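(* Let $\mathrm{E}$ be a vector lattice. The following statements are equivalent. (i) There exists a relatively uniformly complete Archimedean vector lattice $\mathrm{F}$ such that $\mathrm{E}$ is lattice isomorphic to $\mathrm{F}^\sim$. (ii) There exists an inverse system $\mathcal{I}=\left((\mathrm{M}(K_\alpha))_{\alpha\in I},(p_{\beta,\alpha})_{\beta\succcurlyeq\alpha}\right)$ in $\mathbf{NIVL}$, with each $K_\alpha$ a compact Hausdorff space, such that the following holds. (a) For each $\beta\succcurlyeq\alpha$ in $I$ there exist a function $w\in \mathrm{C}(K_\beta)^+$ and a homeomorphism $t:\mathbf{Z}_w^c\to t[\mathbf{Z}_w^c]\subseteq K_\alpha$ onto a dense $\mathrm{C}^\ast$-embedded subspace of $K_\alpha$ such that for every $\mu\in \mathrm{M}(K_\beta)$, $$p_{\beta,\alpha}(\mu)(A)=\int_{t^{-1}[A]} w\,d\mu\quad\text{for every Borel set } A\subseteq K_\alpha.$$ (b) For every $\alpha\in I$ there exists a normal lattice homomorphism $p_\alpha:\mathrm{E}\to \mathrm{M}(K_\alpha)$ such that $\varprojlim\mathcal{I}=\left(\mathrm{E},(p_\alpha)_{\alpha\in I}\right)$ in $\mathbf{NVL}$.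
   Context: All vector lattices are real. $\mathrm{F}^\sim$ is the order dual of $\mathrm{F}$: the vector lattice of order bounded linear functionals on $\mathrm{F}$. $\mathrm{F}$ is relatively uniformly complete if every relatively uniformly Cauchy sequence converges relatively uniformly. For a compact Hausdorff space $K$, $\mathrm{M}(K)$ is the vector lattice of real-valued (signed) Radon measures on the Borel sets of $K$, with pointwise operations and order, and $\mathrm{C}(K)$ is the vector lattice of continuous real functions. For a function $w$, $\mathbf{Z}_w^c=\{x: w(x)\neq 0\}$ is its co-zero set. A subspace $Y\subseteq K$ is $\mathrm{C}^\ast$-embedded if every bounded continuous real function on $Y$ extends to a continuous real function on $K$. A linear map $T$ between vector lattices is a lattice homomorphism if it preserves finite suprema and infima; it is a normal lattice homomorphism if it is moreover order continuous (equivalently, it preserves arbitrary existing suprema and infima); a positive $T:\mathrm{E}\to\mathrm{F}$ is interval preserving if $T[[0,u]]=[0,T(u)]$ for all $0\le u\in\mathrm{E}$. The categories $\mathbf{NVL}$ and $\mathbf{NIVL}$ have vector lattices as objects; morphisms are, respectively, normal lattice homomorphisms and normal interval preserving lattice homomorphisms. An inverse system in a category $\mathbf{C}$ of vector lattices is a pair $((\mathrm{E}_\alpha)_{\alpha\in I},(p_{\beta,\alpha})_{\beta\succcurlyeq\alpha})$ with $I$ a directed set, $\mathrm{E}_\alpha$ vector lattices and $p_{\beta,\alpha}:\mathrm{E}_\beta\to\mathrm{E}_\alpha$ $\mathbf{C}$-morphisms satisfying $p_{\beta,\alpha}\circ p_{\gamma,\beta}=p_{\gamma,\alpha}$ for $\alpha\preccurlyeq\beta\preccurlyeq\gamma$.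 A compatible system in $\mathbf{C}$ is a vector lattice $\mathrm{E}$ with $\mathbf{C}$-morphisms $p_\alpha:\mathrm{E}\to\mathrm{E}_\alpha$ satisfying $p_{\beta,\alpha}\circ p_\beta=p_\alpha$ for $\alpha\preccurlyeq\beta$. The inverse limit in $\mathbf{C}$ is a compatible system $(\mathrm{E},(p_\alpha))$ in $\mathbf{C}$ such that for every compatible system $(\tilde{\mathrm{E}},(\tilde p_\alpha))$ in $\mathbf{C}$ there is a unique $\mathbf{C}$-morphism $s:\tilde{\mathrm{E}}\to\mathrm{E}$ with $p_\alpha\circ s=\tilde p_\alpha$ for all $\alpha$. *)

(* Defs.v *)
From HB Require Import structures.
From mathcomp Require Import all_boot all_order all_algebra.
From mathcomp Require Import all_classical all_reals all_analysis.
From mathcomp Require Import ring lra.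

Set Implicit Arguments.
Unset Strict Implicit.
Unset Printing Implicit Defensive.

Import Order.TTheory GRing.Theory Num.Theory.
Import numFieldNormedType.Exports.

Local Open Scope classical_set_scope.
Local Open Scope ring_scope.

(* The lattice operations are part of this structure rather than inherited from
   [Order.Lattice]: Hierarchy Builder only accepts one common extension of
   [Order.Lattice] and [GRing.Zmodule], which is [Num.RealDomain]. *)
HB.mixin Record Lmodule_POrder_isVectorLattice (R : realType) (V : Type)
    of GRing.Lmodule R V & Order.POrder ring_display V := {
  vsup : V -> V -> V;
  vinf : V -> V -> V;
  vsup_le : forall x y z : V, (vsup x y <= z) = (x <= z) && (y <= z);
  le_vinf : forall x y z : V, (x <= vinf y z) = (x <= y) && (x <= z);
  lev_add2r : forall x y z : V, x <= y -> x + z <= y + z;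
  lev_wpscale : forall (a : R) (x y : V), 0 <= a -> x <= y -> a *: x <= a *: y
}.

#[short(type="vectorLatticeType")]
HB.structure Definition VectorLattice (R : realType) :=
  { V of GRing.Lmodule R V & Order.POrder ring_display V
       & Lmodule_POrder_isVectorLattice R V }.

HB.factory Record Lmodule_isVectorLattice (R : realType) (V : Type)
    of GRing.Lmodule R V := {
  vle : rel V;
  vle_refl : reflexive vle;
  vle_anti : antisymmetric vle;
  vle_trans : transitive vle;
  vle_add2r : forall x y z : V, vle x y -> vle (x + z) (y + z);
  vle_wpscale : forall (a : R) (x y : V),
    0 <= a -> vle x y -> vle (a *: x) (a *: y);
  vle_pos : forall x : V, exists p : V,
    [/\ vle 0 p, vle x p & forall q, vle 0 q -> vle x q -> vle p q]
}.

HB.builders Context (R : realType) (V : Type) of Lmodule_isVectorLattice R V.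

HB.instance Definition _ :=
  Order.Le_isPOrder.Build ring_display V vle_refl vle_anti vle_trans.

Let pos (x : V) : V := sval (cid (vle_pos x)).
Let join (x y : V) : V := pos (x - y) + y.
Let meet (x y : V) : V := - join (- x) (- y).

Let vleN2 (x y : V) : vle (- x) (- y) = vle y x.
Proof.
suff H a b : vle a b -> vle (- b) (- a).
  by apply/idP/idP => [/H|/H//]; rewrite !opprK.
move=> /(vle_add2r (- a - b)).
by rewrite addrA subrr sub0r [- a - b]addrC addrA subrr sub0r.
Qed.

Let joinP (x y z : V) : vle (join x y) z = vle x z && vle y z.
Proof.
rewrite /join /pos; case: cid => p [p0 xp H] /=; apply/idP/andP.
- move=> pz; split; apply: vle_trans pz.
  + by have := vle_add2r y xp; rewrite subrK.
  + by have := vle_add2r y p0; rewrite add0r.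
- move=> [xz yz]; have := @vle_add2r p (z - y) y; rewrite subrK; apply.
  apply: H.
  + by have := vle_add2r (- y) yz; rewrite subrr.
  + exact: vle_add2r.
Qed.

Let meetP (x y z : V) : vle x (meet y z) = vle x y && vle x z.
Proof. by rewrite /meet -vleN2 opprK joinP !vleN2. Qed.

HB.instance Definition _ := Lmodule_POrder_isVectorLattice.Build R V
  joinP meetP vle_add2r vle_wpscale.

HB.end.

Section VectorLatticeTheory.
Variables (R : realType) (V : vectorLatticeType R).
Implicit Types x y z : V.

Lemma lev_add2rE z x y : (x + z <= y + z) = (x <= y).
Proof.
apply/idP/idP => [/(lev_add2r _ _ (- z))|/lev_add2r->//]; by rewrite !addrK.
Qed.

Lemma lev_add2lE z x y : (z + x <= z + y) = (x <= y).
Proof. by rewrite ![z + _]addrC lev_add2rE. Qed.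

Lemma lev_add x y x' y' : x <= y -> x' <= y' -> x + x' <= y + y'.
Proof. by move=> h h'; apply: (le_trans (lev_add2r _ _ x' h)); rewrite lev_add2lE. Qed.

Lemma subv_ge0 x y : (0 <= y - x) = (x <= y).
Proof. by rewrite -[LHS](lev_add2rE x) add0r subrK. Qed.

Lemma lev_subl_addr x y z : (x - y <= z) = (x <= z + y).
Proof. by rewrite -[LHS](lev_add2rE y) subrK. Qed.

Lemma le_vsupl x y : x <= vsup x y.
Proof. by have := lexx (vsup x y); rewrite vsup_le => /andP[]. Qed.

Lemma le_vsupr x y : y <= vsup x y.
Proof. by have := lexx (vsup x y); rewrite vsup_le => /andP[]. Qed.

Lemma vinf_lel x y : vinf x y <= x.
Proof. by have := lexx (vinf x y); rewrite le_vinf => /andP[]. Qed.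

Lemma vinf_ler x y : vinf x y <= y.
Proof. by have := lexx (vinf x y); rewrite le_vinf => /andP[]. Qed.

Lemma riesz_decomposition x1 x2 y : 0 <= x1 -> 0 <= x2 -> 0 <= y ->
  y <= x1 + x2 ->
  exists y1 y2, [/\ 0 <= y1, y1 <= x1, 0 <= y2, y2 <= x2 & y = y1 + y2].
Proof.
move=> x10 x20 y0 yx; exists (vinf y x1), (y - vinf y x1); split.
- by rewrite le_vinf y0.
- exact: vinf_ler.
- by rewrite subv_ge0 vinf_lel.
- suff : y - x2 <= vinf y x1.
    by rewrite !lev_subl_addr addrC.
  by rewrite le_vinf !lev_subl_addr yx andbT -[leLHS]addr0 lev_add2lE.
- by rewrite addrC subrK.
Qed.

Definition vpos x : V := vsup x 0.
Definition vneg x : V := vsup (- x) 0.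

Lemma vpos_ge0 x : 0 <= vpos x. Proof. exact: le_vsupr. Qed.

Lemma vneg_ge0 x : 0 <= vneg x. Proof. exact: le_vsupr. Qed.

Lemma vpos_vneg x : vpos x - vneg x = x.
Proof.
suff -> : vpos x = vneg x + x by rewrite addrC addKr.
apply/le_anti/andP; split.
  rewrite /vpos vsup_le; apply/andP; split.
    by rewrite -lev_subl_addr subrr vneg_ge0.
  by rewrite -lev_subl_addr sub0r le_vsupl.
rewrite -[x in _ + x]opprK lev_subl_addr /vneg vsup_le.
rewrite -[X in X && _](lev_add2rE x) addNr subrK vpos_ge0/=.
by rewrite subv_ge0 le_vsupl.
Qed.

End VectorLatticeTheory.

Section OrderDual.
Variables (R : realType) (F : vectorLatticeType R).

Definition order_bounded (f : F -> R) : Prop :=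
  forall u v : F, exists M : R, forall x, u <= x -> x <= v -> `|f x| <= M.

Definition order_dual_pred : {pred F -> R^o} :=
  fun f => `[< linear f /\ order_bounded f >].

Record orderDual := OrderDual {
  order_dual_fun :> F -> R^o ;
  _ : order_dual_fun \in order_dual_pred
}.

HB.instance Definition _ := [isSub for order_dual_fun].
HB.instance Definition _ := [Choice of orderDual by <:].

Lemma order_dual_submod_closed : submod_closed order_dual_pred.
Proof.
split=> [|a f g].
  apply/asboolP; split=> [k x y|u v]; first by rewrite scaler0 addr0.
  by exists 0 => x _ _; rewrite normr0.
move=> /asboolP[lf bf] /asboolP[lg bg]; apply/asboolP; split=> [k x y|u v].
  rewrite -[LHS]/(a *: f _ + g _) -[RHS]/(k *: (a *: f x + g x) + (a *: f y + g y)).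
  by rewrite lf lg !scalerDr addrACA !scalerA [a * k]mulrC.
have [M HM] := bf u v; have [N HN] := bg u v.
exists (`|a| * M + N) => x ux xv; rewrite -[X in `|X|]/(a * f x + g x).
rewrite (le_trans (ler_normD _ _))// lerD ?HN// normrM.
by rewrite ler_wpM2l ?HM.
Qed.

HB.instance Definition _ :=
  GRing.isSubmodClosed.Build _ _ order_dual_pred order_dual_submod_closed.
HB.instance Definition _ := [SubChoice_isSubLmodule of orderDual by <:].

Definition order_dual_le : rel orderDual :=
  fun f g => `[< forall x : F, 0 <= x -> (f x : R) <= g x >].

Lemma order_dual_linear (f : orderDual) : linear f.
Proof. by case: f => f /= /asboolP[]. Qed.

Lemma order_dual_bounded (f : orderDual) : order_bounded f.
Proof. by case: f => f /= /asboolP[]. Qed.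

Lemma order_dual_funD (f g : orderDual) x : (f + g) x = f x + g x :> R.
Proof. by []. Qed.

Lemma order_dual_funZ a (f : orderDual) x : (a *: f) x = a * f x :> R.
Proof. by []. Qed.

Lemma order_dual_fun0 x : (0 : orderDual) x = 0 :> R.
Proof. by []. Qed.

Lemma order_dualP (f g : orderDual) : f =1 g -> f = g.
Proof. by move=> fg; apply/val_inj/funext. Qed.

Lemma order_dual_le_refl : reflexive order_dual_le.
Proof. by move=> f; apply/asboolP. Qed.

Lemma order_dual_le_anti : antisymmetric order_dual_le.
Proof.
move=> f g /andP[/asboolP fg /asboolP gf]; apply: order_dualP => x.
have E y : 0 <= y -> f y = g y by move=> y0; apply/le_anti; rewrite fg ?gf.
rewrite -(vpos_vneg x) addrC -scaleN1r !order_dual_linear.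
by rewrite !E ?vpos_ge0 ?vneg_ge0.
Qed.

Lemma order_dual_le_trans : transitive order_dual_le.
Proof.
move=> g f h /asboolP fg /asboolP gh; apply/asboolP => x x0.
by rewrite (le_trans (fg x x0))// gh.
Qed.

Lemma order_dual_le_add2r (f g h : orderDual) :
  order_dual_le f g -> order_dual_le (f + h) (g + h).
Proof.
by move=> /asboolP fg; apply/asboolP => x x0; rewrite !order_dual_funD lerD2r fg.
Qed.

Lemma order_dual_le_wpscale (a : R) (f g : orderDual) :
  0 <= a -> order_dual_le f g -> order_dual_le (a *: f) (a *: g).
Proof.
move=> a0 /asboolP fg; apply/asboolP => x x0.
by rewrite !order_dual_funZ ler_wpM2l// fg.
Qed.

Section RieszKantorovich.
Variable f : orderDual.

Let fD x y : f (x + y) = f x + f y :> R.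
Proof. by rewrite -[x]scale1r order_dual_linear !scale1r. Qed.
Let f0 : f 0 = 0 :> R.
Proof. by apply: (@addrI _ (f 0)); rewrite -fD !addr0. Qed.
Let fZ a x : f (a *: x) = a * f x :> R.
Proof. by rewrite -[a *: x]addr0 order_dual_linear f0 addr0. Qed.

Let S x : set R := [set (f y : R) | y in [set y | 0 <= y /\ y <= x]].
Let g x : R := sup (S x).

Let hsS x : 0 <= x -> has_sup (S x).
Proof.
move=> x0; split; first by exists (f 0), 0.
have [M HM] := order_dual_bounded f 0 x.
by exists M => _ [y [y0 yx] <-]; rewrite (le_trans (ler_norm _))// HM.
Qed.

Let g_ub x y : 0 <= y -> y <= x -> f y <= g x.
Proof.
by move=> y0 yx; apply: ub_le_sup; [apply: (hsS _).2; apply: le_trans yx|exists y].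
Qed.

Let g_le x M : 0 <= x -> (forall y, 0 <= y -> y <= x -> f y <= M) -> g x <= M.
Proof.
move=> x0 H; apply: ge_sup; first exact: (hsS x0).1.
by move=> _ [y [y0 yx] <-]; exact: H.
Qed.

Let g_ge0 x : 0 <= x -> 0 <= g x.
Proof. by move=> x0; rewrite -f0 g_ub. Qed.

Let g0 : g 0 = 0.
Proof.
apply/le_anti; rewrite g_ge0// andbT; apply: g_le => // y y0 y0'.
by have -> : y = 0; [apply/le_anti; rewrite y0 y0'|rewrite f0].
Qed.

Let gD x y : 0 <= x -> 0 <= y -> g (x + y) = g x + g y.
Proof.
move=> x0 y0; apply/le_anti/andP; split.
  have xy0 : 0 <= x + y by rewrite -[0]addr0 lev_add.
  apply: g_le => // z z0 zxy.
  have [z1 [z2 [z10 z1x z20 z2y ->]]] := riesz_decomposition x0 y0 z0 zxy.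
  by rewrite fD lerD// g_ub.
rewrite -lerBrDr; apply: g_le => // z z0 zx.
rewrite lerBrDr addrC -lerBrDr; apply: g_le => // t t0 ty.
by rewrite lerBrDr -fD g_ub// 1?addrC ?lev_add// -[0]addr0 lev_add.
Qed.

Let gZ a x : 0 <= a -> 0 <= x -> g (a *: x) = a * g x.
Proof.
rewrite le_eqVlt => /predU1P[<-|a0] x0; first by rewrite scale0r mul0r.
have H b y : 0 < b -> 0 <= y -> g (b *: y) <= b * g y.
  move=> b0 y0; have by0 : 0 <= b *: y by rewrite -(scaler0 _ b) lev_wpscale// ltW.
  apply: g_le => // z z0 zy; rewrite -[z]scale1r -(divff (lt0r_neq0 b0)) -scalerA fZ.
  rewrite ler_pM2l// g_ub//; first by rewrite -(scaler0 _ b^-1) lev_wpscale// invr_ge0 ltW.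
  rewrite -[y]scale1r -(mulVf (lt0r_neq0 b0)) -scalerA lev_wpscale//.
  by rewrite invr_ge0 ltW.
apply/le_anti; rewrite H//=.
have ax0 : 0 <= a *: x by rewrite -(scaler0 _ a) lev_wpscale// ltW.
have := H a^-1 (a *: x); rewrite invr_gt0 => /(_ a0 ax0).
by rewrite scalerA mulVf ?lt0r_neq0// scale1r mulrC ler_pdivlMr// mulrC.
Qed.

Let h x : R^o := g (vpos x) - g (vneg x).

Let hE a b : 0 <= a -> 0 <= b -> h (a - b) = g a - g b.
Proof.
move=> a0 b0; apply/eqP; rewrite subr_eq addrAC eq_sym subr_eq eq_sym -!gD ?vpos_ge0 ?vneg_ge0//.
by rewrite -{1}[vpos _](subrK (vneg (a - b))) vpos_vneg addrAC subrK.
Qed.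

Let h_linear : linear h.
Proof.
move=> k x y; rewrite -{1}(vpos_vneg x) -{1}(vpos_vneg y).
have ge0Z c z : 0 <= c -> 0 <= z -> 0 <= c *: z :> F.
  by move=> c0 z0; rewrite -(scaler0 _ c) lev_wpscale.
have ge0D (z t : F) : 0 <= z -> 0 <= t -> 0 <= z + t.
  by move=> z0 t0; rewrite -[0]addr0 lev_add.
have [k0|k0] := leP 0 k.
  rewrite scalerBr addrACA -opprD hE ?ge0D ?ge0Z ?vpos_ge0 ?vneg_ge0//.
  rewrite !gD ?ge0Z ?vpos_ge0 ?vneg_ge0// !gZ ?vpos_ge0 ?vneg_ge0//.
  by rewrite /h /GRing.scale/= mulrBr addrACA -opprD.
have {}k0 : 0 <= - k by rewrite oppr_ge0 ltW.
rewrite -[k]opprK scaleNr -scalerN opprB scalerBr.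
rewrite addrACA -opprD hE ?ge0D ?ge0Z ?vpos_ge0 ?vneg_ge0//.
rewrite !gD ?ge0Z ?vpos_ge0 ?vneg_ge0// !gZ ?vpos_ge0 ?vneg_ge0//.
by rewrite /h /GRing.scale/= opprK !mulNr mulrBr !opprD opprK addrACA [in LHS]addrC -!addrA addrC -!addrA; lra.
Qed.

Let hE0 x : 0 <= x -> h x = g x.
Proof. by move=> x0; rewrite -{1}[x]subr0 hE// g0 subr0. Qed.

Let h_bounded : order_bounded h.
Proof.
move=> u v; exists (`|h u : R| + `|h v : R|) => x ux xv.
have mono a b : a <= b -> (h a : R) <= h b.
  move=> ab; rewrite -subr_ge0 -[h b - h a]addrC -scaleN1r -h_linear scaleN1r.
  by rewrite addrC hE0 ?g_ge0// subv_ge0.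
rewrite ler_norml opprD; apply/andP; split.
  by rewrite (le_trans _ (mono _ _ ux))// lerBlDr (le_trans (lerNnormlW (lexx _)))// lerDl.
by rewrite (le_trans (mono _ _ xv))// (le_trans (ler_norm _))// lerDr.
Qed.

Lemma order_dual_pos : exists p : orderDual,
  [/\ order_dual_le 0 p, order_dual_le f p
    & forall q, order_dual_le 0 q -> order_dual_le f q -> order_dual_le p q].
Proof.
have hP : h \in order_dual_pred by apply/asboolP.
exists (OrderDual hP); split; [apply/asboolP => x x0 ..|].
- by rewrite [leRHS]hE0 ?g_ge0.
- by rewrite [leRHS]hE0 ?g_ub.
move=> q /asboolP q0 /asboolP fq; apply/asboolP => x x0.
rewrite [leLHS]hE0//; apply: g_le => // y y0 yx; rewrite (le_trans (fq _ y0))//.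
rewrite -subr_ge0 -[q x - q y]addrC -scaleN1r -order_dual_linear scaleN1r addrC.
by apply: q0; rewrite subv_ge0.
Qed.

End RieszKantorovich.

HB.instance Definition _ := Lmodule_isVectorLattice.Build R orderDual
  order_dual_le_refl order_dual_le_anti order_dual_le_trans order_dual_le_add2r
  order_dual_le_wpscale order_dual_pos.

Lemma order_dual_leP (f g : orderDual) :
  f <= g <-> forall x : F, 0 <= x -> (f x : R) <= g x.
Proof. by split=> /asboolP. Qed.

End OrderDual.

HB.mixin Record isCompactHausdorff (K : Type) of Topological K := {
  compactT : compact [set: K];
  hausdorffT : hausdorff_space K
}.

#[short(type="compactHausdorffType")]
HB.structure Definition CompactHausdorff :=
  { K of Topological K & isCompactHausdorff K }.

Definition borel (K : topologicalType) : set (set K) := <<s @open K >>.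
Arguments borel : clear implicits.

(* The library's [measurableType]s are pointed. A compact space may be empty, so
   its Borel sigma-algebra is turned into a [measurableType] only relatively to
   a given point, and definitions that do not need it use [borel] directly. *)
Definition pointed_at (K : topologicalType) (x0 : K) : Type := K.
HB.instance Definition _ (K : topologicalType) (x0 : K) :=
  Choice.copy (pointed_at x0) K.
HB.instance Definition _ (K : topologicalType) (x0 : K) :=
  isPointed.Build (pointed_at x0) x0.

Definition borelType (K : topologicalType) (x0 : K) :=
  @g_sigma_algebraType (pointed_at x0) (@open K).
HB.instance Definition _ (K : topologicalType) (x0 : K) :=
  Measurable.copy (borelType x0) (@g_sigma_algebraType (pointed_at x0) (@open K)).

Lemma borelE (K : topologicalType) (x0 : K) (A : set (borelType x0)) :
  measurable A = borel K A.
Proof. by []. Qed.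

Section Radon.
Variables (R : realType) (K : topologicalType).
Implicit Type mu : set K -> R.

Definition borel_partition (A : set K) (n : nat) (F : nat -> set K) : Prop :=
  [/\ forall i, (i < n)%N -> borel K (F i), trivIset `I_n F
    & \bigcup_(i in `I_n) F i = A].

Definition total_variation mu (A : set K) : \bar R :=
  ereal_sup [set x | exists n F, borel_partition A n F /\
                                 x = (\sum_(i < n) `|mu (F i)|)%:E].

Definition borel_sigma_additive mu : Prop :=
  forall F : nat -> set K, (forall n, borel K (F n)) -> trivIset setT F ->
  (fun n => \sum_(0 <= i < n) mu (F i)) @ \oo --> mu (\bigcup_n F n).

Definition inner_regular mu : Prop :=
  forall A, borel K A -> total_variation mu A =
    ereal_sup [set total_variation mu C | C in [set C | compact C /\ C `<=` A]].

(* A signed measure is a function on all subsets, normalized to be 0 outside the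
   Borel sets, so that equality of functions is equality of measures. *)
Definition is_radon mu : Prop :=
  [/\ forall A, ~ borel K A -> mu A = 0, borel_sigma_additive mu
    & inner_regular mu].

End Radon.

Section BorelTheory.
Variable K : topologicalType.

Lemma borel0 : borel K set0.
Proof. exact: sigma_algebra0. Qed.

Lemma borelC A : borel K A -> borel K (~` A).
Proof. by move=> mA; rewrite -setTD; exact: sigma_algebraCD. Qed.

Lemma borel_bigcup (F : nat -> set K) :
  (forall n, borel K (F n)) -> borel K (\bigcup_n F n).
Proof. exact: sigma_algebra_bigcup. Qed.

Lemma borelU A B : borel K A -> borel K B -> borel K (A `|` B).
Proof. move=> mA mB; rewrite -bigcup2E; apply: borel_bigcup => -[|[|n]]//=.
exact: borel0.
Qed.

Lemma borelI A B : borel K A -> borel K B -> borel K (A `&` B).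
Proof.
move=> mA mB; rewrite -[_ `&` _]setCK setCI.
by apply: borelC; apply: borelU; exact: borelC.
Qed.

Lemma borelD A B : borel K A -> borel K B -> borel K (A `\` B).
Proof. by move=> mA mB; rewrite setDE; apply: borelI => //; exact: borelC. Qed.

End BorelTheory.

Lemma borel_compact (K : compactHausdorffType) (C : set K) :
  compact C -> borel K C.
Proof.
move=> cC; rewrite -[C]setCK; apply: borelC; apply: sub_sigma_algebra.
by apply: closed_openC; exact: compact_closed hausdorffT cC.
Qed.

Section ChargeOf.
Variables (R : realType) (K : topologicalType) (mu : set K -> R).
Hypothesis mu_add : borel_sigma_additive mu.

Lemma borel_measure0 : mu set0 = 0.
Proof.
have h := @mu_add (fun=> set0) (fun=> @borel0 K) (@trivIset_set0 _ _ _).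
rewrite bigcup0// in h.
have h1 : (fun n => \sum_(0 <= i < n.+1) mu set0) @ \oo --> mu set0.
  by move: h; rewrite -cvg_shiftS.
have h2 : (fun n => \sum_(0 <= i < n.+1) mu set0) @ \oo --> mu set0 + mu set0.
  under eq_fun do rewrite big_nat_recr//=.
  by apply: cvgD => //; exact: cvg_cst.
apply: (@addrI _ (mu set0)); rewrite addr0; apply/esym.
exact: (cvg_unique (@Rhausdorff R) h1 h2).
Qed.

Definition charge_of (x0 : K) (_ : borel_sigma_additive mu) :
  set (borelType x0) -> \bar R := fun A => (mu A)%:E.
Arguments charge_of : clear implicits.

Section Charge.
Variable x0 : K.
Local Notation nu := (charge_of x0 mu_add).

Let nu0 : nu set0 = 0%E.
Proof. by rewrite /charge_of borel_measure0. Qed.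

Let nu_fin A : measurable A -> nu A \is a fin_num.
Proof. by []. Qed.

Let nu_add : semi_sigma_additive nu.
Proof.
move=> F mF tF mUF; rewrite /charge_of.
under eq_fun do rewrite sumEFin.
by apply: cvg_EFin; [exact: nearW|exact: mu_add].
Qed.

HB.instance Definition _ := isCharge.Build _ (borelType x0) R nu nu0 nu_fin nu_add.

End Charge.

Lemma borel_measureU A B : borel K A -> borel K B -> A `&` B = set0 ->
  mu (A `|` B) = mu A + mu B.
Proof.
move=> mA mB AB; have [x0|K0] := pselect (exists x0 : K, True).
  have [{}x0 _] := cid x0.
  have /(congr1 fine) := @chargeU _ (borelType x0) R (charge_of x0 mu_add) A B mA mB AB.
  by [].
have E (S : set K) : S = set0 by apply/seteqP; split=> x //; case: K0; exists x.
by rewrite (E (_ `|` _)) (E A) (E B) borel_measure0 addr0.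
Qed.

Lemma borel_measureI A B : borel K A -> borel K B ->
  mu A = mu (A `&` B) + mu (A `\` B).
Proof.
move=> mA mB; rewrite -borel_measureU ?setUIDK//; first exact: borelI.
  exact: borelD.
by rewrite setDE setIACA setICr setI0.
Qed.

Lemma borel_measure_bigcup (F : nat -> set K) n :
  (forall i, (i < n)%N -> borel K (F i)) -> trivIset `I_n F ->
  borel K (\bigcup_(i in `I_n) F i) /\
  mu (\bigcup_(i in `I_n) F i) = \sum_(i < n) mu (F i).
Proof.
elim: n => [_ _|n IH mF tF].
  by rewrite II0 bigcup_set0 big_ord0 borel_measure0; split=> //; exact: borel0.
have [||mU E] := IH.
- by move=> i /ltnW; exact: mF.
- by apply: sub_trivIset tF => i /= /ltnW.
rewrite IIS bigcup_setU bigcup_set1 big_ord_recr/= -E; split.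
  by apply: borelU => //; exact: mF.
rewrite borel_measureU//; first exact: mF.
rewrite setI_bigcupl; apply: bigcup0 => i /= ni.
by have /trivIsetP := tF; apply => //=; [exact: ltnW|rewrite ltn_eqF].
Qed.

Lemma borel_hahn : exists2 P, borel K P &
  (forall A, borel K A -> A `<=` P -> 0 <= mu A) /\
  (forall A, borel K A -> A `&` P = set0 -> mu A <= 0).
Proof.
have [x0|K0] := pselect (exists x0 : K, True); last first.
  have E (S : set K) : S = set0 by apply/seteqP; split=> x //; case: K0; exists x.
  exists set0; first exact: borel0.
  by split=> A; rewrite (E A) borel_measure0.
have [{}x0 _] := cid x0.
have [P [N [[mP Pge0] [mN Nle0] PNT PN0]]] := Hahn_decomposition (charge_of x0 mu_add).
exists P => //; split=> A mA AP.
  by have := Pge0 A mA AP; rewrite /charge_of lee_fin.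
have AN : A `<=` N.
  move=> x Ax; have : [set: K] x by [].
  rewrite -PNT => -[Px|//]; have : (A `&` P) x by [].
  by rewrite AP.
by have := Nle0 A mA AN; rewrite /charge_of lee_fin.
Qed.

End ChargeOf.
Arguments charge_of {R K mu} x0 _ _.

Lemma inner_regularP (R : realType) (K : compactHausdorffType) (mu : set K -> R) :
  borel_sigma_additive mu ->
  inner_regular mu <->
  forall A (e : R), borel K A -> 0 < e -> exists C, [/\ compact C, C `<=` A &
    forall B, borel K B -> B `<=` A `\` C -> `|mu B| <= e].
Proof.
move=> mu_add.
have [P mP [Pge0 Ple0]] := borel_hahn mu_add.
pose V A := mu (A `&` P) - mu (A `\` P).
have p0 A : borel K A -> 0 <= mu (A `&` P).
  by move=> mA; apply: Pge0; [exact: borelI|exact: subIsetr].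
have n0 A : borel K A -> mu (A `\` P) <= 0.
  by move=> mA; apply: Ple0; [exact: borelD|rewrite setDE -setIA setICl setI0].
have absV A : borel K A -> `|mu A| <= V A.
  move=> mA; rewrite (borel_measureI mu_add mA mP) /V.
  have := p0 _ mA; have := n0 _ mA => *.
  by rewrite ler_norml; apply/andP; split; lra.
have VU A B : borel K A -> borel K B -> A `&` B = set0 -> V (A `|` B) = V A + V B.
  move=> mA mB AB; rewrite /V setIUl setDUl !(borel_measureU mu_add).
  - by rewrite opprD addrACA.
  - exact: borelD.
  - exact: borelD.
  - by rewrite !setDE setIACA AB set0I.
  - exact: borelI.
  - exact: borelI.
  - by rewrite setIACA AB set0I.
have V_ge0 A : borel K A -> 0 <= V A.
  by move=> mA; rewrite subr_ge0 (le_trans (n0 _ mA))// p0.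
have Vle A B : borel K A -> borel K B -> A `<=` B -> V A <= V B.
  move=> mA mB AB; rewrite -(setDUK AB) VU ?setIDK//; last first.
  - by rewrite setDE setICA setICr setI0.
  - exact: borelD.
  - by rewrite lerDl V_ge0//; exact: borelD.
have VD A B : borel K A -> borel K B -> A `<=` B -> V B = V A + V (B `\` A).
  move=> mA mB AB; rewrite -VU ?setDUK//; first exact: borelD.
  by rewrite setDE setICA setICr setI0.
have TV A : borel K A -> total_variation mu A = (V A)%:E.
  move=> mA; apply/le_anti/andP; split.
    apply: ge_ereal_sup => _ [n [F [[mF tF FA] ->]]]; rewrite lee_fin.
    have mFP i : (i < n)%N -> borel K (F i `&` P).
      by move=> /mF ?; exact: borelI.
    have mFN i : (i < n)%N -> borel K (F i `\` P).
      by move=> /mF ?; exact: borelD.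
    have tFP : trivIset `I_n (fun i => F i `&` P) by exact: trivIset_setIr.
    have tFN : trivIset `I_n (fun i => F i `\` P).
      exact: (trivIset_setIr (G := fun=> ~` P) tF).
    have [_ EP] := borel_measure_bigcup mu_add mFP tFP.
    have [_ EN] := borel_measure_bigcup mu_add mFN tFN.
    have -> : V A = \sum_(i < n) V (F i).
      rewrite /V sumrB -EP -EN -FA; congr (mu _ - mu _).
        by rewrite setI_bigcupl.
      by rewrite setDE setI_bigcupl; apply: eq_bigcupr => i _; rewrite setDE.
    apply: ler_sum => i _; by apply: absV; exact: mF.
  apply: ereal_sup_ubound; exists 2%N, (bigcup2 (A `&` P) (A `\` P)); split.
    split.
    - by move=> [|[|i]]//= _; [exact: borelI|exact: borelD].
    - apply/trivIsetP => -[|[|i]] [|[|j]]//= _ _ _.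
      + by rewrite setDE setIACA setICr setI0.
      + by rewrite setIC setDE setIACA setICr setI0.
    - by rewrite bigcup2inE setUIDK.
  rewrite big_ord_recl big_ord1/= /V ger0_norm ?p0//.
  by rewrite ler0_norm ?n0.
split=> [reg A e mA e0|reg A mA].
  have := reg A mA; rewrite TV// => E.
  have : (ereal_sup [set total_variation mu C | C in [set C | compact C /\ C `<=` A]]
     \is a fin_num) by rewrite -E.
  move=> /(ub_ereal_sup_adherent e0)[_ [C [cC CA] <-]].
  have mC := borel_compact cC.
  rewrite -E TV// -EFinB lte_fin => h; exists C; split=> // B mB BAC.
  rewrite (le_trans (absV _ mB))// (le_trans (Vle _ _ mB (borelD mA mC) BAC))//.
  by move: h; rewrite (VD _ _ mC mA CA) => h; apply/ltW; lra.
apply/le_anti/andP; split; last first.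
  apply: ge_ereal_sup => _ [C [cC CA] <-].
  have mC := borel_compact cC.
  by rewrite !TV// lee_fin Vle.
rewrite TV//; apply/lee_addgt0Pr => e e0.
have [C [cC CA HC]] := reg A (e / 2) mA (divr_gt0 e0 (ltr0n _ 2)).
have mC := borel_compact cC; have mAC := borelD mA mC.
apply: (@le_trans _ _ ((V C)%:E + e%:E)%E); last first.
  by apply: leeD => //; rewrite -TV//; apply: ereal_sup_ubound; exists C.
rewrite -EFinD lee_fin (VD _ _ mC mA CA) lerD2l /V.
have := HC _ (borelI mAC mP) (@subIsetl _ _ _).
have := HC _ (borelD mAC mP) (@subDsetl _ _ _).
rewrite !ler_norml => /andP[? ?] /andP[? ?]; lra.
Qed.

Section RadonMeasures.
Variables (R : realType) (K : compactHausdorffType).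
Implicit Types (A B C : set K).

Definition radon_pred : {pred set K -> R^o} := fun mu => `[< is_radon mu >].

Record radonMeasure := RadonMeasure {
  radon_fun :> set K -> R^o ;
  _ : radon_fun \in radon_pred
}.

HB.instance Definition _ := [isSub for radon_fun].
HB.instance Definition _ := [Choice of radonMeasure by <:].

Lemma radon_submod_closed : submod_closed radon_pred.
Proof.
split=> [|a mu nu].
  have add0 : borel_sigma_additive (0 : set K -> R).
    by move=> F mF tF; under eq_fun do rewrite big1//; exact: cvg_cst.
  apply/asboolP; split=> //; apply/(inner_regularP add0) => A e mA e0.
  exists set0; split; [exact: compact0|exact: sub0set|move=> B _ _].
  by rewrite normr0 ltW.
move=> /asboolP[mu0 muD /(inner_regularP muD) mur].
move=> /asboolP[nu0 nuD /(inner_regularP nuD) nur].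
have lamD : borel_sigma_additive ((a *: mu + nu) : set K -> R).
  move=> F mF tF; under eq_fun do rewrite big_split/= -mulr_sumr.
  by apply: cvgD; [apply: cvgMr; exact: muD|exact: nuD].
apply/asboolP; split=> // [A nA|].
  by rewrite -[LHS]/(a * mu A + nu A) mu0// nu0// mulr0 addr0.
apply/(inner_regularP lamD) => A e mA e0.
have a0 : 0 < `|a| + 1 by rewrite ltr_wpDl.
have [C [cC CA HC]] := mur A (e / (`|a| + 1) / 2) mA
  (divr_gt0 (divr_gt0 e0 a0) (ltr0n _ 2)).
have [D [cD DA HD]] := nur A (e / 2) mA (divr_gt0 e0 (ltr0n _ 2)).
exists (C `|` D); split; [exact: compactU|by rewrite subUset|].
move=> B mB; rewrite setDUr subsetI => -[BC BD].
rewrite -[X in `|X|]/(a * mu B + nu B) [leRHS]splitr.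
rewrite (le_trans (ler_normD _ _))// lerD ?HD// normrM.
apply: le_trans (ler_wpM2l (normr_ge0 a) (HC _ mB BC)) _.
rewrite mulrA ler_pM2r ?invr_gt0// mulrCA ger_pMr// ler_pdivrMr// mul1r.
by rewrite lerDl.
Qed.

HB.instance Definition _ :=
  GRing.isSubmodClosed.Build _ _ radon_pred radon_submod_closed.
HB.instance Definition _ := [SubChoice_isSubLmodule of radonMeasure by <:].

Definition radon_le : rel radonMeasure :=
  fun mu nu => `[< forall A, borel K A -> (mu A : R) <= nu A >].

Lemma radonP (mu : radonMeasure) : is_radon (mu : set K -> R).
Proof. by case: mu => mu /= /asboolP. Qed.

Lemma radon_sigma_additive (mu : radonMeasure) :
  borel_sigma_additive (mu : set K -> R).
Proof. by have [] := radonP mu. Qed.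

Lemma radon_funD (mu nu : radonMeasure) A : (mu + nu) A = mu A + nu A :> R.
Proof. by []. Qed.

Lemma radon_funZ a (mu : radonMeasure) A : (a *: mu) A = a * mu A :> R.
Proof. by []. Qed.

Lemma radon_fun0 A : (0 : radonMeasure) A = 0 :> R.
Proof. by []. Qed.

Lemma radon_eqP (mu nu : radonMeasure) :
  (forall A, borel K A -> mu A = nu A) -> mu = nu.
Proof.
move=> E; apply/val_inj/funext => A /=.
have [/E//|nA] := pselect (borel K A).
by have [-> // _ _] := radonP mu; have [-> // _ _] := radonP nu.
Qed.

Lemma radon_le_refl : reflexive radon_le.
Proof. by move=> f; apply/asboolP. Qed.

Lemma radon_le_anti : antisymmetric radon_le.
Proof.
move=> mu nu /andP[/asboolP mn /asboolP nm]; apply: radon_eqP => A mA.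
by apply/le_anti; rewrite mn ?nm.
Qed.

Lemma radon_le_trans : transitive radon_le.
Proof.
move=> g f h /asboolP fg /asboolP gh; apply/asboolP => A mA.
by rewrite (le_trans (fg A mA))// gh.
Qed.

Lemma radon_le_add2r (f g h : radonMeasure) :
  radon_le f g -> radon_le (f + h) (g + h).
Proof.
by move=> /asboolP fg; apply/asboolP => A mA; rewrite !radon_funD lerD2r fg.
Qed.

Lemma radon_le_wpscale (a : R) (f g : radonMeasure) :
  0 <= a -> radon_le f g -> radon_le (a *: f) (a *: g).
Proof.
move=> a0 /asboolP fg; apply/asboolP => A mA.
by rewrite !radon_funZ ler_wpM2l// fg.
Qed.

Lemma radon_pos (mu : radonMeasure) : exists p : radonMeasure,
  [/\ radon_le 0 p, radon_le mu p
    & forall q, radon_le 0 q -> radon_le mu q -> radon_le p q].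
Proof.
have [mu0 muD mur] := radonP mu.
have [P mP [Pge0 Ple0]] := borel_hahn muD.
pose p A : R^o := if `[< borel K A >] then mu (A `&` P) else 0.
have pE A : borel K A -> p A = mu (A `&` P) by move=> mA; rewrite /p asboolT.
have pD : borel_sigma_additive (p : set K -> R).
  move=> F mF tF; under eq_fun do under eq_bigr do rewrite pE//.
  rewrite pE; last exact: borel_bigcup.
  rewrite setI_bigcupl; apply: muD => [n|]; first exact: borelI.
  exact: trivIset_setIr.
have pP : p \in radon_pred.
  apply/asboolP; split=> // [A nA|]; first by rewrite /p asboolF.
  apply/(inner_regularP pD) => A e mA e0.
  have [C [cC CA HC]] := (inner_regularP muD).1 mur A e mA e0.
  exists C; split=> // B mB BAC; rewrite pE//; apply: HC; first exact: borelI.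
  by apply: subset_trans BAC; exact: subIsetl.
exists (RadonMeasure pP); split.
- by apply/asboolP => A mA /=; rewrite pE//; apply: Pge0 => //; exact: borelI.
- apply/asboolP => A mA /=; rewrite pE// (borel_measureI muD mA mP) gerDl; apply: Ple0; first exact: borelD.
  by rewrite setDE -setIA setICl setI0.
move=> q /asboolP q0 /asboolP muq; apply/asboolP => A mA /=.
rewrite pE// (borel_measureI (@radon_sigma_additive q) mA mP).
rewrite -[leLHS]addr0 lerD//; first by apply: muq; exact: borelI.
by apply: q0; exact: borelD.
Qed.

HB.instance Definition _ := Lmodule_isVectorLattice.Build R radonMeasure
  radon_le_refl radon_le_anti radon_le_trans radon_le_add2r radon_le_wpscale
  radon_pos.

Lemma radon_leP (mu nu : radonMeasure) :
  mu <= nu <-> forall A, borel K A -> (mu A : R) <= nu A.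
Proof. by split=> /asboolP. Qed.

End RadonMeasures.

(* The integral with respect to a signed measure is the difference of the
   integrals with respect to its Jordan parts, which do not depend on the Hahn
   decomposition [Hahn_decomposition_uniq]. *)
Definition charge_integral d (T : measurableType d) (R : realType)
    (nu : {charge set T -> \bar R}) (D : set T) (f : T -> R) : \bar R :=
  let PN := svalP (cid (svalP (cid (Hahn_decomposition nu)))) in
  (\int[jordan_pos PN]_(x in D) (f x)%:E
   - \int[jordan_neg PN]_(x in D) (f x)%:E)%E.

(* The only measure on an empty space is 0; on a nonempty one the choice of the
   point at which it is pointed is irrelevant. *)
Definition radon_integral (R : realType) (K : compactHausdorffType)
    (mu : radonMeasure R K) (D : set K) (f : K -> R) : \bar R :=
  if pselect (exists _ : K, True) is left K0 then
    charge_integral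
      (charge_of (sval (cid K0)) (@radon_sigma_additive R K mu)) D f
  else 0%E.

Definition cozero (R : realType) (K : Type) (w : K -> R) : set K :=
  [set x | w x != 0].

Definition homeomorphism (X Y : topologicalType) (t : X -> Y) : Prop :=
  continuous t /\
  exists t' : Y -> X, [/\ continuous t', cancel t t' & cancel t' t].

Definition Cstar_embedded (R : realType) (K : topologicalType) (Y : set K) : Prop :=
  forall f : Y -> R, continuous f -> (exists M, forall y, `|f y| <= M) ->
  exists g : K -> R, continuous g /\ forall y : Y, g (\val y) = f y.

Section RelativelyUniform.
Variables (R : realType) (F : vectorLatticeType R).

Definition vabs (x : F) : F := vsup x (- x).

Definition archimedean_vl : Prop :=
  forall x : F, 0 <= x -> infimums [set n.+1%:R^-1 *: x | n in [set: nat]] 0.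

Definition ru_cauchy (x : nat -> F) : Prop :=
  exists2 u : F, 0 <= u & forall e : R, 0 < e -> exists N, forall m n,
    (N <= m)%N -> (N <= n)%N -> vabs (x m - x n) <= e *: u.

Definition ru_converges_to (x : nat -> F) (l : F) : Prop :=
  exists2 u : F, 0 <= u & forall e : R, 0 < e -> exists N, forall n,
    (N <= n)%N -> vabs (x n - l) <= e *: u.

Definition ru_complete : Prop :=
  forall x : nat -> F, ru_cauchy x -> exists l, ru_converges_to x l.

End RelativelyUniform.
Arguments archimedean_vl {R} F.
Arguments ru_complete {R} F.

Section Morphisms.
Variables (R : realType) (E F : vectorLatticeType R).
Implicit Type T : E -> F.

Definition lattice_hom T : Prop :=
  [/\ linear T, {morph T : x y / vsup x y} & {morph T : x y / vinf x y}].

Definition lattice_isomorphic : Prop :=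
  exists2 T : E -> F, lattice_hom T & bijective T.

Definition decreases_to_0 (D : set E) : Prop :=
  [/\ D !=set0,
      forall x y, D x -> D y -> exists z, [/\ D z, z <= x & z <= y]
    & infimums D 0].

Definition order_continuous T : Prop :=
  forall D, decreases_to_0 D -> infimums [set vabs (T x) | x in D] 0.

Definition normal_lattice_hom T : Prop := lattice_hom T /\ order_continuous T.

Definition interval_preserving T : Prop :=
  (forall x, 0 <= x -> 0 <= T x) /\
  forall u, 0 <= u ->
    [set T x | x in [set x | 0 <= x <= u]] = [set y | 0 <= y <= T u].

End Morphisms.
Arguments lattice_isomorphic {R} E F.

(* The class of morphisms of a category whose objects are all vector lattices. *)
Definition vl_category (R : realType) :=
  forall E F : vectorLatticeType R, (E -> F) -> Prop.

Definition NVL (R : realType) : vl_category R :=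
  fun E F T => normal_lattice_hom T.

Definition NIVL (R : realType) : vl_category R :=
  fun E F T => normal_lattice_hom T /\ interval_preserving T.

Definition directed_set (I : Type) (le : I -> I -> Prop) : Prop :=
  [/\ exists _ : I, True,
      forall a, le a a,
      forall a b c, le a b -> le b c -> le a c
    & forall a b, exists c, le a c /\ le b c].

Section InverseLimits.
Variables (R : realType) (C : vl_category R).
Variables (I : Type) (le : I -> I -> Prop) (E : I -> vectorLatticeType R).

(* [p b a] is only meaningful, hence only constrained, when [le a b] holds. *)
Variable p : forall b a, E b -> E a.

Definition inverse_system : Prop :=
  [/\ directed_set le,
      forall a b, le a b -> C (@p b a)
    & forall a b c, le a b -> le b c -> @p b a \o @p c b =1 @p c a].

Definition compatible_system (L : vectorLatticeType R)
    (q : forall a, L -> E a) : Prop :=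
  (forall a, C (q a)) /\
  (forall a b, le a b -> @p b a \o q b =1 q a).

Definition inverse_limit (L : vectorLatticeType R)
    (q : forall a, L -> E a) : Prop :=
  compatible_system q /\
  forall (L' : vectorLatticeType R) (q' : forall a, L' -> E a),
    compatible_system q' ->
    exists! s : L' -> L, C s /\ forall a, q a \o s =1 q' a.

End InverseLimits.

(* Main.v *)
Require Import Defs.
From HB Require Import structures.
From mathcomp Require Import all_boot all_order all_algebra.
From mathcomp Require Import all_classical all_reals all_analysis.
From mathcomp Require Import ring lra.

Set Implicit Arguments.
Unset Strict Implicit.
Unset Printing Implicit Defensive.

Import Order.TTheory GRing.Theory Num.Theory.
Import numFieldNormedType.Exports.

Local Open Scope classical_set_scope.
Local Open Scope ring_scope.

(* Kakutani plus the Riesz representation theorem, glued along principal ideals.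

   (i) -> (ii).  For [u >= 0] the ideal [F_u] generated by [u] is isomorphic to
   [C(K_u)], with [K_u] the space of lattice characters of [F_u] that map [u] to
   1.  For [u <= v] the inclusion of [F_u] in [F_v] becomes [f |-> w * (f o t)],
   where [w] is the function on [K_v] representing [u], and [t] restricts a
   character to [F_u] and normalizes it.  The range of this map being an ideal
   makes the range of [t] C*-embedded.  The adjoint of an ideal embedding is a
   normal interval preserving lattice homomorphism, and [F], the directed union
   of the [F_u], has as its order dual the inverse limit of the [M(K_u)].

   (ii) -> (i).  Clause (a) says that [p] is the adjoint of [f |-> w * (f o t)],
   which is an ideal embedding because [t] has dense C*-embedded range.  Hence
   [E] is the order dual of the direct limit of the [C(K_a)], by uniqueness of
   inverse limits.  In this direct limit every principal ideal lies in a single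
   [C(K_a)], so it is Archimedean and relatively uniformly complete. *)

(** * Vector lattices and order duals *)

(** One statement about duals serves both implications: if [F] is the directed union of the ranges
    of ideal embeddings [j a : E a -> F], and [rho a] identifies [M a] with the order dual of [E a],
    then [orderDual F], with the adjoints of the [j a], is the limit in [NVL] of the [M a]. In both
    uses [E a] is C(K_a) and [rho a] is the Riesz isomorphism.

    An ideal embedding acts on duals in two ways. Mapping intervals onto intervals lets the
    Riesz-Kantorovich formula compute positive parts, so the adjoint is a lattice homomorphism.
    Having a solid range lets a functional on the ideal be extended without exceeding a given
    majorant, so the adjoint preserves intervals. Order continuity comes for free, since infima of
    downward directed sets of functionals are pointwise on the positive cone.

    The identification of F_u with C(K_u) needs many characters; they come from maximal filters of
    positive elements, along which x / u has a limit. The index u = 0 has an empty spectrum, so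
    empty compact spaces do occur. *)

Section VectorLattices.
Variables (R : realType) (V : vectorLatticeType R).
Implicit Types x y z : V.

Lemma lev_oppE x y : (- x <= - y) = (y <= x).
Proof. by rewrite -[LHS]subv_ge0 opprK addrC subv_ge0. Qed.

Lemma addv_ge0 x y : 0 <= x -> 0 <= y -> 0 <= x + y.
Proof. by move=> x0 y0; rewrite -[0]addr0 lev_add. Qed.

Lemma scalev_ge0 (a : R) x : 0 <= a -> 0 <= x -> 0 <= a *: x.
Proof. by move=> a0 x0; rewrite -(scaler0 _ a) lev_wpscale. Qed.

Lemma lev_scale2r (a b : R) x : 0 <= x -> a <= b -> a *: x <= b *: x.
Proof. by move=> x0 ab; rewrite -subv_ge0 -scalerBl scalev_ge0// subr_ge0. Qed.

Lemma lev_scaleE (a : R) x y : 0 < a -> (a *: x <= a *: y) = (x <= y).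
Proof.
move=> a0; apply/idP/idP => [h|]; last exact/lev_wpscale/ltW.
have : a^-1 *: (a *: x) <= a^-1 *: (a *: y) by rewrite lev_wpscale// invr_ge0 ltW.
by rewrite !scalerA mulVf ?scale1r// gt_eqF.
Qed.

Lemma vsup_vpos x y : vsup x y = vpos (x - y) + y.
Proof.
apply/le_anti; rewrite vsup_le -!lev_subl_addr subrr vpos_ge0 le_vsupl/=.
rewrite -[leRHS](subrK y) lev_add2rE /vpos vsup_le subv_ge0 le_vsupr.
by rewrite lev_add2rE le_vsupl.
Qed.

Lemma vinf_vsup x y : vinf x y = - vsup (- x) (- y).
Proof.
apply/le_anti; rewrite -[X in X && _]lev_oppE opprK vsup_le !lev_oppE vinf_lel.
by rewrite vinf_ler le_vinf -!(lev_oppE x) -!(lev_oppE y) opprK le_vsupl le_vsupr.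
Qed.

Lemma vsup_l x y : y <= x -> vsup x y = x.
Proof. by move=> yx; apply/le_anti; rewrite vsup_le lexx yx le_vsupl. Qed.

Lemma vabs_ge0 x : 0 <= vabs x.
Proof.
have : x + - x <= vabs x + vabs x by rewrite lev_add ?le_vsupl ?le_vsupr.
rewrite subrr -mulr2n -scaler_nat => h.
by rewrite -(@lev_scaleE 2)// scaler0.
Qed.

Lemma vabs_pos x : 0 <= x -> vabs x = x.
Proof.
by move=> x0; apply: vsup_l; rewrite (le_trans _ x0)// -oppr0 lev_oppE.
Qed.

Lemma vabs_le x y : (vabs x <= y) = (x <= y) && (- x <= y).
Proof. exact: vsup_le. Qed.

(** Additivity gives natural multiples. With k the integer part of (n+1) a, monotonicity puts both
    (n+1) g (a x) and (n+1) a g x between k g x and (k+1) g x, so n+1 times their mean error is at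
    most g x. *)
Lemma additive_cone_homogeneous (g : V -> R) :
  (forall x y, 0 <= x -> 0 <= y -> g (x + y) = g x + g y) ->
  (forall x, 0 <= x -> 0 <= g x) ->
  forall (a : R) x, 0 <= a -> 0 <= x -> g (a *: x) = a * g x.
Proof.
move=> gD g0 a x a0 x0.
have gn n y : 0 <= y -> g (n%:R *: y) = n%:R * g y.
  move=> y0; elim: n => [|n IH].
    have := gD 0 0 (lexx _) (lexx _); rewrite scale0r mul0r addr0.
    by move=> /eqP; rewrite -subr_eq0 opprD addNKr oppr_eq0 => /eqP.
  by rewrite -natr1 scalerDl scale1r gD ?scalev_ge0// IH mulrDl mul1r.
have mono y z : 0 <= y -> y <= z -> g y <= g z.
  move=> y0 yz; rewrite -[z](subrK y) gD ?subv_ge0//.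
  by rewrite lerDr g0// subv_ge0.
have bound n : `|g (a *: x) - a * g x| * n.+1%:R <= g x.
  set k := Num.truncn (a * n.+1%:R).
  have /andP[k1 k2] : k%:R <= a * n.+1%:R < k.+1%:R.
    by rewrite truncn_itv ?mulr_ge0.
  have h1 : k%:R * g x <= n.+1%:R * g (a *: x).
    rewrite -!gn ?scalev_ge0// mono ?scalev_ge0// scalerA lev_scale2r//.
    by rewrite mulrC.
  have h2 : n.+1%:R * g (a *: x) <= k.+1%:R * g x.
    rewrite -!gn ?scalev_ge0// mono ?scalev_ge0// scalerA lev_scale2r// mulrC.
    exact: ltW.
  rewrite -[n.+1%:R]ger0_norm// -normrM ler_norml; have gx := g0 _ x0.
  have e1 : k%:R * g x <= a * n.+1%:R * g x by rewrite ler_wpM2r.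
  have e2 : a * n.+1%:R * g x <= k.+1%:R * g x by rewrite ler_wpM2r// ltW.
  move: h1 h2 e1 e2; rewrite -[k.+1%:R]natr1.
  move: (k%:R : R) (n.+1%:R : R) => K N; nra.
apply/eqP; rewrite -subr_eq0 -normr_le0 leNgt; apply/negP => d0.
set d := `|_ - _| in d0 bound.
have := bound (Num.truncn (g x / d)); apply/negP; rewrite -ltNge.
by rewrite mulrC -ltr_pdivrMr// truncnS_gt.
Qed.

(** All ways of writing x = a - b in the cone give the same g a - g b, because a + x^- = x^+ + b;
    linearity follows by choosing convenient differences. Functionals given by suprema or infima
    over the cone are obtained this way. *)
Lemma extend_from_cone (g : V -> R) :
  (forall x y, 0 <= x -> 0 <= y -> g (x + y) = g x + g y) ->
  (forall x, 0 <= x -> 0 <= g x) ->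
  exists phi : orderDual V, forall x, 0 <= x -> phi x = g x.
Proof.
move=> gD g0; have gZ := additive_cone_homogeneous gD g0.
pose h x : R^o := g (vpos x) - g (vneg x).
have hE (a b : V) : 0 <= a -> 0 <= b -> h (a - b) = g a - g b.
  move=> a0 b0; have := gD _ _ a0 (vneg_ge0 (a - b)).
  have -> : a + vneg (a - b) = vpos (a - b) + b.
    by rewrite -{1}(subrK b a) -{1}(vpos_vneg (a - b)) addrAC subrK.
  by rewrite gD ?vpos_ge0// /h; lra.
have h0 x : 0 <= x -> h x = g x.
  move=> x0; rewrite -{1}[x]subr0 hE//.
  have := gZ 0 x (lexx _) x0; rewrite scale0r mul0r => ->.
  by rewrite subr0.
have hD x y : h (x + y) = h x + h y.
  rewrite -{1}(vpos_vneg x) -{1}(vpos_vneg y) addrACA -opprD.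
  rewrite hE ?addv_ge0 ?vpos_ge0 ?vneg_ge0// !gD ?vpos_ge0 ?vneg_ge0//.
  by rewrite /h; lra.
have hN x : h (- x) = - h x.
  by rewrite -{1}(vpos_vneg x) opprB hE ?vpos_ge0 ?vneg_ge0// /h opprB.
have hZp x (a : R) : 0 <= a -> h (a *: x) = a * h x.
  move=> a0; rewrite -{1}(vpos_vneg x) scalerBr.
  rewrite hE ?scalev_ge0 ?vpos_ge0 ?vneg_ge0// !gZ ?vpos_ge0 ?vneg_ge0//.
  by rewrite /h mulrBr.
have hZ a x : h (a *: x) = a * h x.
  have [/(hZp x)//|/ltW] := leP 0 a; rewrite -oppr_ge0 => /(hZp x).
  by rewrite scaleNr hN mulNr => /oppr_inj.
have hmono x y : x <= y -> (h x : R) <= h y.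
  move=> xy; rewrite -subr_ge0 -[- h x]hN -hD h0 ?g0// subv_ge0//.
have hP : h \in @order_dual_pred R V.
  apply/asboolP; split=> [a x y|u v]; first by rewrite hD hZ.
  exists (`|h u : R| + `|h v : R|) => x ux xv.
  have := hmono _ _ ux; have := hmono _ _ xv.
  have := ler_norm (h v : R); have := ler_norm (- h u : R); rewrite normrN.
  have := normr_ge0 (h v : R); have := normr_ge0 (h u : R).
  by rewrite ler_norml => *; apply/andP; split; lra.
by exists (OrderDual hP) => x x0 /=; rewrite h0.
Qed.

End VectorLattices.

Section OrderDualTheory.
Variables (R : realType) (V : vectorLatticeType R).
Implicit Types (phi psi : orderDual V) (x y : V).

Lemma od_funD phi x y : phi (x + y) = phi x + phi y :> R.
Proof. by rewrite -[x]scale1r order_dual_linear !scale1r. Qed.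

Lemma od_fun0 phi : phi 0 = 0 :> R.
Proof. by apply: (@addrI _ (phi 0)); rewrite -od_funD !addr0. Qed.

Lemma od_funZ phi (a : R) x : phi (a *: x) = a * phi x :> R.
Proof. by rewrite -[a *: x]addr0 order_dual_linear od_fun0 addr0. Qed.

Lemma od_funN phi x : phi (- x) = - (phi x : R).
Proof. by rewrite -scaleN1r od_funZ mulN1r. Qed.

Lemma od_funB phi x y : phi (x - y) = phi x - phi y :> R.
Proof. by rewrite od_funD od_funN. Qed.

Lemma od_homo phi x y : 0 <= phi -> x <= y -> (phi x : R) <= phi y.
Proof.
move=> /order_dual_leP phi0 xy; rewrite -subr_ge0 -od_funB.
by apply: phi0; rewrite subv_ge0.
Qed.

Lemma od_eqP phi psi : (forall x, 0 <= x -> phi x = psi x) -> phi = psi.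
Proof.
move=> h; apply/le_anti/andP.
by split; apply/order_dual_leP => x x0; rewrite h.
Qed.

(* The Riesz-Kantorovich formula [phi^+ x = sup {phi y | 0 <= y <= x}]. *)
Lemma od_vpos_le phi x (M : R) : 0 <= x ->
  (forall y, 0 <= y -> y <= x -> (phi y : R) <= M) -> (vpos phi x : R) <= M.
Proof.
move=> x0 xM.
pose S x : set R := [set (phi y : R) | y in [set y | 0 <= y /\ y <= x]].
pose g x : R := sup (S x).
have hsS z : 0 <= z -> has_sup (S z).
  move=> z0; split; first by exists (phi 0), 0.
  have [N HN] := order_dual_bounded phi 0 z.
  by exists N => _ [y [y0 yx] <-]; rewrite (le_trans (ler_norm _))// HN.
have gub z y : 0 <= y -> y <= z -> (phi y : R) <= g z.
  move=> y0 yz; apply: ub_le_sup; last by exists y.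
  by apply: (hsS _ _).2; apply: le_trans yz.
have gle z N : 0 <= z -> (forall y, 0 <= y -> y <= z -> (phi y : R) <= N) -> g z <= N.
  move=> z0 H; apply: ge_sup; first exact: (hsS _ z0).1.
  by move=> _ [y [y0 yz] <-]; exact: H.
have g0 z : 0 <= z -> 0 <= g z by move=> z0; rewrite -(od_fun0 phi) gub.
have gD z t : 0 <= z -> 0 <= t -> g (z + t) = g z + g t.
  move=> z0 t0; have zt0 := addv_ge0 z0 t0; apply/le_anti/andP; split.
    apply: (gle) => // y y0 yzt.
    have [y1 [y2 [y10 y1z y20 y2t ->]]] := riesz_decomposition z0 t0 y0 yzt.
    by rewrite od_funD lerD// gub.
  rewrite -lerBrDr; apply: (gle) => // y y0 yz.
  rewrite lerBrDr addrC -lerBrDr; apply: (gle) => // y' y'0 y't.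
  by rewrite lerBrDr -od_funD gub ?addv_ge0// addrC lev_add.
have [psi psiE] := extend_from_cone gD g0.
have : vpos phi <= psi.
  rewrite /vpos vsup_le; apply/andP; split; apply/order_dual_leP => y y0.
  - by rewrite psiE// gub.
  - by rewrite psiE// g0.
by move=> /order_dual_leP/(_ _ x0)/le_trans; apply; rewrite psiE// gle.
Qed.

(* The pointwise infimum on the positive cone is additive, as [D] is downward
   directed, hence it comes from a lower bound of [D] in the order dual. *)
Lemma od_decreases_to_0 (D : set (orderDual V)) : decreases_to_0 D ->
  forall x (e : R), 0 <= x -> 0 < e -> exists2 d, D d & (d x : R) < e.
Proof.
move=> [[d0 Dd0] Ddir [Dlb Dinf]] x e x0 e0.
have D0 d : D d -> 0 <= d by move=> /Dlb.
have D0x d y : D d -> 0 <= y -> 0 <= d y :> R.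
  by move=> /D0 d_ge0 y0; rewrite -(od_fun0 d) od_homo.
pose S x : set R := [set (d x : R) | d in D].
pose g x := inf (S x).
have hS y : 0 <= y -> has_inf (S y).
  move=> y0; split; first by exists (d0 y), d0.
  by exists 0 => _ [d Dd <-]; exact: D0x.
have gle y d : 0 <= y -> D d -> g y <= d y.
  by move=> y0 Dd; apply: ge_inf; [exact: (hS _ y0).2|exists d].
have lge y M : 0 <= y -> (forall d, D d -> M <= d y) -> M <= g y.
  move=> y0 H; apply: lb_le_inf; first exact: (hS _ y0).1.
  by move=> _ [d Dd <-]; exact: H.
have g0 y : 0 <= y -> 0 <= g y.
  by move=> y0; apply: (lge) => // d Dd; exact: D0x.
have gD y z : 0 <= y -> 0 <= z -> g (y + z) = g y + g z.
  move=> y0 z0; apply/le_anti/andP; split; last first.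
    apply: (lge) => [|d Dd]; first exact: addv_ge0.
    by rewrite od_funD lerD// gle.
  rewrite -lerBlDr; apply: (lge) => // d Dd.
  rewrite lerBlDr [d y + _]addrC -lerBlDr; apply: (lge) => // d' Dd'; rewrite lerBlDr.
  have [c [Dc cd cd']] := Ddir _ _ Dd Dd'.
  rewrite (le_trans (gle _ _ (addv_ge0 y0 z0) Dc))// od_funD addrC.
  by rewrite lerD//; [move/order_dual_leP: cd'; apply|move/order_dual_leP: cd; apply].
have [psi psiE] := extend_from_cone gD g0.
have psi0 : psi <= 0.
  apply: Dinf => d Dd; apply/order_dual_leP => y y0.
  by rewrite psiE// gle.
have gx0 : g x < e.
  rewrite (le_lt_trans _ e0)//.
  by move/order_dual_leP: psi0 => /(_ _ x0); rewrite psiE.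
have [_ [d Dd <-] dlt] := inf_lt (hS _ x0).1 gx0.
by exists d.
Qed.

End OrderDualTheory.

(** * Ideal embeddings and adjoints *)

Section MorphismTheory.
Variables (R : realType).
Implicit Types E F G : vectorLatticeType R.

Lemma linear_mapD E F (T : E -> F) : linear T -> {morph T : x y / x + y}.
Proof. by move=> lT x y; rewrite -[x]scale1r lT !scale1r. Qed.

Lemma linear_map0 E F (T : E -> F) : linear T -> T 0 = 0.
Proof. by move=> lT; apply: (@addrI _ (T 0)); rewrite -linear_mapD// !addr0. Qed.

Lemma linear_mapZ E F (T : E -> F) (a : R) : linear T -> {morph T : x / a *: x}.
Proof. by move=> lT x; rewrite -[a *: x]addr0 lT linear_map0// addr0. Qed.

Lemma linear_mapN E F (T : E -> F) : linear T -> {morph T : x / - x}.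
Proof. by move=> lT x; rewrite -scaleN1r linear_mapZ// scaleN1r. Qed.

Lemma linear_mapB E F (T : E -> F) : linear T -> {morph T : x y / x - y}.
Proof. by move=> lT x y; rewrite linear_mapD// linear_mapN. Qed.

Lemma linear_map_homo E F (T : E -> F) : linear T ->
  (forall x, 0 <= x -> 0 <= T x) -> {homo T : x y / x <= y}.
Proof.
by move=> lT T0 x y xy; rewrite -subv_ge0 -linear_mapB// T0// subv_ge0.
Qed.

Lemma lattice_hom_of_vpos E F (T : E -> F) : linear T ->
  {morph T : x / vpos x} -> lattice_hom T.
Proof.
move=> lT Tp; have Ts : {morph T : x y / vsup x y}.
  by move=> x y; rewrite !vsup_vpos linear_mapD// Tp linear_mapB.
by split=> // x y; rewrite !vinf_vsup (linear_mapN lT) Ts !(linear_mapN lT).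
Qed.

Lemma lattice_hom_vpos E F (T : E -> F) : lattice_hom T -> {morph T : x / vpos x}.
Proof. by move=> [lT Ts _] x; rewrite /vpos Ts linear_map0. Qed.

Lemma lattice_hom_ge0 E F (T : E -> F) x : lattice_hom T -> 0 <= x -> 0 <= T x.
Proof.
move=> hT x0; rewrite -[x](vsup_l x0) -/(vpos x) lattice_hom_vpos//.
exact: vpos_ge0.
Qed.

Lemma lattice_hom_homo E F (T : E -> F) : lattice_hom T -> {homo T : x y / x <= y}.
Proof.
move=> hT; have [lT _ _] := hT.
by apply: linear_map_homo => // x; exact: lattice_hom_ge0.
Qed.

(** A set decreasing to 0 is positive and stays so under a lattice homomorphism: the absolute values
    drop out, and only the bound from above on lower bounds has content. *)
Lemma order_continuousP E F (T : E -> F) : lattice_hom T ->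
  order_continuous T <->
  forall D, decreases_to_0 D -> forall h, (forall d, D d -> h <= T d) -> h <= 0.
Proof.
move=> hT; have D0 (D : set E) d : decreases_to_0 D -> D d -> 0 <= d by move=> [_ _ [+ _]]; apply.
split=> H D hD.
  move=> h hle; have [_] := H D hD; apply => _ [d Dd <-].
  by rewrite vabs_pos ?hle//; exact: lattice_hom_ge0 hT (D0 _ _ hD Dd).
split; first by move=> _ [d Dd <-]; exact: vabs_ge0.
move=> h hlb; apply: (H _ hD) => d Dd.
rewrite -[T d]vabs_pos; first by apply: hlb; exists d.
by exact: lattice_hom_ge0 hT (D0 _ _ hD Dd).
Qed.

Lemma normal_comp E F G (S : F -> G) (T : E -> F) :
  normal_lattice_hom S -> normal_lattice_hom T -> normal_lattice_hom (S \o T).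
Proof.
move=> [hS cS] [hT cT].
have hST : lattice_hom (S \o T).
  move: hS hT => [lS Ss Si] [lT Ts Ti].
  split=> [a x y|x y|x y] /=; first by rewrite lT lS.
  - by rewrite Ts Ss.
  - by rewrite Ti Si.
split=> //; apply/order_continuousP => // D hD h hle.
move/(order_continuousP hT)/(_ D hD): cT => cT.
have [[d0 Dd0] Ddir [Dlb _]] := hD.
apply: ((order_continuousP hS).1 cS [set T d | d in D]) => [|_ [d Dd <-]]; last exact: hle.
split; first by exists (T d0), d0.
  move=> _ _ [x Dx <-] [y Dy <-]; have [z [Dz zx zy]] := Ddir _ _ Dx Dy.
  by exists (T z); split; [exists z|exact: lattice_hom_homo|exact: lattice_hom_homo].
split; first by move=> _ [d Dd <-]; apply: lattice_hom_ge0 => //; exact: Dlb.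
by move=> g glb; apply: cT => d Dd; apply: glb; exists d.
Qed.

(** Suprema, infima and order continuity are not asked for, as they are determined by the order. *)
Definition order_iso E F (T : E -> F) : Prop :=
  [/\ linear T, forall x y, (T x <= T y) = (x <= y) & forall y, exists x, T x = y].

Lemma order_iso_inj E F (T : E -> F) : order_iso T -> injective T.
Proof.
by move=> [_ mT _] x y Txy; apply/le_anti; rewrite -!mT Txy lexx.
Qed.

Lemma order_iso_normal E F (T : E -> F) : order_iso T -> normal_lattice_hom T.
Proof.
move=> [lT mT sT]; have T0 := linear_map0 lT.
have hT : lattice_hom T.
  apply: lattice_hom_of_vpos => // x; apply/le_anti/andP; split; last first.
    by rewrite /vpos vsup_le mT le_vsupl -T0 mT le_vsupr.
  have [p pE] := sT (vpos (T x)); rewrite -pE mT /vpos vsup_le -2!mT pE T0.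
  by rewrite le_vsupl le_vsupr.
split=> //; apply/order_continuousP => // D [_ _ [_ Dinf]] h.
have [g <-] := sT h => gle; rewrite -T0 mT; apply: Dinf => d Dd.
by rewrite -mT gle.
Qed.

Lemma order_iso_bijective E F (T : E -> F) : order_iso T -> bijective T.
Proof.
move=> iT; have [_ _ sT] := iT; exists (fun y => sval (cid (sT y))) => [x|y].
  by apply: (order_iso_inj iT); case: cid.
by case: cid.
Qed.

Lemma order_iso_inv E F (T : E -> F) (S : F -> E) :
  order_iso T -> cancel S T -> order_iso S.
Proof.
move=> iT SK; have [lT mT sT] := iT; split=> [a x y|x y|x].
- by apply: (order_iso_inj iT); rewrite lT !SK.
- by rewrite -mT !SK.
- by exists (T x); apply: (order_iso_inj iT); rewrite SK.
Qed.

Lemma bijective_lattice_hom_order_iso E F (T : E -> F) :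
  lattice_hom T -> bijective T -> order_iso T.
Proof.
move=> hT bT; have [lT Ts _] := hT; have iT := bij_inj bT.
split=> // [x y|y]; last by case: bT => S _ SK; exists (S y).
apply/idP/idP => [h|]; last exact: lattice_hom_homo.
suff -> : y = vsup y x by rewrite le_vsupr.
by apply: iT; rewrite Ts vsup_l.
Qed.

Definition ideal_embedding E F (T : E -> F) : Prop :=
  [/\ linear T, forall x y, (T x <= T y) = (x <= y)
    & forall x y, 0 <= y -> y <= T x -> exists z, y = T z].

Lemma ideal_embedding_inj E F (T : E -> F) : ideal_embedding T -> injective T.
Proof.
by move=> [_ mT _] x y Txy; apply/le_anti; rewrite -!mT Txy lexx.
Qed.

Lemma ideal_embedding_ge0 E F (T : E -> F) x : ideal_embedding T ->
  (0 <= T x) = (0 <= x).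
Proof. by move=> [lT mT _]; rewrite -(linear_map0 lT) mT. Qed.

(** The positive part of T x lies between 0 and T (x^+), hence in the range by solidity, and can be
    compared with x^+ back in [E]. *)
Lemma ideal_embedding_lattice_hom E F (T : E -> F) :
  ideal_embedding T -> lattice_hom T.
Proof.
move=> iT; have [lT mT sT] := iT; apply: lattice_hom_of_vpos => // x.
apply/le_anti/andP; split; last first.
  by rewrite /vpos vsup_le mT le_vsupl ideal_embedding_ge0// le_vsupr.
have h : vpos (T x) <= T (vpos x).
  by rewrite /vpos vsup_le mT le_vsupl ideal_embedding_ge0// le_vsupr.
have [p pE] := sT _ _ (vpos_ge0 _) h; rewrite pE mT /vpos vsup_le.
by rewrite -(ideal_embedding_ge0 _ iT) -mT -pE le_vsupl le_vsupr.
Qed.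

Lemma ideal_embedding_interval E F (T : E -> F) :
  ideal_embedding T -> interval_preserving T.
Proof.
move=> iT; have [lT mT sT] := iT; split=> [x|u u0].
  by rewrite ideal_embedding_ge0.
apply/seteqP; split=> [_ [x /andP[x0 xu] <-]|y /andP[y0 yu]] /=.
  by rewrite ideal_embedding_ge0// x0 mT.
have [z zE] := sT _ _ y0 yu; exists z => //=.
by rewrite -(ideal_embedding_ge0 _ iT) -mT -zE y0.
Qed.

(** Total in [T]: the value is 0 when [phi \o T] is not an order bounded functional, which cannot
    happen for positive linear [T]. *)
Definition adj E F (T : E -> F) (phi : orderDual F) : orderDual E :=
  insubd 0 (phi \o T : E -> R^o).

Section Adjoint.
Variables (E F : vectorLatticeType R) (T : E -> F).
Hypotheses (lT : linear T) (posT : forall x, 0 <= x -> 0 <= T x).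

Lemma adjE phi x : adj T phi x = phi (T x).
Proof.
rewrite /adj /insubd insubT//=; apply/asboolP; split=> [a y z|u v] /=.
  by rewrite lT order_dual_linear.
have [M HM] := order_dual_bounded phi (T u) (T v).
have Tm := linear_map_homo lT posT.
by exists M => y uy yv; apply: HM; exact: Tm.
Qed.

Lemma adj_linear : linear (adj T).
Proof.
by move=> a phi psi; apply: order_dualP => x; rewrite [RHS]order_dual_funD order_dual_funZ !adjE.
Qed.

Lemma adj_homo : {homo adj T : phi psi / phi <= psi}.
Proof.
move=> phi psi /order_dual_leP h; apply/order_dual_leP => x x0.
by rewrite !adjE h// posT.
Qed.

End Adjoint.

Section NormalAdjoint.
Variables (E F : vectorLatticeType R) (T : E -> F).
Hypotheses (lT : linear T) (ipT : interval_preserving T).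

Let posT x : 0 <= x -> 0 <= T x. Proof. exact: ipT.1. Qed.

(** The Riesz-Kantorovich supremum for phi^+ at T x runs over [0, T x], the image of [0, x], hence
    over values of [adj T phi] on [0, x]. For order continuity, functionals decreasing to 0 have
    small values at T x. *)
Lemma adj_normal : normal_lattice_hom (adj T).
Proof.
have hT : lattice_hom (adj T).
  apply: lattice_hom_of_vpos (adj_linear lT posT) _ => phi; apply/le_anti/andP; split.
    apply/order_dual_leP => x x0; rewrite (adjE lT posT).
    apply: od_vpos_le; first exact: ipT.1.
    move=> y y0 yTx; have : [set y | 0 <= y <= T x] y by rewrite /= y0.
    rewrite -ipT.2// => -[z /andP[z0 zx] <-]; rewrite -(adjE lT posT).
    apply: (@le_trans _ _ (vpos (adj T phi) z)).
      by move/order_dual_leP: (le_vsupl (adj T phi) 0); apply.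
    by apply: od_homo => //; exact: vpos_ge0.
  rewrite {1}/vpos vsup_le (adj_homo lT posT) ?le_vsupl//=.
  have <- : adj T 0 = 0 by apply: order_dualP => x; rewrite (adjE lT posT).
  exact/(adj_homo lT posT)/vpos_ge0.
split=> //; apply/order_continuousP => // D hD h hle.
apply/order_dual_leP => x x0; rewrite leNgt; apply/negP => hx.
have [d Dd] := od_decreases_to_0 hD (ipT.1 _ x0) hx.
by apply/negP; rewrite -leNgt -(adjE lT posT); move/order_dual_leP: (hle d Dd); apply.
Qed.

End NormalAdjoint.

(* A functional on an ideal below the restriction of [phi] extends to the
   smallest functional [x |-> sup {psi y | T y <= x}], which is below [phi]. *)
Lemma adj_interval E F (T : E -> F) :
  ideal_embedding T -> interval_preserving (adj T).
Proof.
move=> iT; have [lT mT sT] := iT; have ipT := ideal_embedding_interval iT; have posT := ipT.1.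
have aT0 : adj T 0 = 0 by apply: order_dualP => x; rewrite adjE.
split=> [phi phi0|phi phi0]; first by rewrite -aT0; exact: adj_homo.
apply/seteqP; split=> [_ [p /andP[p0 pphi] <-]|psi /andP[psi0 psiphi]] /=.
  by apply/andP; split; [rewrite -aT0|]; exact: adj_homo.
pose S x : set R := [set (psi y : R) | y in [set y | 0 <= y /\ T y <= x]].
pose g x : R := sup (S x).
have psi_phi y : 0 <= y -> (psi y : R) <= phi (T y).
  by move=> y0; rewrite -(adjE lT posT); move/order_dual_leP: psiphi; apply.
have hS x : 0 <= x -> has_sup (S x).
  move=> x0; split; first by exists (psi 0), 0; rewrite //= (linear_map0 lT).
  exists (phi x) => _ [y [y0 yx] <-]; rewrite (le_trans (psi_phi _ y0))//.
  exact: od_homo.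
have gub x y : 0 <= y -> T y <= x -> (psi y : R) <= g x.
  move=> y0 yx; apply: ub_le_sup; last by exists y.
  by apply: (hS _ _).2; apply: le_trans yx; rewrite ideal_embedding_ge0.
have gle x M : 0 <= x -> (forall y, 0 <= y -> T y <= x -> (psi y : R) <= M) -> g x <= M.
  move=> x0 H; apply: ge_sup; first exact: (hS _ x0).1.
  by move=> _ [y [y0 yx] <-]; exact: H.
have g0 x : 0 <= x -> 0 <= g x.
  by move=> x0; rewrite -(od_fun0 psi) gub// (linear_map0 lT).
have gD x1 x2 : 0 <= x1 -> 0 <= x2 -> g (x1 + x2) = g x1 + g x2.
  move=> x10 x20; have x120 := addv_ge0 x10 x20; apply/le_anti/andP; split.
    apply: (gle) => // y y0 Tyx.
    have Ty0 : 0 <= T y by rewrite ideal_embedding_ge0.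
    (* The decomposition of [T y] takes place in [F]; its pieces lie below [T y], so solidity brings
       them back to [E]. *)
    have [a1 [a2 [a10 a1x a20 a2x TyE]]] := riesz_decomposition x10 x20 Ty0 Tyx.
    have a1T : a1 <= T y by rewrite TyE -{1}[a1]addr0 lev_add2lE.
    have a2T : a2 <= T y by rewrite TyE -{1}[a2]add0r lev_add2rE.
    have [y1 y1E] := sT _ _ a10 a1T; have [y2 y2E] := sT _ _ a20 a2T.
    have -> : y = y1 + y2.
      by apply: (ideal_embedding_inj iT); rewrite linear_mapD// -y1E -y2E.
    by rewrite od_funD lerD// gub -?(ideal_embedding_ge0 _ iT) -?y1E -?y2E.
  rewrite -lerBrDr; apply: (gle) => // y y0 yx1.
  rewrite lerBrDr addrC -lerBrDr; apply: (gle) => // z z0 zx2.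
  by rewrite lerBrDr -od_funD gub ?addv_ge0// addrC linear_mapD// lev_add.
have [p pE] := extend_from_cone gD g0.
exists p; last first.
  apply: od_eqP => x x0; have Tx0 : 0 <= T x by rewrite ideal_embedding_ge0.
  rewrite (adjE lT posT) pE//; apply/le_anti; rewrite gub// andbT.
  by apply: gle => // y y0; rewrite mT => yx; exact: od_homo.
apply/andP; split; apply/order_dual_leP => x x0; rewrite pE//; first exact: g0.
by apply: gle => // y y0 yx; rewrite (le_trans (psi_phi _ y0))// od_homo.
Qed.

End MorphismTheory.

(** * Order duals of directed unions *)

Section DualLimit.
Variables (R : realType) (I : Type) (le : I -> I -> Prop).
Variables (E M : I -> vectorLatticeType R) (F : vectorLatticeType R).
Variables (j : forall a, E a -> F) (rho : forall a, M a -> orderDual (E a)).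
Variables (p : forall b a, M b -> M a) (q : forall a, orderDual F -> M a).
Arguments j : clear implicits.
Arguments rho : clear implicits.
Arguments p : clear implicits.
Hypothesis le_dir : directed_set le.
Hypothesis j_emb : forall a, ideal_embedding (j a).
Hypothesis j_incr : forall a b, le a b -> forall x, exists y, j a x = j b y.
Hypothesis j_cover : forall z, exists a x, z = j a x.
Hypothesis rho_iso : forall a, order_iso (rho a).
(** No maps between the [E a] are given: [p b a] has to be the adjoint of the inclusion of the range
    of [j a] in that of [j b], read through [rho]. *)
Hypothesis pE : forall a b, le a b -> forall mu x y, j a x = j b y ->
  rho a (p b a mu) x = rho b mu y.
Hypothesis qE : forall a phi x, rho a (q a phi) x = phi (j a x).

Let rho_inj a := order_iso_inj (rho_iso a).
Let j_inj a := ideal_embedding_inj (j_emb a).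
Let j_lin a : linear (j a). Proof. by have [] := j_emb a. Qed.
Let j_int a := ideal_embedding_interval (j_emb a).
Let rho_lin a : linear (rho a). Proof. by have [] := rho_iso a. Qed.
Lemma normal_of_rho a (L : vectorLatticeType R) (s : L -> M a) :
  normal_lattice_hom (rho a \o s) -> normal_lattice_hom s.
Proof.
have [r rK rhoK] := order_iso_bijective (rho_iso a).
have sE : s = r \o (rho a \o s) by apply/funext => x /=; rewrite rK.
move=> h; rewrite sE; apply: (normal_comp _ h); apply: order_iso_normal.
exact: order_iso_inv (rho_iso a) rhoK.
Qed.

(** The inclusion of ranges defines an ideal embedding [T : E a -> E b], and [rho] conjugates
    [p b a] into [adj T]. *)
Lemma dual_system_NIVL a b : le a b -> NIVL (p b a).
Proof.
move=> ab; have /choice[T TE] := j_incr ab.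
have iT : ideal_embedding T.
  have [_ mj sj] := j_emb a; have [_ mj' _] := j_emb b; split=> [k x y|x y|x y y0 yT].
  - by apply: (@j_inj b); rewrite -TE !j_lin !TE.
  - by rewrite -mj' -!TE mj.
  - have [||z zE] := sj x (j b y); rewrite ?(ideal_embedding_ge0 _ (j_emb b))//.
      by rewrite TE mj'.
    by exists z; apply: (@j_inj b); rewrite -TE.
have [lT _ _] := iT; have intT := ideal_embedding_interval iT; have posT := intT.1.
have pT : rho a \o p b a = adj T \o rho b.
  apply/funext => mu; apply: order_dualP => x /=.
  by rewrite adjE//; apply: pE => //; exact: TE.
split.
  apply: normal_of_rho; rewrite pT; apply: normal_comp; first exact: adj_normal.
  exact: order_iso_normal.
have [_ ma sa] := rho_iso a; have [_ mb sb] := rho_iso b.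
have a0 := linear_map0 (@rho_lin a); have b0 := linear_map0 (@rho_lin b).
have pT' mu : rho a (p b a mu) = adj T (rho b mu) by move/(congr1 (@^~ mu)): pT.
have [adj0 adj_int] := adj_interval iT.
split=> [mu mu0|mu mu0].
  by rewrite -ma a0 pT'; apply: adj0; rewrite -b0 mb.
apply/seteqP; split=> [_ [nu /andP[nu0 numu] <-]|nu /andP[nu0 numu]] /=.
  rewrite -!ma a0 !pT'; apply/andP; split; first by apply: adj0; rewrite -b0 mb.
  by apply: (linear_map_homo (adj_linear lT posT) adj0); rewrite mb.
have : [set phi | 0 <= phi <= adj T (rho b mu)] (rho a nu).
  by rewrite /= -pT' -{1}a0 !ma nu0.
rewrite -adj_int; last by rewrite -b0 mb.
move=> -[phi]; have [nu' <-] := sb phi; rewrite /= -b0 !mb => nu'mu.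
rewrite -pT' => /rho_inj <-.
by exists nu'.
Qed.

Lemma dual_inverse_system : inverse_system (@NIVL R) le p.
Proof.
split=> // [a b|a b c ab bc mu]; first exact: dual_system_NIVL.
have [_ _ le_tr _] := le_dir.
apply: rho_inj; apply: order_dualP => x.
have [y xy] := j_incr ab x; have [z yz] := j_incr bc y.
by rewrite (pE ab _ xy) (pE bc _ yz) (pE (le_tr _ _ _ ab bc) _ (etrans xy yz)).
Qed.

Lemma dual_normal a : normal_lattice_hom (q a).
Proof.
apply: normal_of_rho; rewrite (_ : _ \o _ = adj (j a)); first exact: adj_normal.
by apply/funext => phi; apply: order_dualP => x /=; rewrite qE (adjE (@j_lin a) (j_int a).1).
Qed.

(** The [q a] jointly reflect the order because a positive element of [F] comes from a positive
    element of some [E a]. The mediating map is therefore studied coordinate by coordinate. *)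
Let q_le phi psi : (forall a, q a phi <= q a psi) -> phi <= psi.
Proof.
move=> h; apply/order_dual_leP => z z0; have [a [x zE]] := j_cover z.
have [_ ma _] := rho_iso a.
have := h a; rewrite -ma => /order_dual_leP/(_ x); rewrite zE !qE; apply.
by rewrite -(ideal_embedding_ge0 _ (j_emb a)) -zE.
Qed.

Let q_inj phi psi : (forall a, q a phi = q a psi) -> phi = psi.
Proof. by move=> h; apply/le_anti/andP; split; apply: q_le => a; rewrite h. Qed.

Lemma dual_compatible : compatible_system (@NVL R) le p q.
Proof.
split=> [a|a b ab phi]; first exact: dual_normal.
apply: rho_inj; apply: order_dualP => x; have [y xy] := j_incr ab x.
by rewrite /= (pE ab _ xy) !qE xy.
Qed.

Section Universal.
Variables (L : vectorLatticeType R) (q' : forall a, L -> M a).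
Hypothesis q'_comp : compatible_system (@NVL R) le p q'.

Let q'_coh a b (t : L) x y : j a x = j b y -> rho a (q' a t) x = rho b (q' b t) y.
Proof.
move=> xy; have [_ _ _ le_ub] := le_dir; have [c [ac bc]] := le_ub a b.
have [x' xx'] := j_incr ac x; have [y' yy'] := j_incr bc y.
have qE' d (dc : le d c) : q' d t = p c d (q' c t) by rewrite -[LHS](q'_comp.2 _ _ dc t).
rewrite (qE' _ ac) (qE' _ bc) (pE ac _ xx') (pE bc _ yy'); congr (rho _ _ _).
by apply: (@j_inj c); rewrite -xx' -yy'.
Qed.

(** At z = j a x the functional [s t] takes the value of [q' a t] at x; by [q'_coh] this does not
    depend on the representative. *)
Lemma dual_mediating : exists s : L -> orderDual F, forall a t, q a (s t) = q' a t.
Proof.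
have /choice[al] : forall z, exists ax : {a & E a}, z = j (projT1 ax) (projT2 ax).
  by move=> z; have [a [x ->]] := j_cover z; exists (existT _ a x).
move=> alE; pose f (t : L) z : R^o := rho _ (q' _ t) (projT2 (al z)).
have fE t a x : f t (j a x) = rho a (q' a t) x by apply: q'_coh; rewrite -alE.
have j_cover2 z1 z2 : exists a x1 x2, z1 = j a x1 /\ z2 = j a x2.
  have [a [x ->]] := j_cover z1; have [b [y ->]] := j_cover z2.
  have [_ _ _ le_ub] := le_dir; have [c [ac bc]] := le_ub a b.
  have [x' xx'] := j_incr ac x; have [y' yy'] := j_incr bc y.
  by exists c, x', y'.
have fP t : f t \in @order_dual_pred R F.
  apply/asboolP; split=> [k z1 z2|u v].
    have [a [x1 [x2 [-> ->]]]] := j_cover2 z1 z2.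
    by rewrite -j_lin !fE order_dual_linear.
  have [a [x1 [x2 [uE vE]]]] := j_cover2 u v.
  have [B HB] := order_dual_bounded (rho a (q' a t)) x1 x2.
  have [_ mj sj] := j_emb a.
  (* [z - u] lies between 0 and [j a (x2 - x1)], so the whole interval [u, v] comes from the single
     space [E a], where [B] is a bound. *)
  exists B => z uz zv; have [||y yE] := sj (x2 - x1) (z - u).
  - by rewrite subv_ge0.
  - by rewrite linear_mapB// -uE -vE lev_add2rE.
  have zE : z = j a (y + x1) by rewrite linear_mapD// -yE -uE subrK.
  by rewrite zE fE; apply: HB; rewrite -mj -zE -?uE -?vE.
exists (fun t => OrderDual (fP t)) => a t.
by apply: rho_inj; apply: order_dualP => x; rewrite qE; exact: fE.
Qed.

Lemma dual_universal : exists! s : L -> orderDual F,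
  NVL s /\ forall a, q a \o s =1 q' a.
Proof.
have [s sE] := dual_mediating; exists s; split; last first.
  move=> s' [_ s'E]; apply/funext => t; apply: q_inj => a.
  by rewrite sE -s'E.
split=> //; have [q'N _] := q'_comp.
have hs : lattice_hom s.
  apply: lattice_hom_of_vpos => [k x y|x]; apply: q_inj => a; rewrite sE.
    have [[lq' _ _] _] := q'N a; have [[lq _ _] _] := dual_normal a.
    by rewrite lq' lq !sE.
  have [hq' _] := q'N a; have [hq _] := dual_normal a.
  by rewrite (lattice_hom_vpos hq') (lattice_hom_vpos hq) sE.
split=> //; apply/order_continuousP => // D hD h hle; apply: q_le => a.
have [hq' cq'] := q'N a; have [hq _] := dual_normal a.
have [lq _ _] := hq; rewrite (linear_map0 lq).
apply: ((order_continuousP hq').1 cq' D hD) => d Dd.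
by rewrite -sE; apply: (lattice_hom_homo hq); exact: hle.
Qed.

End Universal.

Lemma dual_inverse_limit : inverse_limit (@NVL R) le p q.
Proof. by split; [exact: dual_compatible|exact: dual_universal]. Qed.

End DualLimit.

(** * Uniqueness of inverse limits and transport along isomorphisms *)

Section LimitIsomorphism.
Variables (R : realType) (I : Type) (le : I -> I -> Prop).
Variables (M : I -> vectorLatticeType R) (p : forall b a, M b -> M a).

Lemma normal_id (E : vectorLatticeType R) : normal_lattice_hom (@id E).
Proof. by apply: order_iso_normal; split=> // y; exists y. Qed.

Lemma compatible_comp (E F : vectorLatticeType R) (q : forall a, F -> M a)
    (s : E -> F) : normal_lattice_hom s -> compatible_system (@NVL R) le p q ->
  compatible_system (@NVL R) le p (fun a => q a \o s).
Proof.
move=> sN [qN qp]; split=> [a|a b ab x]; last exact: (qp _ _ ab).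
exact: normal_comp (qN a) sN.
Qed.

Lemma inverse_limit_unique (E F : vectorLatticeType R)
    (q : forall a, E -> M a) (q' : forall a, F -> M a) :
  inverse_limit (@NVL R) le p q -> inverse_limit (@NVL R) le p q' ->
  lattice_isomorphic E F.
Proof.
move=> [qC qU] [q'C q'U].
have [s [[sN sE] _]] := q'U _ _ qC; have [r [[rN rE] _]] := qU _ _ q'C.
(* An endomorphism of a limit that commutes with the projections is the identity; this applies to
   both composites of [s] and [r]. *)
have loop (G : vectorLatticeType R) (g : forall a, G -> M a) (t : G -> G) :
    inverse_limit (@NVL R) le p g -> normal_lattice_hom t ->
    (forall a, g a \o t =1 g a) -> t = id.
  move=> [gC gU] tN tE; have [u [_ uU]] := gU _ _ gC.
  by rewrite -(uU t)// (uU id)//; split=> //; exact: normal_id.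
exists s; first by have [] := sN.
exists r => x.
  have /(congr1 (@^~ x)) // : r \o s = id.
  apply: (@loop _ q) => //; first exact: normal_comp.
  by move=> a y; rewrite -[RHS]sE; exact: rE.
have /(congr1 (@^~ x)) // : s \o r = id.
apply: (@loop _ q') => //; first exact: normal_comp.
by move=> a y; rewrite -[RHS]rE; exact: sE.
Qed.

Lemma inverse_limit_iso (E F : vectorLatticeType R) (q : forall a, F -> M a)
    (s : E -> F) : order_iso s -> inverse_limit (@NVL R) le p q ->
  inverse_limit (@NVL R) le p (fun a => q a \o s).
Proof.
move=> sI [qC qU]; have sN := order_iso_normal sI.
split; first exact: compatible_comp.
move=> L q' q'C; have [t [[tN tE] tU]] := qU _ _ q'C.
have [r rK sK] := order_iso_bijective sI.
exists (r \o t); split.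
  split=> [|a x]; last by rewrite /= sK; exact: tE.
  apply: normal_comp => //; apply: order_iso_normal.
  exact: order_iso_inv sI sK.
move=> t' [t'N t'E]; rewrite (tU (s \o t')); last first.
  by split=> //; exact: normal_comp.
by apply/funext => x /=; rewrite rK.
Qed.

End LimitIsomorphism.

(** * Spaces of continuous functions *)

Section ContinuousFunctions.
Variables (R : realType) (K : topologicalType).

Definition cfun_pred : {pred K -> R^o} := fun f => `[< continuous (f : K -> R) >].

Record cfun := CFun { cfun_fun :> K -> R^o ; _ : cfun_fun \in cfun_pred }.

HB.instance Definition _ := [isSub for cfun_fun].
HB.instance Definition _ := [Choice of cfun by <:].

Lemma cfun_submod_closed : submod_closed cfun_pred.
Proof.
split=> [|a f g]; first by apply/asboolP => x; exact: cst_continuous.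
move=> /asboolP cf /asboolP cg; apply/asboolP => x.
rewrite (_ : (a *: f + g) = (fun x => a * (f x : R) + g x))//.
by apply: cvgD; [apply: cvgM; [exact: cvg_cst|exact: cf]|exact: cg].
Qed.

HB.instance Definition _ :=
  GRing.isSubmodClosed.Build _ _ cfun_pred cfun_submod_closed.
HB.instance Definition _ := [SubChoice_isSubLmodule of cfun by <:].

Definition cfun_le : rel cfun := fun f g => `[< forall x, (f x : R) <= g x >].

Lemma cfun_continuous (f : cfun) : continuous (f : K -> R).
Proof. by case: f => f /= /asboolP. Qed.

Definition mkcfun (f : K -> R) (cf : continuous f) : cfun := CFun (asboolT cf).

Lemma cfun_eqP (f g : cfun) : (forall x, f x = g x :> R) -> f = g.
Proof. by move=> fg; apply/val_inj/funext. Qed.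

Lemma cfun_le_refl : reflexive cfun_le.
Proof. by move=> f; apply/asboolP. Qed.

Lemma cfun_le_anti : antisymmetric cfun_le.
Proof.
move=> f g /andP[/asboolP fg /asboolP gf]; apply: cfun_eqP => x.
by apply/le_anti; rewrite fg gf.
Qed.

Lemma cfun_le_trans : transitive cfun_le.
Proof.
move=> g f h /asboolP fg /asboolP gh; apply/asboolP => x.
exact: le_trans (fg x) (gh x).
Qed.

Lemma cfun_le_add2r (f g h : cfun) : cfun_le f g -> cfun_le (f + h) (g + h).
Proof. by move=> /asboolP fg; apply/asboolP => x; apply: lerD. Qed.

Lemma cfun_le_wpscale (a : R) (f g : cfun) :
  0 <= a -> cfun_le f g -> cfun_le (a *: f) (a *: g).
Proof. by move=> a0 /asboolP fg; apply/asboolP => x; apply: ler_wpM2l. Qed.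

Lemma cfun_pos (f : cfun) : exists p : cfun,
  [/\ cfun_le 0 p, cfun_le f p & forall q, cfun_le 0 q -> cfun_le f q -> cfun_le p q].
Proof.
have cp : continuous (fun x => Num.max (f x : R) 0).
  move=> x; apply: continuous_max; [exact: cfun_continuous|exact: cst_continuous].
exists (mkcfun cp); split.
- by apply/asboolP => x /=; rewrite le_max lexx orbT.
- by apply/asboolP => x /=; rewrite le_max lexx.
- move=> q /asboolP q0 /asboolP fq; apply/asboolP => x /=.
  by rewrite ge_max fq; exact: q0.
Qed.

HB.instance Definition _ := Lmodule_isVectorLattice.Build R cfun
  cfun_le_refl cfun_le_anti cfun_le_trans cfun_le_add2r cfun_le_wpscale cfun_pos.

Lemma cfun_leP (f g : cfun) : f <= g <-> forall x, (f x : R) <= g x.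
Proof. by split=> /asboolP. Qed.

Lemma cfunDE (f g : cfun) x : (f + g) x = f x + g x :> R. Proof. by []. Qed.
Lemma cfunZE a (f : cfun) x : (a *: f) x = a * f x :> R. Proof. by []. Qed.
Lemma cfunNE (f : cfun) x : (- f) x = - (f x : R) :> R. Proof. by []. Qed.
Lemma cfunBE (f g : cfun) x : (f - g) x = f x - g x :> R. Proof. by []. Qed.
Lemma cfun0E x : (0 : cfun) x = 0 :> R. Proof. by []. Qed.

Definition ccst (c : R) : cfun := mkcfun (fun x => @cst_continuous K R c x).

End ContinuousFunctions.
Arguments ccst {R K} c.

Section CompactFunctions.
Variables (R : realType) (K : compactHausdorffType).

Lemma cfun_bounded (f : cfun R K) : exists2 M : R, 0 <= M & forall x, `|f x : R| <= M.
Proof.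
have cf : compact ((f : K -> R) @` [set: K]).
  apply: continuous_compact; last exact: compactT.
  by apply: continuous_subspaceT => x; exact: cfun_continuous.
have [M [_ HM]] := compact_bounded cf.
exists (`|M| + 1) => [|x]; first by rewrite addr_ge0.
by apply: (HM (`|M| + 1)); [rewrite ltr_pwDr// ler_norm|exists x].
Qed.

Lemma urysohn_cfun (A B : set K) : closed A -> closed B -> A `&` B = set0 ->
  exists f : cfun R K, [/\ forall x, 0 <= (f x : R) <= 1, forall x, A x -> f x = 0 :> R
    & forall x, B x -> f x = 1 :> R].
Proof.
move=> cA cB AB; have nK := compact_normal (@hausdorffT K) (@compactT K).
have [f [cf fA fB f01]] := urysohn_ext_itv nK cA cB AB (@ltr01 R).
exists (mkcfun cf); split=> x /=.
- by have := f01 (f x) (imageT f x); rewrite /= in_itv.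
- by move=> Ax; apply: fA; exists x.
- by move=> Bx; apply: fB; exists x.
Qed.

End CompactFunctions.

(** * Integration against signed Radon measures *)

Section IntegralAgainstFiniteMeasures.
Variables (R : realType) (K : compactHausdorffType) (x0 : K).
Implicit Type m : {finite_measure set (borelType x0) -> \bar R}.

Lemma cfun_measurable (f : cfun R K) (D : set (borelType x0)) :
  measurable_fun D (f : borelType x0 -> R).
Proof.
apply: measurable_funS (@subsetT _ D) _ => //.
apply: (measurability _ (measurable_realfun.RGenOInfty.measurableE R)) => _ [_ [a ->] <-].
rewrite setTI; apply: sub_sigma_algebra.
have -> : f @^-1` `]a, +oo[%classic = (f : K -> R) @^-1` [set y | a < y].
  by apply/seteqP; split=> x /=; rewrite in_itv/= andbT.
by apply: open_comp => [x _|]; [exact: cfun_continuous|exact: open_gt].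
Qed.

Lemma cfun_integrable m (f : cfun R K) (D : set (borelType x0)) :
  measurable D -> m.-integrable D (EFin \o (f : borelType x0 -> R)).
Proof.
move=> mD; apply: measurable_bounded_integrable => //.
- by rewrite ltey_eq fin_num_measure.
- exact: cfun_measurable.
- have [M M0 fM] := cfun_bounded f; exists M; split; first exact: num_real.
  by move=> N MN x _; apply: le_trans (fM x) (ltW MN).
Qed.

(** From jp - jn = m1 - m2 on measurable sets, the measures jp + m2 and m1 + jn agree. Integrating
    against both and regrouping finite terms frees the integral from the Hahn decomposition. *)
Lemma charge_integral_sub (nu : {charge set (borelType x0) -> \bar R})
    (m1 m2 : {finite_measure set (borelType x0) -> \bar R}) D (f : cfun R K) :
  (forall A, measurable A -> nu A = m1 A - m2 A)%E -> measurable D ->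
  charge_integral nu D f = (Rintegral m1 D f - Rintegral m2 D f)%:E.
Proof.
move=> nuE mD; rewrite /charge_integral /=; set PN := (X in jordan_pos X).
set jp := jordan_pos PN; set jn := jordan_neg PN.
have ifin (m : {finite_measure set (borelType x0) -> \bar R}) :
    (\int[m]_(x in D) (f x)%:E = (Rintegral m D f)%:E)%E.
  by rewrite fineK//; apply: integrable_fin_num => //; exact: cfun_integrable.
have E : (\int[measure_add jp m2]_(x in D) (f x)%:E =
          \int[measure_add m1 jn]_(x in D) (f x)%:E)%E.
  apply: eq_measure_integral => A mA _; rewrite [LHS]measure_addE [RHS]measure_addE.
  have h : (nu A = jp A - jn A)%E.
    by rewrite (jordan_decomp PN mA) /cadd/= cscaleN1.
  suff : (jp A + m2 A = m1 A + jn A)%E by [].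
  have [a ja] : exists a, jp A = a%:E.
    by exists (fine (jp A)); rewrite fineK// fin_num_measure.
  have [b jb] : exists b, jn A = b%:E.
    by exists (fine (jn A)); rewrite fineK// fin_num_measure.
  have [c m1c] : exists c, m1 A = c%:E.
    by exists (fine (m1 A)); rewrite fineK// fin_num_measure.
  have [d m2d] : exists d, m2 A = d%:E.
    by exists (fine (m2 A)); rewrite fineK// fin_num_measure.
  move: h; rewrite nuE// ja jb m1c m2d -!EFinB -!EFinD => -[?].
  by congr (_%:E); lra.
move: E; rewrite !integral_measure_add//; try exact: cfun_integrable;
  try by apply/measurable_realfun.measurable_EFinP; exact: cfun_measurable.
have ip : (\int[jp]_(x in D) (f x)%:E = (Rintegral jp D f)%:E)%E := ifin _.
have jn' : (\int[jn]_(x in D) (f x)%:E = (Rintegral jn D f)%:E)%E := ifin _.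
suff: (\int[jp]_(x in D) (f x)%:E + \int[m2]_(x in D) (f x)%:E =
       \int[m1]_(x in D) (f x)%:E + \int[jn]_(x in D) (f x)%:E ->
       \int[jp]_(x in D) (f x)%:E - \int[jn]_(x in D) (f x)%:E =
       (Rintegral m1 D f - Rintegral m2 D f)%:E)%E by [].
rewrite ip jn' !ifin -!EFinD => -[E].
by congr (_%:E); lra.
Qed.

End IntegralAgainstFiniteMeasures.

Section PositiveRadonMeasures.
Variables (R : realType) (K : compactHausdorffType) (x0 : K) (mu : radonMeasure R K).
Hypothesis mu0 : 0 <= mu.

Let nu : {charge set (borelType x0) -> \bar R} :=
  charge_of x0 (@radon_sigma_additive R K mu).

Let nu0 (A : set (borelType x0)) : (0 <= nu A)%E.
Proof.
rewrite /nu /charge_of lee_fin; have [mA|nA] := pselect (borel K A).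
  by move/radon_leP: mu0; apply.
by have [-> //] := radonP mu.
Qed.

Definition posm : set (borelType x0) -> \bar R := measure_of_charge nu nu0.

HB.instance Definition _ := Measure.on posm.

Let posm_finite : fin_num_fun posm. Proof. by []. Qed.

HB.instance Definition _ := @Measure_isFinite.Build _ _ _ posm posm_finite.

End PositiveRadonMeasures.
Arguments posm {R K} x0 {mu} mu0 _.

Section RadonIntegral.
Variables (R : realType) (K : compactHausdorffType).
Implicit Types (mu nu : radonMeasure R K) (D A B : set K) (f g : cfun R K).

(* Locked, so that the integrals are atoms for [lra]. *)
Fact rint_key : unit. Proof. exact: tt. Qed.
Definition rint mu D (f : K -> R) : R :=
  locked_with rint_key (fine (radon_integral mu D f)).

Lemma rint_def mu D f : rint mu D f = fine (radon_integral mu D f).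
Proof. exact: unlock. Qed.

Lemma radon_decomposition mu : exists p n, [/\ 0 <= p, 0 <= n & mu = p - n].
Proof.
exists (vpos mu), (vneg mu); split; last exact/esym/vpos_vneg.
  exact: vpos_ge0.
exact: vneg_ge0.
Qed.

Lemma empty_space_borel A : ~ (exists _ : K, True) -> A = set0.
Proof. by move=> K0; apply/seteqP; split=> x //; case: K0; exists x. Qed.

Lemma radon_fun_set0 mu : mu set0 = 0 :> R.
Proof. exact: (borel_measure0 (@radon_sigma_additive R K mu)). Qed.

Lemma radon_integral_sub (K0 : exists _ : K, True) mu1 mu2 (h1 : 0 <= mu1)
    (h2 : 0 <= mu2) D f : borel K D ->
  radon_integral (mu1 - mu2) D f =
  (Rintegral (posm (sval (cid K0)) h1) D f
   - Rintegral (posm (sval (cid K0)) h2) D f)%:E.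
Proof.
move=> mD; rewrite /radon_integral; case: pselect => // K0'.
rewrite (Prop_irrelevance K0' K0).
by apply: charge_integral_sub.
Qed.

Lemma radon_integral_posm (K0 : exists _ : K, True) mu (mu0 : 0 <= mu) D f :
  borel K D ->
  radon_integral mu D f = (Rintegral (posm (sval (cid K0)) mu0) D f)%:E.
Proof.
move=> mD; have z0 : 0 <= (0 : radonMeasure R K) by [].
rewrite -{1}[mu]subr0 (radon_integral_sub _ mu0 z0)//.
suff -> : Rintegral (posm (sval (cid K0)) z0) D f = 0 by rewrite subr0.
rewrite /Rintegral (eq_measure_integral mzero) ?integral_measure_zero//.
Qed.

Lemma rint_empty mu D f : ~ (exists _ : K, True) -> rint mu D f = 0.
Proof. by move=> K0; rewrite rint_def /radon_integral; case: pselect. Qed.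

Lemma radon_integral_rint mu D f : borel K D ->
  radon_integral mu D f = (rint mu D f)%:E.
Proof.
move=> mD; have [K0|K0] := pselect (exists _ : K, True); last first.
  by rewrite rint_empty// /radon_integral; case: pselect.
have [p [n [p0 n0 ->]]] := radon_decomposition mu.
by rewrite rint_def (radon_integral_sub K0 p0 n0).
Qed.

Lemma rint_sub mu1 mu2 D f : 0 <= mu1 -> 0 <= mu2 -> borel K D ->
  rint (mu1 - mu2) D f = rint mu1 D f - rint mu2 D f.
Proof.
move=> h1 h2 mD; have [K0|K0] := pselect (exists _ : K, True); last first.
  by rewrite !rint_empty// subr0.
by rewrite !rint_def (radon_integral_sub K0 h1 h2)// !(radon_integral_posm K0).
Qed.

Lemma rint_le mu D f g : 0 <= mu -> borel K D ->
  (forall x, D x -> (f x : R) <= g x) -> rint mu D f <= rint mu D g.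
Proof.
move=> mu0 mD fg; have [K0|K0] := pselect (exists _ : K, True); last first.
  by rewrite !rint_empty.
rewrite !rint_def !(radon_integral_posm K0 mu0)//=.
by apply: le_Rintegral => //; exact: cfun_integrable.
Qed.

Lemma rintD mu D f g : borel K D -> rint mu D (f + g) = rint mu D f + rint mu D g.
Proof.
move=> mD; have [K0|K0] := pselect (exists _ : K, True); last first.
  by rewrite !rint_empty// addr0.
suff H nu : 0 <= nu -> rint nu D (f + g) = rint nu D f + rint nu D g.
  have [p [n [p0 n0 ->]]] := radon_decomposition mu.
  by rewrite !rint_sub// (H p)// (H n)//; lra.
move=> nu0; rewrite !rint_def !(radon_integral_posm K0 nu0)//=.
by apply: RintegralD => //; exact: cfun_integrable.
Qed.

Lemma rintZ mu D (a : R) f : borel K D -> rint mu D (a *: f) = a * rint mu D f.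
Proof.
move=> mD; have [K0|K0] := pselect (exists _ : K, True); last first.
  by rewrite !rint_empty// mulr0.
suff H nu : 0 <= nu -> rint nu D (a *: f) = a * rint nu D f.
  have [p [n [p0 n0 ->]]] := radon_decomposition mu.
  by rewrite !rint_sub// (H p)// (H n)// mulrBr.
move=> nu0; rewrite !rint_def !(radon_integral_posm K0 nu0)//=.
by apply: RintegralZl => //; exact: cfun_integrable.
Qed.

Lemma rint_cst mu D (c : R) : borel K D -> rint mu D (ccst c : cfun R K) = c * mu D.
Proof.
move=> mD; have [K0|K0] := pselect (exists _ : K, True); last first.
  by rewrite rint_empty// (@empty_space_borel D K0) radon_fun_set0 mulr0.
suff H nu : 0 <= nu -> rint nu D (ccst c : cfun R K) = c * nu D.
  have [p [n [p0 n0 ->]]] := radon_decomposition mu.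
  by rewrite rint_sub// (H p)// (H n)// -mulrBr.
move=> nu0; rewrite !rint_def !(radon_integral_posm K0 nu0)//=.
rewrite Rintegral_cst//.
Qed.

Lemma rintU mu A B f : borel K A -> borel K B -> A `&` B = set0 ->
  rint mu (A `|` B) f = rint mu A f + rint mu B f.
Proof.
move=> mA mB AB; have mAB := borelU mA mB.
have [K0|K0] := pselect (exists _ : K, True); last first.
  by rewrite !rint_empty// addr0.
suff H nu : 0 <= nu -> rint nu (A `|` B) f = rint nu A f + rint nu B f.
  have [p [n [p0 n0 ->]]] := radon_decomposition mu.
  by rewrite !rint_sub// (H p)// (H n)//; lra.
move=> nu0; rewrite !rint_def !(radon_integral_posm K0 nu0)//=.
by apply: Rintegral_setU => //; [exact: (cfun_integrable _ _ mAB)|apply/disj_set2P].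
Qed.

(** For positive [mu] the integrals over the pieces form a series of nonnegative terms, which
    converges to its sum; a signed [mu] is split into positive parts. *)
Lemma rint_sigma_additive mu f : 0 <= f ->
  borel_sigma_additive (fun A => rint mu A f).
Proof.
move=> /cfun_leP f0 F mF tF; have mUF := borel_bigcup mF.
have [K0|K0] := pselect (exists _ : K, True); last first.
  under eq_fun do under eq_bigr do rewrite rint_empty//.
  by rewrite rint_empty//; under eq_fun do rewrite big1//; exact: cvg_cst.
suff H nu : 0 <= nu ->
    (fun n => \sum_(0 <= i < n) rint nu (F i) f) @ \oo --> rint nu (\bigcup_n F n) f.
  have [p [n [p0 n0 ->]]] := radon_decomposition mu; rewrite rint_sub//.
  under eq_fun do (under eq_bigr do rewrite rint_sub//; rewrite sumrB).
  by apply: cvgB; exact: H.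
move=> nu0; set m := posm (sval (cid K0)) nu0.
have fE A : borel K A -> (\int[m]_(x in A) (f x)%:E = (rint nu A f)%:E)%E.
  move=> mA; rewrite -radon_integral_rint// (radon_integral_posm K0 nu0)//.
  by rewrite fineK//; apply: integrable_fin_num => //; exact: cfun_integrable.
have := integral_bigcup (mu := m) (g := EFin \o f) tF mF (cfun_integrable _ _ mUF).
rewrite fE//= => E.
have : (fun n => \sum_(0 <= i < n) \int[m]_(x in F i) (f x)%:E)%E @ \oo -->
    (rint nu (\bigcup_n F n) f)%:E.
  rewrite E; apply: is_cvg_nneseries => n _ _.
  by apply: integral_ge0 => x _; rewrite lee_fin; exact: f0.
under eq_fun do (under eq_bigr do rewrite fE//; rewrite sumEFin).
by move/fine_cvgP => -[_].
Qed.

Lemma rint_addm mu nu D f : borel K D ->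
  rint (mu + nu) D f = rint mu D f + rint nu D f.
Proof.
move=> mD; have [K0|K0] := pselect (exists _ : K, True); last first.
  by rewrite !rint_empty// addr0.
suff H mu1 mu2 : 0 <= mu1 -> 0 <= mu2 -> rint (mu1 + mu2) D f = rint mu1 D f + rint mu2 D f.
  have [p [n [p0 n0 ->]]] := radon_decomposition mu.
  have [q [k [q0 k0 ->]]] := radon_decomposition nu.
  rewrite addrACA -opprD !rint_sub ?addv_ge0//.
  by rewrite (H p q)// (H n k)//; lra.
move=> h1 h2; have h12 := addv_ge0 h1 h2.
rewrite !rint_def (radon_integral_posm K0 h1)// (radon_integral_posm K0 h2)//.
rewrite (radon_integral_posm K0 h12)//= /Rintegral -fineD; last 2 first.
- by apply: integrable_fin_num => //; exact: cfun_integrable.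
- by apply: integrable_fin_num => //; exact: cfun_integrable.
set x0 := sval (cid K0).
have iD (m : {finite_measure set (borelType x0) -> \bar R}) := cfun_integrable m f mD.
have := @integral_measure_add _ (borelType x0) R (posm x0 h1) (posm x0 h2) D mD
  (EFin \o f) (iD _) (iD _) => /= <-.
by congr fine; apply: eq_measure_integral => A mA _; rewrite [RHS]measure_addE.
Qed.

Lemma rint0m D f : borel K D -> rint 0 D f = 0.
Proof.
move=> mD; have := rint_addm 0 0 f mD; rewrite addr0 => /eqP.
by rewrite -subr_eq0 opprD addNKr oppr_eq0 => /eqP.
Qed.

Lemma rint_ge0 mu D f : 0 <= mu -> borel K D -> 0 <= f -> 0 <= rint mu D f.
Proof.
move=> mu0 mD /cfun_leP f0; rewrite -(mul0r (mu D : R)) -rint_cst//.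
by apply: rint_le => // x _; exact: f0.
Qed.

(** For positive [f] the integral is additive and positive in [mu] on the cone, hence homogeneous
    there; adding a constant to [f] and splitting [mu] removes the signs. *)
Lemma rint_scalem (a : R) mu D f : borel K D -> rint (a *: mu) D f = a * rint mu D f.
Proof.
move=> mD.
suff H nu g : 0 <= nu -> 0 <= g -> rint (a *: nu) D g = a * rint nu D g.
  have [M M0 fM] := cfun_bounded f.
  have H' nu : 0 <= nu -> rint (a *: nu) D f = a * rint nu D f.
    move=> nu0; have g0 : 0 <= f + ccst M.
      apply/cfun_leP => x; rewrite cfun0E cfunDE /=.
      by have := fM x; rewrite ler_norml => /andP[+ _]; rewrite -subr_ge0 opprK.
    have := H nu _ nu0 g0; rewrite !rintD// !rint_cst// mulrDr radon_funZ.
    by rewrite (mulrCA M) => /addIr.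
  have [p [n [p0 n0 ->]]] := radon_decomposition mu.
  rewrite rint_sub// scalerBr mulrBr -(H' p)// -(H' n)//.
  have := rint_addm (a *: p - a *: n) (a *: n) f mD; rewrite subrK => ->.
  by rewrite addrK.
move=> nu0 g0; have hom (b : R) : 0 <= b -> rint (b *: nu) D g = b * rint nu D g.
  move=> b0; apply: (additive_cone_homogeneous (g := fun mu => rint mu D g)) => //.
  - by move=> ? ? _ _; exact: rint_addm.
  - by move=> ? ?; exact: rint_ge0.
have [/hom//|/ltW] := leP 0 a; rewrite -oppr_ge0 => /hom Ha.
have := rint_addm (a *: nu) (- a *: nu) g mD.
rewrite -scalerDl subrr scale0r rint0m// Ha => /esym/eqP.
by rewrite addr_eq0 mulNr opprK => /eqP.
Qed.

End RadonIntegral.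

(* [compact_cover] requires a pointed space. *)
Lemma compact_subcover (T : topologicalType) (I : eqType) (A : set T)
    (U : I -> set T) : compact A -> (forall i, open (U i)) ->
  A `<=` \bigcup_i U i ->
  exists s : seq I, forall x, A x -> exists2 i, i \in s & U i x.
Proof.
move=> /compact_near_coveringP cA oU AU.
(* Members of [G] contain every list that includes the entries of some [s0]. Near-covering
   compactness for this filter turns the local choices into one list that works on all of [A]. *)
pose G : set_system (seq I) :=
  [set S | exists s0 : seq I, forall s : seq I, {subset s0 <= s} -> S s].
have FG : Filter G.
  split; first by exists [::].
    move=> P Q [s1 h1] [s2 h2]; exists (s1 ++ s2) => s hs.
    by split; [apply: h1|apply: h2] => i si; apply: hs; rewrite mem_cat si ?orbT.
  by move=> P Q PQ [s0 h0]; exists s0 => s /h0 /PQ.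
have [|s0 h0] := cA _ G (fun s x => exists2 i, i \in s & U i x) FG.
  move=> x /AU[i _ Uix]; exists (U i, [set s : seq I | i \in s]) => /=.
    split; first by apply: open_nbhs_nbhs; split.
    by exists [:: i] => s; apply; rewrite mem_head.
  by move=> [y s] /= [Uiy si]; exists i.
by exists s0; exact: h0.
Qed.

(** * The functional defined by a Radon measure *)

Section RadonFunctional.
Variables (R : realType) (K : compactHausdorffType).
Implicit Types (mu nu : radonMeasure R K) (A B C D U : set K) (f g h : cfun R K).

Lemma borel_open U : open U -> borel K U.
Proof. exact: sub_sigma_algebra. Qed.

Lemma borelT : borel K setT.
Proof. by apply: borel_open; exact: openT. Qed.

Lemma closed_compactK C : closed C -> compact C.
Proof. by move=> cC; exact: (subclosed_compact cC (@compactT K) (@subsetT _ C)). Qed.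

Lemma radon_funU mu A B : borel K A -> borel K B -> A `&` B = set0 ->
  mu (A `|` B) = mu A + mu B :> R.
Proof. exact: (borel_measureU (@radon_sigma_additive R K mu)). Qed.

Lemma radon_fun_le mu A B : 0 <= mu -> borel K A -> borel K B -> A `<=` B ->
  (mu A : R) <= mu B.
Proof.
move=> /radon_leP mu0 mA mB AB; rewrite -(setDUK AB) radon_funU ?setIDK//.
- by rewrite lerDl; apply: mu0; exact: borelD.
- exact: borelD.
- by rewrite setDE setICA setICr setI0.
Qed.

Lemma radon_inner mu A (e : R) : borel K A -> 0 < e ->
  exists C, [/\ compact C, C `<=` A &
    forall B, borel K B -> B `<=` A `\` C -> `|mu B : R| <= e].
Proof.
move=> mA e0; have [_ mD reg] := radonP mu.
exact: (inner_regularP mD).1 reg A e mA e0.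
Qed.

Lemma rint_setD mu A f : borel K A ->
  rint mu setT f = rint mu A f + rint mu (~` A) f.
Proof.
move=> mA; rewrite -rintU ?setUv ?setICr//; exact: borelC.
Qed.

Lemma rint_homo mu D f g : 0 <= mu -> borel K D -> f <= g ->
  rint mu D f <= rint mu D g.
Proof. by move=> mu0 mD /cfun_leP fg; apply: rint_le. Qed.

Lemma rint_bounded mu : order_bounded (rint mu setT : cfun R K -> R).
Proof.
move=> u v; have mT := borelT; have [p [n [p0 n0 ->]]] := radon_decomposition mu.
exists (`|rint p setT u| + `|rint p setT v| + (`|rint n setT u| + `|rint n setT v|)).
move=> f uf fv.
have H nu : 0 <= nu -> `|rint nu setT f| <= `|rint nu setT u| + `|rint nu setT v|.
  move=> nu0; have := rint_homo nu0 mT uf; have := rint_homo nu0 mT fv.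
  have := ler_norm (rint nu setT v); have := ler_norm (- rint nu setT u).
  have := normr_ge0 (rint nu setT v); have := normr_ge0 (rint nu setT u).
  by rewrite normrN ler_norml => *; apply/andP; split; lra.
by rewrite rint_sub// (le_trans (ler_normB _ _))// lerD// H.
Qed.

Lemma rint_linear mu : linear (rint mu setT : cfun R K -> R^o).
Proof. by move=> a f g; rewrite rintD ?rintZ//; exact: borelT. Qed.

Definition riesz mu : orderDual (cfun R K) :=
  OrderDual (asboolT (conj (@rint_linear mu) (@rint_bounded mu))).

Lemma rieszE mu f : riesz mu f = rint mu setT f :> R. Proof. by []. Qed.

Lemma riesz_linear : linear riesz.
Proof.
move=> a mu nu; apply: order_dualP => f; have mT := borelT.
by rewrite order_dual_funD order_dual_funZ !rieszE rint_addm// rint_scalem.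
Qed.

(** The test function is 1 on [C] and 0 on [C'], a compact subset of the complement of [C] such that
    [nu] gives at most [e] to the rest of that complement. *)
Lemma rint_test_le mu nu C (e : R) : 0 <= mu -> 0 <= nu ->
  (forall f, 0 <= f -> rint mu setT f <= rint nu setT f) ->
  compact C -> 0 < e -> (mu C : R) <= nu C + e.
Proof.
move=> mu0 nu0 munu cC e0; have mC := borel_compact cC; have mT := borelT.
have [C' [cC' C'C HC']] := radon_inner nu (borelC mC) e0.
have mC' := borel_compact cC'.
have clC := compact_closed (@hausdorffT K) cC.
have clC' := compact_closed (@hausdorffT K) cC'.
have [|f [f01 f0 f1]] := @urysohn_cfun R K C' C clC' clC.
  by apply/seteqP; split=> x // -[/C'C].
have fge0 : 0 <= f by apply/cfun_leP => x; have /andP[] := f01 x.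
have step1 : (mu C : R) <= rint mu setT f.
  rewrite (rint_setD mu f mC) -[leLHS]addr0 lerD//; last first.
    by apply: rint_ge0 => //; exact: borelC.
  rewrite -[leLHS]mul1r -rint_cst//; apply: rint_le => // x Cx.
  by rewrite f1.
have step2 : rint nu setT f <= nu C + nu (~` C `\` C').
  rewrite (rint_setD nu f mC) lerD//.
    rewrite -[leRHS]mul1r -rint_cst//; apply: rint_le => // x Cx.
    by have /andP[] := f01 x.
  have E : ~` C = C' `|` (~` C `\` C') by rewrite setDUK.
  have mD : borel K (~` C `\` C') by apply: borelD => //; exact: borelC.
  rewrite {1}E rintU//; last by rewrite setDE setICA setICr setI0.
  rewrite -[leRHS]add0r lerD//.
    rewrite -(mul0r (nu C' : R)) -rint_cst//; apply: rint_le => // x C'x.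
    by rewrite f0.
  rewrite -[leRHS]mul1r -rint_cst//; apply: rint_le => // x _.
  by have /andP[] := f01 x.
apply: (le_trans step1); apply: (le_trans (munu _ fge0)); apply: (le_trans step2).
rewrite lerD2l (le_trans (ler_norm _))// HC'//.
by apply: borelD => //; exact: borelC.
Qed.

(** To reflect the order, write nu - mu = p - n with p and n positive. On positive functions n is
    below p; [rint_test_le] passes this to compact sets and inner regularity of [n] to Borel sets,
    each at the cost of e / 2. *)
Lemma riesz_le mu nu : (riesz mu <= riesz nu) = (mu <= nu).
Proof.
have mT := borelT; apply/idP/idP => [/order_dual_leP h|munu]; last first.
  apply/order_dual_leP => f f0; rewrite !rieszE -subr_ge0.
  have -> : rint nu setT f - rint mu setT f = rint (nu - mu) setT f.
    by rewrite rint_addm// -(scaleN1r mu) rint_scalem// mulN1r.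
  by rewrite rint_ge0// subv_ge0.
have [p [n [p0 n0 lamE]]] := radon_decomposition (nu - mu).
have np f : 0 <= f -> rint n setT f <= rint p setT f.
  move=> f0; have := h f f0; rewrite !rieszE -[nu](subrK mu) lamE.
  by rewrite rint_addm// rint_sub//; lra.
rewrite -subv_ge0 lamE subv_ge0; apply/radon_leP => A mA.
apply/ler_addgt0Pr => e e0; have e20 : 0 < e / 2 by rewrite divr_gt0.
have [C [cC CA HC]] := radon_inner n mA e20; have mC := borel_compact cC.
have mAC := borelD mA mC.
have := HC _ mAC (@subset_refl _ _); rewrite ler_norml => /andP[_ h1].
have h2 := rint_test_le n0 p0 np cC e20.
have h3 := radon_fun_le p0 mC mA CA.
have h4 : n A = n C + n (A `\` C) :> R.
  by rewrite -radon_funU ?setDUK// setDE setICA setICr setI0.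
by rewrite [leLHS]h4; lra.
Qed.

Definition cmin f (c : R) : cfun R K :=
  mkcfun (fun x => continuous_min (@cfun_continuous R K f x) (@cst_continuous K R c x)).

Definition cmul f g : cfun R K :=
  mkcfun (fun x => continuousM (@cfun_continuous R K f x) (@cfun_continuous R K g x)).

Lemma cminE f c x : cmin f c x = Num.min (f x : R) c. Proof. by []. Qed.
Lemma cmulE f g x : cmul f g x = (f x : R) * g x. Proof. by []. Qed.

Lemma cfun_open_gt f (c : R) : open [set x | c < (f x : R)].
Proof.
have : open ((f : K -> R) @^-1` [set y | c < y]).
  by apply: open_comp => [x _|]; [exact: cfun_continuous|exact: open_gt].
by [].
Qed.

Lemma cfun_closed_ge f (c : R) : closed [set x | c <= (f x : R)].
Proof.
have : closed ((f : K -> R) @^-1` [set y | c <= y]).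
  by apply: closed_comp => [x _|]; [exact: cfun_continuous|exact: closed_ge].
by [].
Qed.

(** The relation between test functions and open sets in Riesz's construction, with vanishing off
    [U] in place of compact support in [U]. *)
Definition below_indic U f := (forall x, 0 <= (f x : R) <= 1) /\
  (forall x, ~ U x -> f x = 0 :> R).

(* Layer cake: with [g_k = min h k], the increment [g_(k+2) - g_(k+1)] lies
   below the indicator of [{h > k+1}], on which [g_(k+1) - g_k] equals 1. *)
Lemma layer_cake_le mu (L : orderDual (cfun R K)) h : 0 <= mu -> 0 <= L ->
  (forall U f, open U -> below_indic U f -> (L f : R) <= mu U) ->
  L (ccst 1) = mu setT :> R -> 0 <= h ->
  (L h : R) <= mu setT + rint mu setT h.
Proof.
move=> mu0 L0 LU L1 /cfun_leP h0; have mT := borelT.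
have main k : (L (cmin h k.+1%:R) : R) <= mu setT + rint mu setT (cmin h k%:R).
  elim: k => [|k IH].
    (* The bottom layer min h 1 is bounded by L 1 = mu setT, and shifting the levels by one leaves
       this as the only error. *)
    rewrite (_ : cmin h 0%:R = 0); last first.
      by apply: cfun_eqP => x; rewrite cminE min_r//; exact: h0.
    have := rintD mu (0 : cfun R K) 0 mT; rewrite addr0 => E0.
    have -> : rint mu setT (0 : cfun R K) = 0 by lra.
    rewrite addr0 -L1; apply: od_homo => //; apply/cfun_leP => x.
    by rewrite cminE /= ge_min lexx orbT.
  set U := [set x | k.+1%:R < (h x : R)].
  have oU : open U := cfun_open_gt h k.+1%:R.
  have mU := borel_open oU.
  have h1 : (L (cmin h k.+2%:R - cmin h k.+1%:R) : R) <= mu U.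
    apply: LU => //; split=> x.
      rewrite cfunBE !cminE -natr1; move: (k.+1%:R : R) (h x : R) => a b.
      by rewrite !minEle; do 2 case: ifPn; rewrite -?ltNge => *; apply/andP; split; lra.
    move=> /negP; rewrite -leNgt => hx; rewrite cfunBE !cminE !min_l ?subrr//.
    by rewrite (le_trans hx)// ler_nat.
  have h2 : mu U <= rint mu setT (cmin h k.+1%:R - cmin h k%:R).
    have inc x : 0 <= (cmin h k.+1%:R - cmin h k%:R) x :> R.
      rewrite cfunBE !cminE -natr1; move: (k%:R : R) (h x : R) => a b.
      by rewrite !minEle; do 2 case: ifPn; rewrite -?ltNge => *; lra.
    rewrite (rint_setD mu _ mU) -[leLHS]addr0 lerD//; last first.
      by apply: rint_ge0 => //; [exact: borelC|apply/cfun_leP].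
    rewrite -[leLHS]mul1r -rint_cst//; apply: rint_le => // x Ux.
    have {}Ux : k.+1%:R < (h x : R) by [].
    move: Ux; rewrite cfunBE !cminE -natr1 /=; move: (k%:R : R) (h x : R) => a b.
    by rewrite !minEle; do 2 case: ifPn; rewrite -?ltNge => *; lra.
  have h3 : L (cmin h k.+2%:R) = L (cmin h k.+2%:R - cmin h k.+1%:R) + L (cmin h k.+1%:R) :> R.
    by rewrite -od_funD subrK.
  have h4 : rint mu setT (cmin h k.+1%:R) =
      rint mu setT (cmin h k.+1%:R - cmin h k%:R) + rint mu setT (cmin h k%:R).
    by rewrite -rintD// subrK.
  by rewrite [leLHS]h3 h4; lra.
have [M M0 hM] := cfun_bounded h.
set k := Num.truncn M; have kM : M <= k.+1%:R by rewrite ltW// truncnS_gt.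
have E n : (k < n)%N -> cmin h n%:R = h.
  move=> kn; apply: cfun_eqP => x; rewrite cminE min_l//.
  rewrite (le_trans (ler_norm _))// (le_trans (hM x))// (le_trans kM)//.
  by rewrite ler_nat.
by have := main k.+1; rewrite !E.
Qed.

(** The error mu setT in [layer_cake_le] does not grow with [h]: applied to n h and divided by n, it
    disappears as n grows. Adding a constant, on which both sides agree, extends the inequality to
    every [f], and passing to - f gives equality. *)
Lemma layer_cake mu (L : orderDual (cfun R K)) : 0 <= mu -> 0 <= L ->
  (forall U f, open U -> below_indic U f -> (L f : R) <= mu U) ->
  L (ccst 1) = mu setT :> R -> L = riesz mu.
Proof.
move=> mu0 L0 LU L1; have mT := borelT.
have pos h : 0 <= h -> (L h : R) <= rint mu setT h.
  move=> h0; rewrite leNgt; apply/negP => lt_h.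
  set d := L h - rint mu setT h; have d0 : 0 < d by rewrite subr_gt0.
  pose n := (Num.truncn (mu setT / d)).+1.
  have nd : mu setT < n%:R * d by rewrite -ltr_pdivrMr// truncnS_gt.
  have := layer_cake_le mu0 L0 LU L1 (scalev_ge0 (ler0n R n) h0).
  rewrite od_funZ rintZ//; move: nd; rewrite /d; nra.
have le f : (L f : R) <= rint mu setT f.
  have [M M0 fM] := cfun_bounded f.
  have /pos : 0 <= f + ccst M.
    apply/cfun_leP => x; rewrite cfun0E cfunDE /=.
    by have := fM x; rewrite ler_norml => /andP[+ _]; rewrite -subr_ge0 opprK.
  have -> : ccst M = M *: ccst 1 :> cfun R K.
    by apply: cfun_eqP => x; rewrite cfunZE /= mulr1.
  by rewrite rintD// rintZ// od_funD od_funZ L1 rint_cst// mul1r lerD2r.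
apply: order_dualP => f; apply/le_anti; rewrite rieszE le/=.
have := le (- f); rewrite -(scaleN1r f) rintZ// od_funZ !mulN1r.
by rewrite lerN2.
Qed.

End RadonFunctional.

(** * The Riesz representation theorem *)

Section OuterMeasure.
Variables (R : realType) (K : compactHausdorffType) (L : orderDual (cfun R K)).
Hypothesis L0 : 0 <= L.
Implicit Types (A B C U V X : set K) (f g h : cfun R K).

Let L1 : R := L (ccst 1).
Let L1_ge0 : 0 <= L1.
Proof. by rewrite -(od_fun0 L); apply: od_homo => //; apply/cfun_leP => x /=. Qed.

Lemma below_indic0 U : below_indic U (0 : cfun R K).
Proof. by split=> [x|x _]; rewrite cfun0E ?lexx ?ler01. Qed.

Lemma below_indic_sub U V f : U `<=` V -> below_indic U f -> below_indic V f.
Proof. by move=> UV [f01 f0]; split=> // x Vx; apply: f0 => /UV. Qed.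

(** The content of open sets in Riesz's construction. *)
Definition inner_content U : R := sup [set (L f : R) | f in below_indic U].

Let inner_content_has_sup U : has_sup [set (L f : R) | f in below_indic U].
Proof.
split; first by exists (L 0), 0 => //; exact: below_indic0.
exists L1 => _ [f [f01 _] <-]; apply: od_homo => //; apply/cfun_leP => x /=.
by have /andP[] := f01 x.
Qed.

Lemma inner_content_ub U f : below_indic U f -> (L f : R) <= inner_content U.
Proof. by move=> Uf; apply: ub_le_sup; [exact: (inner_content_has_sup U).2|exists f]. Qed.

Lemma inner_content_le U (M : R) : (forall f, below_indic U f -> (L f : R) <= M) ->
  inner_content U <= M.
Proof.
move=> H; apply: ge_sup; first exact: (inner_content_has_sup U).1.
by move=> _ [f Uf <-]; exact: H.
Qed.

Lemma inner_content_ge0 U : 0 <= inner_content U.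
Proof. by rewrite -(od_fun0 L) inner_content_ub//; exact: below_indic0. Qed.

Lemma inner_content_homo U V : U `<=` V -> inner_content U <= inner_content V.
Proof. by move=> UV; apply: inner_content_le => f /(below_indic_sub UV)/inner_content_ub. Qed.

Lemma inner_contentT : inner_content setT = L1.
Proof.
apply/le_anti/andP; split.
  apply: inner_content_le => f [f01 _]; apply: od_homo => //; apply/cfun_leP => x /=.
  by have /andP[] := f01 x.
apply: inner_content_ub; split=> [x|x []//]; apply/andP.
by split; [exact: ler01|exact: lexx].
Qed.

Lemma inner_content0 : inner_content set0 = 0.
Proof.
apply/le_anti; rewrite inner_content_ge0 andbT; apply: inner_content_le => f [_ f0].
by rewrite (_ : f = 0) ?od_fun0//; apply: cfun_eqP => x; rewrite f0.
Qed.

(** This is (f - e)^+, supported in the compact set {f >= e}; it replaces approximation by functions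
    of compact support. *)
Definition cshrink (e : R) f : cfun R K := f - cmin f e.

Lemma cshrinkE e f x : cshrink e f x = (f x : R) - Num.min (f x : R) e.
Proof. by []. Qed.

Lemma cshrink_eq0 e f x : f x <= e -> cshrink e f x = 0 :> R.
Proof. by move=> fe; rewrite cshrinkE min_l// subrr. Qed.

Lemma cshrink_le e f : (L f : R) <= L (cshrink e f) + e * L1.
Proof.
rewrite -od_funZ -od_funD; apply: od_homo => //; apply/cfun_leP => x.
rewrite cfunDE cfunZE cshrinkE /= mulr1 minEle; case: ifPn => [h|_].
  by rewrite subrr add0r.
by rewrite subrK.
Qed.

Lemma below_indic_shrink U V f (e : R) : 0 < e -> below_indic U f ->
  (forall x, e <= (f x : R) -> V x) -> below_indic V (cshrink e f).
Proof.
move=> e0 [f01 f0] V1; split=> x.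
  have := f01 x; rewrite cshrinkE minEle => /andP[? ?].
  by case: ifPn; rewrite -?ltNge => ?; apply/andP; split; lra.
move=> Vx; apply: cshrink_eq0; apply: ltW; rewrite ltNge; apply/negP.
by move=> /V1.
Qed.

Lemma inner_content_eps U (M : R) : (forall f (e : R), below_indic U f -> 0 < e ->
  (L (cshrink e f) : R) <= M) -> inner_content U <= M.
Proof.
move=> H; apply: inner_content_le => f Uf; apply/ler_addgt0Pr => e e0.
(* Shrinking by a constant costs at most that constant times [L1], which may be 0; hence the divisor
   [L1 + 1]. *)
have e'0 : 0 < e / (L1 + 1) by rewrite divr_gt0// ltr_wpDl.
rewrite (le_trans (cshrink_le (e / (L1 + 1)) f))// lerD ?H//.
by rewrite mulrAC ler_pdivrMr ?ltr_wpDl// ler_pM2l// lerDl.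
Qed.

(* On the compact set [{f >= e}], contained in [U `|` V], a Urysohn function
   for the closed sets [{f >= e} \ U] and [{f >= e} \ V] splits [(f - e)^+]. *)
Lemma inner_contentU U V : open U -> open V ->
  inner_content (U `|` V) <= inner_content U + inner_content V.
Proof.
move=> oU oV; apply: inner_content_eps => f e UVf e0; have [f01 f0] := UVf.
set C := [set x | e <= (f x : R)].
have cC : closed C := @cfun_closed_ge _ _ f e.
have CUV : C `<=` U `|` V.
  move=> x Cx; apply: contrapT => /f0 fx; move: Cx; rewrite /C /= fx.
  by rewrite leNgt e0.
have cU : closed (C `\` U) by rewrite setDE; apply: closedI => //; exact: open_closedC.
have cV : closed (C `\` V) by rewrite setDE; apply: closedI => //; exact: open_closedC.
have [|g [g01 g0 g1]] := @urysohn_cfun R K _ _ cU cV.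
  by apply/seteqP; split=> x // -[[Cx nU] [_ nV]]; case: (CUV x Cx).
set s := cshrink e f; have sE : s = cmul s g + cmul s (ccst 1 - g).
  apply: cfun_eqP => x; rewrite cfunDE !cmulE cfunBE /=.
  by move: (s x : R) (g x : R) => a b; lra.
have [s01 s0] : below_indic C s by apply: (below_indic_shrink e0 UVf).
have unit_mul (a b : R) : 0 <= a <= 1 -> 0 <= b <= 1 -> 0 <= a * b <= 1.
  by move=> /andP[a0 a1] /andP[b0 b1]; rewrite mulr_ge0// mulr_ile1.
have unit_sub (a : R) : 0 <= a <= 1 -> 0 <= 1 - a <= 1.
  by move=> /andP[a0 a1]; apply/andP; split; lra.
rewrite sE od_funD lerD//; apply: inner_content_ub; split=> x.
- by rewrite cmulE; exact: unit_mul.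
- move=> nU; rewrite cmulE; have [Cx|nC] := pselect (C x).
    by rewrite g0 ?mulr0.
  by rewrite s0 ?mul0r.
- by rewrite cmulE cfunBE; exact: unit_mul (s01 x) (unit_sub _ (g01 x)).
- move=> nV; rewrite cmulE cfunBE; have [Cx|nC] := pselect (C x).
    by rewrite g1 ?subrr ?mulr0.
  by rewrite s0 ?mul0r.
Qed.

Lemma inner_content_finite_union (U : nat -> set K) n : (forall i, open (U i)) ->
  inner_content (\bigcup_(i in `I_n) U i) <= \sum_(0 <= i < n) inner_content (U i).
Proof.
move=> oU; elim: n => [|n IH]; first by rewrite II0 bigcup_set0 inner_content0 big_geq.
rewrite IIS bigcup_setU bigcup_set1 big_nat_recr//=.
rewrite (le_trans (inner_contentU _ _))//; last by rewrite lerD2r.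
by apply: bigcup_open => i _; exact: oU.
Qed.

(** The set where a test function is at least [e] is compact, hence covered by finitely many [U i];
    finite subadditivity then bounds the shrunk test function. *)
Lemma inner_content_bigcup (U : nat -> set K) : (forall i, open (U i)) ->
  ((inner_content (\bigcup_i U i))%:E <= \sum_(i <oo) (inner_content (U i))%:E)%E.
Proof.
move=> oU.
have H f e : below_indic (\bigcup_i U i) f -> 0 < e ->
    ((L (cshrink e f) : R)%:E <= \sum_(i <oo) (inner_content (U i))%:E)%E.
  move=> Uf e0; have [f01 f0] := Uf.
  have cC : compact [set x | e <= (f x : R)].
    exact: closed_compactK (@cfun_closed_ge _ _ f e).
  have CU : [set x | e <= (f x : R)] `<=` \bigcup_i U i.
    move=> x Cx; apply: contrapT => /f0 fx; move: Cx; rewrite /= fx.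
    by rewrite leNgt e0.
  have [D DC] := compact_subcover cC oU CU.
  pose n := (\max_(i <- D) i).+1.
  have Un : [set x | e <= (f x : R)] `<=` \bigcup_(i in `I_n) U i.
    move=> x /DC[i iD Uix]; exists i => //=.
    by rewrite /n ltnS (@leq_bigmax_seq _ D xpredT id).
  apply: (@le_trans _ _ (\sum_(0 <= i < n) inner_content (U i))%:E).
    rewrite lee_fin (le_trans _ (inner_content_finite_union _ oU))// inner_content_ub//.
    exact: (below_indic_shrink e0 Uf Un).
  rewrite -sumEFin; apply: nneseries_lim_ge => i _ _.
  by rewrite lee_fin inner_content_ge0.
move: H; set S := (\sum_(i <oo) _)%E => H.
have S0 : (0 <= S)%E by apply: nneseries_ge0 => i _ _; rewrite lee_fin inner_content_ge0.
case: S S0 H => [r| |]// _ H; last by rewrite leey.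
by rewrite lee_fin; apply: inner_content_eps => f e Uf e0; rewrite -lee_fin; exact: H.
Qed.

Definition outer_content A : R :=
  inf [set inner_content U | U in [set U | open U /\ A `<=` U]].

Let outer_content_has_inf A : has_inf [set inner_content U | U in [set U | open U /\ A `<=` U]].
Proof.
split; first by exists (inner_content setT), setT => //; split=> //; exact: openT.
by exists 0 => _ [U _ <-]; exact: inner_content_ge0.
Qed.

Lemma outer_content_lb A U : open U -> A `<=` U -> outer_content A <= inner_content U.
Proof. by move=> oU AU; apply: ge_inf; [exact: (outer_content_has_inf A).2|exists U]. Qed.

Lemma outer_content_ge A (M : R) : (forall U, open U -> A `<=` U -> M <= inner_content U) ->
  M <= outer_content A.
Proof.
move=> H; apply: lb_le_inf; first exact: (outer_content_has_inf A).1.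
by move=> _ [U [oU AU] <-]; exact: H.
Qed.

Lemma outer_content_ge0 A : 0 <= outer_content A.
Proof. by apply: outer_content_ge => U _ _; exact: inner_content_ge0. Qed.

Lemma outer_content_open U : open U -> outer_content U = inner_content U.
Proof.
move=> oU; apply/le_anti; rewrite outer_content_lb//=.
by apply: outer_content_ge => V _; exact: inner_content_homo.
Qed.

Lemma outer_content_approx A (e : R) : 0 < e -> exists U,
  [/\ open U, A `<=` U & inner_content U < outer_content A + e].
Proof.
move=> e0; have [_ [U [oU AU] <-] h] := inf_adherent e0 (outer_content_has_inf A).
by exists U.
Qed.

Variable x0 : K.

(* The unused proof is what the instance below is inferred from. *)
Definition outer_content_ext (_ : 0 <= L) : set (pointed_at x0) -> \bar R :=
  fun A => (outer_content A)%:E.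

Local Notation oc_ext := (outer_content_ext L0).

Let oc_ext0 : oc_ext set0 = 0%E.
Proof. by rewrite /outer_content_ext outer_content_open ?inner_content0//; exact: open0. Qed.

Let oc_ext_ge0 A : (0 <= oc_ext A)%E. Proof. by rewrite lee_fin outer_content_ge0. Qed.

Let oc_ext_homo : {homo oc_ext : A B / A `<=` B >-> (A <= B)%E}.
Proof.
move=> A B AB; rewrite lee_fin; apply: outer_content_ge => U oU BU.
by apply: outer_content_lb => //; exact: subset_trans BU.
Qed.

Let oc_ext_sigma : sigma_subadditive oc_ext.
Proof.
move=> F; apply/lee_addgt0Pr => e e0.
have e'0 i : 0 < e / (2 ^ i.+1)%:R by rewrite divr_gt0// ltr0n expn_gt0.
have /choice[U UE] i := outer_content_approx (F i) (e'0 i).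
apply: (@le_trans _ _ (\sum_(i <oo) (inner_content (U i))%:E)%E).
  rewrite (le_trans _ (inner_content_bigcup _))//; last by move=> i; have [] := UE i.
  rewrite lee_fin outer_content_lb//; last by move=> x [i _ Fx]; exists i => //; have [_ + _] := UE i; apply.
  by apply: bigcup_open => i _; have [] := UE i.
apply: (le_trans _ (epsilon_trick xpredT (fun i => oc_ext_ge0 (F i)) (ltW e0))).
apply: lee_nneseries => i _; first by rewrite lee_fin inner_content_ge0.
by rewrite -EFinD lee_fin; have [_ _ /ltW] := UE i.
Qed.

HB.instance Definition _ := isOuterMeasure.Build R (pointed_at x0) oc_ext
  oc_ext0 oc_ext_ge0 oc_ext_homo oc_ext_sigma.

(** For an open V containing X and f below the indicator of V [&] U, the set [W] is open and
    contains X minus U. A function g below the indicator of [W] and (f - e)^+ are nowhere both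
    nonzero, so their sum is below the indicator of V. *)
Lemma open_caratheodory U : open U -> (oc_ext : {outer_measure set _ -> \bar R}).-caratheodory U.
Proof.
move=> oU; apply: le_caratheodory_measurable => X.
rewrite /= /outer_content_ext -EFinD lee_fin; apply: outer_content_ge => V oV XV.
rewrite -lerBrDr (le_trans (outer_content_lb (openI oV oU) _))//; first by apply: setSI.
apply: inner_content_eps => f e fVU e0; rewrite lerBrDr -lerBrDl.
pose W := V `\` [set x | e <= (f x : R)].
have oW : open W.
  by rewrite /W setDE; apply: openI => //; apply: closed_openC; exact: cfun_closed_ge.
have [f01 f0] := fVU.
apply: (@le_trans _ _ (inner_content W)).
  apply: outer_content_lb => // x [Xx nUx]; split; first exact: XV.
  by rewrite /= f0 => [|[]//]; apply/negP; rewrite -ltNge.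
apply: inner_content_le => g [g01 g0]; rewrite lerBrDl -od_funD; apply: inner_content_ub.
have [s01 s0] : below_indic V (cshrink e f).
  apply: (below_indic_shrink e0 fVU) => x /= ex; apply: contrapT => nV.
  by move: ex; rewrite f0 => [|[]//]; rewrite leNgt e0.
split=> x; rewrite cfunDE.
  have [ex|ex] := leP e (f x : R).
    by rewrite g0 ?addr0//; move=> -[_]; apply.
  by rewrite cshrink_eq0 ?add0r// ltW.
by move=> nV; rewrite s0// g0 ?add0r//; move=> -[].
Qed.

Lemma borel_caratheodory A : borel K A ->
  (oc_ext : {outer_measure set _ -> \bar R}).-caratheodory A.
Proof.
move: A; apply: smallest_sub; last exact: open_caratheodory.
split.
- exact: caratheodory_measurable_set0.
- by move=> A mA; rewrite setTD; exact: caratheodory_measurable_setC.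
- by move=> F mF; exact: caratheodory_measurable_bigcup.
Qed.

End OuterMeasure.
Arguments outer_content_ext {R K L} x0 _ _.

Section RieszRepresentation.
Variables (R : realType) (K : compactHausdorffType).

(** The measure is the outer content on Borel sets, additive there by Caratheodory's theorem;
    [layer_cake] recognizes its functional as [L] from open sets and the total mass. *)
Lemma riesz_positive (L : orderDual (cfun R K)) : 0 <= L ->
  exists mu : radonMeasure R K, riesz mu = L.
Proof.
move=> L0; have mT := @borelT K.
have [[x0 _]|K0] := pselect (exists _ : K, True); last first.
  exists 0; apply: order_dualP => f; rewrite (_ : f = 0) ?od_fun0//.
  by apply: cfun_eqP => x; case: K0; exists x.
pose om : {outer_measure set (pointed_at x0) -> \bar R} := outer_content_ext x0 L0.
pose mu A : R^o := if `[< borel K A >] then outer_content L A else 0.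
have muE A : borel K A -> mu A = outer_content L A by move=> mA; rewrite /mu asboolT.
have mu_ge0 A : 0 <= (mu A : R).
  by rewrite /mu; case: ifP => // _; exact: outer_content_ge0.
have mu_add : borel_sigma_additive (mu : set K -> R).
  move=> F mF tF; have mUF := borel_bigcup mF.
  have := @caratheodory_measure_sigma_additive R (pointed_at x0) om F
    (fun i => @borel_caratheodory R K L L0 x0 _ (mF i)) tF (@borel_caratheodory R K L L0 x0 _ mUF).
  rewrite /om /= /outer_content_ext; under eq_fun do rewrite sumEFin.
  move=> /fine_cvgP[_]; rewrite (muE _ mUF).
  have -> // : (fun n => \sum_(0 <= i < n) mu (F i)) =
               (fun n => \sum_(0 <= i < n) outer_content L (F i)).
  by apply/funext => n; apply: eq_bigr => i _; exact: muE.
have mu_reg A (e : R) : borel K A -> 0 < e -> exists C, [/\ compact C, C `<=` A &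
    forall B, borel K B -> B `<=` A `\` C -> `|mu B : R| <= e].
  (* Approximating the complement of [A] from outside yields the compact set: the complement of [U]
     lies in [A], and what it misses of [A] is U [&] A, of mass less than [e]. *)
  move=> mA e0; have [U [oU AU hU]] := outer_content_approx L0 (~` A) e0.
  exists (~` U); split.
  - by apply: closed_compactK; exact: open_closedC.
  - by move=> x nU; apply: contrapT => /AU.
  - move=> B mB BA; have BU : B `<=` U.
      by move=> x /BA[_ /contrapT].
    have mU := borel_open oU; have mUA := borelI mU mA.
    have e1 : mu U = mu (U `&` A) + mu (U `\` A) := borel_measureI mu_add mU mA.
    have e2 : mu (U `&` A) = mu (U `&` A `&` B) + mu ((U `&` A) `\` B) :=
      borel_measureI mu_add mUA mB.
    have e3 : U `&` A `&` B = B.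
      by apply/seteqP; split=> [x []//|x Bx]; split=> //; split; [exact: BU|have [] := BA x Bx].
    have e4 : U `\` A = ~` A.
      by rewrite setDE; apply/setIidPr.
    have := mu_ge0 ((U `&` A) `\` B); move: hU.
    rewrite -(outer_content_open L0 oU) -!muE//; last exact: borelC.
    rewrite ger0_norm// e1 e2 e3 e4; lra.
have muP : mu \in @radon_pred R K.
  apply/asboolP; split=> // [A nA|]; first by rewrite /mu asboolF.
  exact/(inner_regularP mu_add).
exists (RadonMeasure muP); apply/esym/layer_cake => //.
- by apply/radon_leP => A _; exact: mu_ge0.
- move=> U f oU Uf; rewrite /= muE; last exact: borel_open.
  by rewrite outer_content_open//; exact: inner_content_ub.
- by rewrite /= muE// outer_content_open ?inner_contentT//; exact: openT.
Qed.

Lemma riesz_order_iso : order_iso (@riesz R K).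
Proof.
split; [exact: riesz_linear|exact: riesz_le|move=> L].
have [p pE] := riesz_positive (vpos_ge0 L).
have [n nE] := riesz_positive (vneg_ge0 L).
exists (p - n); rewrite linear_mapB; last exact: riesz_linear.
by rewrite pE nE vpos_vneg.
Qed.

End RieszRepresentation.

(** * Weighted composition maps *)

Section CozeroExtension.
Variables (R : realType) (K : compactHausdorffType) (w : K -> R).
Hypotheses (cw : continuous w) (w0 : forall x, 0 <= w x).
Implicit Type h : cozero w -> R.

Definition cozero_ext h (x : K) : R :=
  if pselect (cozero w x) is left Zx then w x * h (exist _ x (mem_set Zx)) else 0.

Lemma cozero_ext_in h (z : cozero w) : cozero_ext h (\val z) = w (\val z) * h z.
Proof.
rewrite /cozero_ext; case: pselect => [Zz|]; last by case; exact: set_valP.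
by congr (_ * h _); apply: val_inj.
Qed.

Lemma cozero_ext_out h x : ~ cozero w x -> cozero_ext h x = 0.
Proof. by move=> nZ; rewrite /cozero_ext; case: pselect. Qed.

Lemma cozero_ex x : cozero w x -> exists z : cozero w, \val z = x.
Proof. by move=> Zx; exists (exist _ x (mem_set Zx)). Qed.

Lemma cozeroN x : ~ cozero w x -> w x = 0.
Proof. by move=> /negP; rewrite negbK => /eqP. Qed.

Lemma cozero_open : open (cozero w).
Proof.
have -> : cozero w = [set x | 0 < (mkcfun cw x : R)].
  by apply/seteqP; split=> x; rewrite /cozero /= lt_def w0 andbT.
exact: cfun_open_gt.
Qed.

(** On the cozero set, which is open, this is a product of continuous functions. At a zero of [w],
    boundedness of [h] gives |w h| <= N w, and [w] tends to 0. *)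
Lemma cozero_ext_continuous h (M : R) : continuous h -> (forall z, `|h z| <= M) ->
  continuous (cozero_ext h).
Proof.
move=> ch hM x; have [Zx|nZ] := pselect (cozero w x).
  suff : {in cozero w, continuous (cozero_ext h)} by apply; exact: mem_set.
  rewrite -(continuous_open_subspace _ cozero_open); apply/subspace_sigL_continuousP.
  rewrite (_ : sigL _ _ = fun z : cozero w => w (\val z) * h z); last first.
    by apply/funext => z; rewrite -cozero_ext_in.
  have cv : continuous (set_val : cozero w -> K) :=
    @initial_continuous (cozero w) K set_val.
  move=> z; have h1 : {for z, continuous (w \o (set_val : cozero w -> K))}.
    by apply: continuous_comp; [exact: cv|exact: cw].
  exact: (continuousM h1 (@ch z)).
have [N N0 hN] : exists2 N : R, 0 <= N & forall y, `|cozero_ext h y| <= N * w y.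
  (* [M] itself may be negative when the cozero set is empty. *)
  exists `|M| => // y; have [/cozero_ex[z <-]|nZy] := pselect (cozero w y).
    rewrite cozero_ext_in normrM (ger0_norm (w0 _)) mulrC ler_wpM2r//.
    exact: le_trans (hM z) (ler_norm M).
  by rewrite cozero_ext_out// cozeroN// normr0 mulr0.
apply/cvgrPdist_lt => e e0; rewrite cozero_ext_out//.
have e1 : 0 < e / (N + 1) by rewrite divr_gt0// ltr_wpDl.
have : \forall y \near x, w y < e / (N + 1).
  have /cvgrPdist_lt/(_ _ e1) := @cw x; apply: filterS => y.
  by rewrite cozeroN// sub0r normrN (ger0_norm (w0 y)).
apply: filterS => y wy; rewrite sub0r normrN (le_lt_trans (hN y))//.
move: wy; rewrite ltr_pdivlMr ?ltr_wpDl// mulrC => lt_e; apply: le_lt_trans lt_e.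
by rewrite ler_wpM2r// lerDl.
Qed.

End CozeroExtension.

Section WeightedComposition.
Variables (R : realType) (K1 K2 : compactHausdorffType).
Variables (w : K2 -> R) (Y : set K1) (t : cozero w -> Y).
Hypotheses (cw : continuous w) (w0 : forall x, 0 <= w x) (ct : continuous t).

Let Z := cozero w.

Definition wcomp_fun (f : K1 -> R) : K2 -> R :=
  cozero_ext (fun z : cozero w => f (\val (t z))).

Lemma wcomp_fun_in f (z : Z) : wcomp_fun f (\val z) = w (\val z) * f (\val (t z)).
Proof. exact: cozero_ext_in. Qed.

Lemma wcomp_fun_out f x : ~ Z x -> wcomp_fun f x = 0.
Proof. exact: cozero_ext_out. Qed.

Lemma wcomp_continuous (f : cfun R K1) : continuous (wcomp_fun f).
Proof.
have [M _ fM] := cfun_bounded f.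
apply: (cozero_ext_continuous cw w0 (M := M)) => [z|z]; last exact: fM.
have cvY : continuous (set_val : Y -> K1) := @initial_continuous Y K1 set_val.
have : {for z, continuous ((f : K1 -> R) \o ((set_val : Y -> K1) \o t))}.
  apply: continuous_comp; last exact: cfun_continuous.
  by apply: continuous_comp; [exact: ct|exact: cvY].
exact.
Qed.

Definition wcomp (f : cfun R K1) : cfun R K2 := mkcfun (@wcomp_continuous f).

Lemma wcompE f x : wcomp f x = wcomp_fun f x :> R. Proof. by []. Qed.

Lemma wcomp_linear : linear wcomp.
Proof.
move=> a f g; apply: cfun_eqP => x; rewrite cfunDE cfunZE !wcompE.
have [/cozero_ex[z <-]|nZ] := pselect (Z x); last first.
  by rewrite !wcomp_fun_out// mulr0 addr0.
by rewrite !wcomp_fun_in mulrDr mulrCA.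
Qed.

Lemma wcomp_ge0 f : 0 <= f -> 0 <= wcomp f.
Proof.
move=> /cfun_leP f0; apply/cfun_leP => x; rewrite cfun0E wcompE.
have [/cozero_ex[z <-]|nZ] := pselect (Z x); last by rewrite wcomp_fun_out.
by rewrite wcomp_fun_in mulr_ge0//; exact: f0.
Qed.

Lemma wcomp1 : wcomp (ccst 1) = mkcfun cw.
Proof.
apply: cfun_eqP => x; rewrite wcompE /=.
have [/cozero_ex[z <-]|nZ] := pselect (Z x); last by rewrite wcomp_fun_out// cozeroN.
by rewrite wcomp_fun_in mulr1.
Qed.

(** This is t^-1[A] as a subset of [K2], the domain of integration in the formula for [p]. *)
Definition tpre (A : set K1) : set K2 :=
  [set \val x | x in [set x | A (\val (t x))]].

Lemma tpre_sub A : tpre A `<=` Z.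
Proof. by move=> _ [z _ <-]; exact: set_valP. Qed.

Lemma tpre_in A (z : Z) : tpre A (\val z) <-> A (\val (t z)).
Proof. by split=> [[z' Az' /val_inj <-//]|Az]; exists z. Qed.

Lemma tpreT : tpre setT = Z.
Proof.
by apply/seteqP; split=> [|x /cozero_ex[z <-]]; [exact: tpre_sub|exists z].
Qed.

Lemma tpre_open A : open A -> open (tpre A).
Proof.
move=> oA; have : open [set z : Z | A (\val (t z))].
  have : open ((\val \o t) @^-1` A).
    apply: open_comp => // z _; apply: continuous_comp; first exact: ct.
    exact: initial_continuous.
  by [].
move=> [W oW WE].
have -> : tpre A = W `&` Z.
  apply/seteqP; split=> [_ [z Az <-]|x [Wx /cozero_ex[z zx]]].
    split; last exact: set_valP.
    by move/seteqP: WE => [_ /(_ z Az)].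
  rewrite -zx; apply/tpre_in; move/seteqP: WE => [/(_ z) + _]; apply.
  by rewrite /= set_valE zx.
by apply: openI => //; exact: (cozero_open cw w0).
Qed.

Lemma tpre_borel A : borel K1 A -> borel K2 (tpre A).
Proof.
move: A; apply: smallest_sub; last first.
  by move=> A oA; apply: borel_open; exact: tpre_open.
split.
- rewrite /= (_ : tpre set0 = set0); first exact: borel0.
  by apply/seteqP; split=> [_ []//|x []].
- move=> A mA; rewrite /= setTD (_ : tpre (~` A) = Z `\` tpre A).
    by apply: borelD => //; apply: borel_open; exact: (cozero_open cw w0).
  apply/seteqP; split=> [_ [z nA <-]|x [/cozero_ex[z <-] nA]].
    by split; [exact: set_valP|rewrite tpre_in].
  by apply/tpre_in => Az; apply: nA; apply/tpre_in.
- move=> F mF; rewrite /= (_ : tpre (\bigcup_k F k) = \bigcup_k tpre (F k)).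
    exact: borel_bigcup.
  apply/seteqP; split=> [_ [z [k _ Fz] <-]|_ [k _ [z Fz <-]]].
    by exists k => //; exists z.
  by exists z => //; exists k.
Qed.

Lemma tpre_bigcup (F : nat -> set K1) : tpre (\bigcup_k F k) = \bigcup_k tpre (F k).
Proof.
apply/seteqP; split=> [_ [z [k _ Fz] <-]|_ [k _ [z Fz <-]]].
  by exists k => //; exists z.
by exists z => //; exists k.
Qed.

Definition timg (C : set K2) : set K1 :=
  [set \val (t z) | z in [set z : Z | C (\val z)]].

Lemma timg_compact (C : set K2) : compact C -> C `<=` Z -> compact (timg C).
Proof.
move=> cC CZ; have [[x0 Cx0]|C0] := pselect (C !=set0); last first.
  have -> : timg C = set0; last exact: compact0.
  by apply/seteqP; split=> // x [z Cz _]; case: C0; exists (\val z).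
have [z0 _] := cozero_ex (CZ _ Cx0).
have cvt : continuous (fun z : Z => \val (t z)).
  move=> z; apply: continuous_comp; first exact: ct.
  exact: initial_continuous.
(* [t] lives on a subtype; extended off [Z] by a constant, it is continuous on the subspace [Z]. The
   constant is taken from a point of [C], so the empty [C] is treated apart. *)
pose ext := valL_ (\val (t z0)) (fun z : Z => \val (t z)).
have extE (z : Z) : ext (\val z) = \val (t z).
  exact: (congr1 (@^~ z) (valLK (\val (t z0)) (fun z : Z => \val (t z)))).
have /(continuous_subspaceW CZ) : {within Z, continuous ext}.
  exact/subspace_valL_continuousP'.
move=> /continuous_compact/(_ cC); congr (compact _).
apply/seteqP; split=> [_ [x Cx <-]|_ [z Cz <-]].
  have [z zx] := cozero_ex (CZ _ Cx); exists z; first by rewrite /= zx.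
  by rewrite -zx extE.
by exists (\val z) => //; rewrite extE.
Qed.

(** [nu] is the image under [t] of the measure with density [w] against [mu]. Compact sets that
    nearly exhaust t^-1[A] have compact images in [A], whence regularity; [layer_cake] reduces the
    functional to open sets and total mass. *)
Lemma wcomp_push_positive (mu : radonMeasure R K2) : 0 <= mu ->
  exists nu : radonMeasure R K1,
    (forall A, borel K1 A -> nu A = rint mu (tpre A) w :> R) /\
    riesz nu = adj wcomp (riesz mu).
Proof.
move=> mu0; pose wc := mkcfun cw; have mT := @borelT.
have wc0 : 0 <= wc by apply/cfun_leP => x; exact: w0.
pose nu A : R^o := if `[< borel K1 A >] then rint mu (tpre A) wc else 0.
have nuE A : borel K1 A -> nu A = rint mu (tpre A) wc.
  by move=> mA; rewrite /nu asboolT.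
have nu_ge0 A : 0 <= (nu A : R).
  rewrite /nu; case: ifPn => // /asboolP mA.
  by apply: rint_ge0 => //; exact: tpre_borel.
have nu_add : borel_sigma_additive (nu : set K1 -> R).
  move=> F mF tF; rewrite nuE; last exact: borel_bigcup.
  have -> : (fun n => \sum_(0 <= i < n) nu (F i)) =
            (fun n => \sum_(0 <= i < n) rint mu (tpre (F i)) wc).
    by apply/funext => n; apply: eq_bigr => i _; exact: nuE.
  rewrite tpre_bigcup; apply: rint_sigma_additive => //.
    by move=> n; exact: tpre_borel.
  apply/trivIsetP => i j _ _ ij; apply/seteqP; split=> // _ [[z Fi <-]].
  move=> /tpre_in Fj; move/trivIsetP: tF => /(_ i j I I ij)/seteqP[h _].
  exact: (h (\val (t z)) (conj Fi Fj)).
have nu_reg A (e : R) : borel K1 A -> 0 < e -> exists C, [/\ compact C, C `<=` A &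
    forall B, borel K1 B -> B `<=` A `\` C -> `|nu B : R| <= e].
  move=> mA e0; have [M M0 wM] := cfun_bounded wc.
  (* [M] bounds the density, so [nu B] is at most [M] times the [mu]-mass of the preimage of [B];
     the added 1 keeps the divisor positive. *)
  have e1 : 0 < e / (M + 1) by rewrite divr_gt0// ltr_wpDl.
  have [C [cC CA HC]] := radon_inner mu (tpre_borel mA) e1.
  exists (timg C); split.
  - by apply: timg_compact => // x /CA; exact: tpre_sub.
  - by move=> _ [z Cz <-]; apply/tpre_in; exact: CA.
  - move=> B mB BA; rewrite ger0_norm// nuE//.
    have mtB := tpre_borel mB.
    apply: (@le_trans _ _ (M * mu (tpre B))).
      rewrite -rint_cst//; apply: rint_le => // x _.
      exact: le_trans (ler_norm _) (wM x).
    have : (mu (tpre B) : R) <= e / (M + 1).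
      rewrite (le_trans (ler_norm _))// HC// => _ [z Bz <-]; split.
        by apply/tpre_in; have [] := BA _ Bz.
      by move=> Cz; have [_] := BA _ Bz; apply; exists z.
    rewrite ler_pdivlMr ?ltr_wpDl// mulrC => h; apply: le_trans h.
    rewrite ler_wpM2r ?lerDl//; move/radon_leP: mu0; exact.
have nuP : nu \in @radon_pred R K1.
  apply/asboolP; split=> // [A nA|]; first by rewrite /nu asboolF.
  exact/(inner_regularP nu_add).
exists (RadonMeasure nuP); split; first exact: nuE.
have adjw f : adj wcomp (riesz mu) f = rint mu setT (wcomp f) :> R.
  by rewrite (adjE wcomp_linear wcomp_ge0).
have rest A (f : cfun R K2) : borel K2 A -> (forall x, ~ A x -> f x = 0 :> R) ->
    rint mu setT f = rint mu A f.
  move=> mA f0; rewrite (rint_setD mu f mA).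
  suff -> : rint mu (~` A) f = 0 by rewrite addr0.
  have mAC := borelC mA; rewrite -[RHS](mul0r (mu (~` A) : R)) -rint_cst//.
  by apply/le_anti/andP; split; apply: rint_le => // x /f0 ->.
apply/esym/layer_cake => [| |U f oU Uf|].
- by apply/radon_leP => A _; exact: nu_ge0.
- apply/order_dual_leP => f f0; rewrite adjw.
  by apply: rint_ge0 => //; exact: wcomp_ge0.
- rewrite adjw [leRHS]nuE; last exact: borel_open.
  have mtU : borel K2 (tpre U) by apply: tpre_borel; exact: borel_open.
  have [f01 f0] := Uf.
  rewrite (rest (tpre U))//.
    apply: rint_le => // _ [z Uz <-]; rewrite wcompE wcomp_fun_in /=.
    by have /andP[_ f1] := f01 (\val (t z)); rewrite ler_piMr.
  move=> x nU; rewrite wcompE; have [/cozero_ex[z zx]|nZ] := pselect (Z x).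
    rewrite -zx wcomp_fun_in f0 ?mulr0// => Uz; apply: nU.
    by rewrite -zx; apply/tpre_in.
  exact: wcomp_fun_out.
- rewrite adjw wcomp1 [RHS]nuE//.
  rewrite tpreT (rest Z)//; first by apply: borel_open; exact: (cozero_open cw w0).
  by move=> x nZ /=; exact: cozeroN.
Qed.

Lemma wcomp_push (mu : radonMeasure R K2) : exists nu : radonMeasure R K1,
  (forall A, borel K1 A -> nu A = rint mu (tpre A) w :> R) /\
  riesz nu = adj wcomp (riesz mu).
Proof.
have [p [n [p0 n0 ->]]] := radon_decomposition mu.
have [p' [p'A p'E]] := wcomp_push_positive p0.
have [n' [n'A n'E]] := wcomp_push_positive n0.
exists (p' - n'); split=> [A mA|].
  rewrite (@rint_sub _ _ p n _ (mkcfun cw))//; last exact: tpre_borel.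
  by rewrite -p'A// -n'A.
rewrite !(linear_mapB (@riesz_linear R _)) p'E n'E.
by rewrite -(linear_mapB (adj_linear wcomp_linear wcomp_ge0)).
Qed.

End WeightedComposition.

Section WeightedCompositionIdeal.
Variables (R : realType) (K1 K2 : compactHausdorffType).
Variables (w : K2 -> R) (Y : set K1) (t : cozero w -> Y).
Hypotheses (cw : continuous w) (w0 : forall x, 0 <= w x) (ht : homeomorphism t).
Hypotheses (dY : dense Y) (eY : Cstar_embedded R Y).

Lemma cfun_le_dense (f g : cfun R K1) :
  (forall y : Y, (f (\val y) : R) <= g (\val y)) -> f <= g.
Proof.
move=> fg; apply/cfun_leP => x; rewrite leNgt; apply/negP => gf.
have [||y [/= y0 Yy]] := dY (O := [set x | 0 < ((f - g) x : R)]).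
- exists x; suff : 0 < (f x : R) - g x by [].
  by rewrite subr_gt0.
- exact: cfun_open_gt.
have := fg (exist _ y (mem_set Yy)); apply/negP; rewrite -ltNge -subr_gt0.
exact: y0.
Qed.

Lemma cozero_gt0 (z : cozero w) : 0 < w (\val z).
Proof. by rewrite lt_def w0 andbT; exact: set_valP z. Qed.

(** Density of [Y] gives order reflection. If 0 <= g <= w (f o t), then g / w, carried to [Y] by the
    inverse of [t], is continuous and between 0 and [f]. Being bounded it extends to some [h], and g
    = w (h o t), both sides vanishing off the cozero set. *)
Lemma wcomp_ideal_embedding : ideal_embedding (wcomp cw w0 ht.1).
Proof.
have [ct [t' [ct' tK t'K]]] := ht.
have emb f g : (wcomp cw w0 ht.1 f <= wcomp cw w0 ht.1 g) = (f <= g).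
  apply/idP/idP => [h|fg]; last first.
    by rewrite -subv_ge0 -(linear_mapB (@wcomp_linear _ _ _ _ _ _ cw w0 ht.1)) wcomp_ge0// subv_ge0.
  apply: cfun_le_dense => y; move/cfun_leP: h => /(_ (\val (t' y))).
  by rewrite !wcompE !wcomp_fun_in t'K ler_pM2l// cozero_gt0.
split=> [|//|f g /cfun_leP g0 /cfun_leP gf]; first exact: wcomp_linear.
have [M M0 fM] := cfun_bounded f.
pose k (y : Y) : R := g (\val (t' y)) / w (\val (t' y)).
have k0 y : 0 <= k y by apply: divr_ge0; [exact: g0|exact/ltW/cozero_gt0].
have kf y : k y <= f (\val y).
  rewrite ler_pdivrMr ?cozero_gt0// mulrC.
  by have := gf (\val (t' y)); rewrite wcompE wcomp_fun_in t'K.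
have ck : continuous k.
  have cvZ : continuous (set_val : cozero w -> K2) :=
    @initial_continuous (cozero w) K2 set_val.
  have cv : continuous ((set_val : cozero w -> K2) \o t').
    by move=> y; apply: continuous_comp; [exact: ct'|exact: cvZ].
  move=> y; have h1 : {for y, continuous ((g : K2 -> R) \o (set_val \o t'))}.
    by apply: continuous_comp; [exact: cv|exact: cfun_continuous].
  have h2 : {for y, continuous (w \o (set_val \o t'))}.
    by apply: continuous_comp; [exact: cv|exact: cw].
  by apply: continuousM h1 (continuousV _ h2); rewrite gt_eqF// cozero_gt0.
have [|h [ch hk]] := eY ck.
  exists M => y; rewrite ger0_norm// (le_trans (kf y))//.
  by rewrite (le_trans (ler_norm _)).
exists (mkcfun ch); apply: cfun_eqP => x; rewrite wcompE.
have [/cozero_ex[z <-]|nZ] := pselect (cozero w x).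
  rewrite wcomp_fun_in /= hk /k tK mulrC divfK//.
  by rewrite gt_eqF// cozero_gt0.
rewrite wcomp_fun_out//; apply/le_anti/andP; split; last exact: g0.
by have := gf x; rewrite wcompE wcomp_fun_out.
Qed.

End WeightedCompositionIdeal.

(** * Direct limits of vector lattices *)

Section DirectLimit.
Variables (R : realType) (I : Type) (le : I -> I -> Prop).
Variables (E : I -> vectorLatticeType R) (T : forall a b, E a -> E b).
Arguments T : clear implicits.

Definition direct_system : Prop :=
  [/\ directed_set le, forall a b, le a b -> ideal_embedding (T a b)
    & forall a b c, le a b -> le b c -> T b c \o T a b =1 T a c].

Hypothesis sys : direct_system.

Let le_inhabited : exists _ : I, True.
Proof. by have [[+ _ _ _]] := sys. Qed.
Let le_ub a b : exists c, le a c /\ le b c.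
Proof. by have [[_ _ _]] := sys. Qed.
Let le_refl a : le a a. Proof. by have [[_ + _ _] _ _] := sys; apply. Qed.
Let T_emb a b : le a b -> ideal_embedding (T a b).
Proof. by have [_ + _] := sys; apply. Qed.
Let T_lin a b : le a b -> linear (T a b).
Proof. by move=> /T_emb[]. Qed.
Let T_le a b (ab : le a b) x y : (T a b x <= T a b y) = (x <= y).
Proof. by have [_ ->] := T_emb ab. Qed.
Let T_comp a b c x : le a b -> le b c -> T b c (T a b x) = T a c x.
Proof. by have [_ _ h] := sys => ab bc; exact: h. Qed.
Let le_tr a b c : le a b -> le b c -> le a c.
Proof. by have [[_ _ + _] _ _] := sys; apply. Qed.

Local Notation D := {a : I & E a}.

(** The class of [u] under equality at some later index; elements of the limit are such classes. *)
Definition germ (u : D) : set D := [set v | exists c,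
  [/\ le (projT1 u) c, le (projT1 v) c
    & T (projT1 u) c (projT2 u) = T (projT1 v) c (projT2 v)]].

Definition is_germ : {pred set D} := fun A => `[< exists u, A = germ u >].

(** Carrying the proof in the type attaches to it the instances that are built from this proof. *)
Definition dlim (_ : direct_system) := {A : set D | A \in is_germ}.

HB.instance Definition _ := Choice.on (dlim sys).

Definition dlim_in a (x : E a) : dlim sys :=
  exist _ (germ (existT _ a x)) (asboolT (ex_intro _ _ erefl)).

Local Notation j := dlim_in.

Lemma dlim_in_eq a b (x : E a) (y : E b) : j x = j y <->
  exists c, [/\ le a c, le b c & T a c x = T b c y].
Proof.
split=> [/(congr1 sval)/= e|[c [ac bc e]]].
  have : germ (existT _ b y) (existT _ b y) by exists b; split.
  by rewrite -e.
apply/val_inj => /=; apply/seteqP; split=> -[d z] [g /= [ag dg eg]].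
  have [h [ch gh]] := le_ub c g; exists h => /=; split.
  - exact: le_tr bc ch.
  - exact: le_tr dg gh.
  - by rewrite -(T_comp _ bc ch) -e (T_comp _ ac ch) -(T_comp _ ag gh) eg T_comp.
have [h [ch gh]] := le_ub c g; exists h => /=; split.
- exact: le_tr ac ch.
- exact: le_tr dg gh.
- by rewrite -(T_comp _ ac ch) e (T_comp _ bc ch) -(T_comp _ ag gh) eg T_comp.
Qed.

Lemma dlim_in_T a b (x : E a) : le a b -> j (T a b x) = j x.
Proof. by move=> ab; apply/dlim_in_eq; exists b; split=> //; rewrite T_comp. Qed.

Lemma dlim_cover (z : dlim sys) : exists a x, z = @dlim_in a x.
Proof.
case: z => A /= AP; have /asboolP[[a x] AE] := AP.
by exists a, x; apply/val_inj.
Qed.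

Lemma dlim_cover2 (z1 z2 : dlim sys) :
  exists a (xy : E a * E a), z1 = j xy.1 /\ z2 = j xy.2.
Proof.
have [a [x ->]] := dlim_cover z1; have [b [y ->]] := dlim_cover z2.
have [c [ac bc]] := le_ub a b.
by exists c, (T a c x, T b c y); rewrite !dlim_in_T.
Qed.

Lemma dlim_cover3 (z1 z2 z3 : dlim sys) :
  exists a (x y z : E a), [/\ z1 = j x, z2 = j y & z3 = j z].
Proof.
have [a [[x y] [-> ->]]] := dlim_cover2 z1 z2; have [b [z ->]] := dlim_cover z3.
have [c [ac bc]] := le_ub a b.
by exists c, (T a c x), (T a c y), (T b c z); rewrite !dlim_in_T.
Qed.

(** Operations use chosen representatives; [dlim_addE] and its analogues show that the choice does
    not matter, and the axioms are then checked at a common index. *)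
Definition dlim_add (z1 z2 : dlim sys) : dlim sys :=
  let xy := svalP (cid (dlim_cover2 z1 z2)) in
  j ((sval (cid xy)).1 + (sval (cid xy)).2).
Definition dlim_opp (z : dlim sys) : dlim sys :=
  j (- sval (cid (svalP (cid (dlim_cover z))))).
Definition dlim_scale (k : R) (z : dlim sys) : dlim sys :=
  j (k *: sval (cid (svalP (cid (dlim_cover z))))).
Definition dlim_zero : dlim sys :=
  j (0 : E (sval (cid le_inhabited))).
Definition dlim_le : rel (dlim sys) := fun z1 z2 =>
  `[< exists a (x y : E a), [/\ z1 = j x, z2 = j y & x <= y] >].

Lemma dlim_addE a (x y : E a) : dlim_add (j x) (j y) = j (x + y).
Proof.
rewrite /dlim_add; case: cid => b /= h; case: cid => -[x' y'] /= [].
move=> /dlim_in_eq[c [ac bc ex]] /dlim_in_eq[d [ad bd ey]].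
have [g [cg dg]] := le_ub c d; apply/dlim_in_eq; exists g.
have ag := le_tr ac cg; have bg := le_tr bc cg; split=> //.
rewrite !linear_mapD; try exact: T_lin.
by rewrite -(T_comp x' bc cg) -(T_comp y' bd dg) -ex -ey !T_comp.
Qed.

Lemma dlim_oppE a (x : E a) : dlim_opp (j x) = j (- x).
Proof.
rewrite /dlim_opp; case: cid => b /= h; case: cid => x' /=.
move=> /dlim_in_eq[c [ac bc ex]]; apply/dlim_in_eq; exists c; split=> //.
by rewrite !linear_mapN ?ex//; exact: T_lin.
Qed.

Lemma dlim_scaleE k a (x : E a) : dlim_scale k (j x) = j (k *: x).
Proof.
rewrite /dlim_scale; case: cid => b /= h; case: cid => x' /=.
move=> /dlim_in_eq[c [ac bc ex]]; apply/dlim_in_eq; exists c; split=> //.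
by rewrite !linear_mapZ ?ex//; exact: T_lin.
Qed.

Lemma dlim_zeroE a : dlim_zero = j (0 : E a).
Proof.
apply/dlim_in_eq; have [c [ac bc]] := le_ub (sval (cid le_inhabited)) a.
by exists c; split=> //; rewrite !linear_map0//; exact: T_lin.
Qed.

Lemma dlim_leE a (x y : E a) : dlim_le (j x) (j y) = (x <= y).
Proof.
apply/asboolP/idP => [[b [x' [y' []]]]|xy]; last by exists a, x, y.
move=> /dlim_in_eq[c [ac bc ex]] /dlim_in_eq[d [ad bd ey]] xy'.
have [g [cg dg]] := le_ub c d; have ag := le_tr ac cg; have bg := le_tr bc cg.
rewrite -(T_le ag) -(T_comp x ac cg) ex -(T_comp y ad dg) ey !T_comp//.
by rewrite T_le.
Qed.

Fact dlim_addA : associative dlim_add.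
Proof.
move=> z1 z2 z3; have [a [x [y [z [-> -> ->]]]]] := dlim_cover3 z1 z2 z3.
by rewrite !dlim_addE addrA.
Qed.

Fact dlim_addC : commutative dlim_add.
Proof.
move=> z1 z2; have [a [[x y] [-> ->]]] := dlim_cover2 z1 z2.
by rewrite !dlim_addE addrC.
Qed.

Fact dlim_add0 : left_id dlim_zero dlim_add.
Proof.
by move=> z; have [a [x ->]] := dlim_cover z; rewrite (dlim_zeroE a) dlim_addE add0r.
Qed.

Fact dlim_addN : left_inverse dlim_zero dlim_opp dlim_add.
Proof.
move=> z; have [a [x ->]] := dlim_cover z.
by rewrite (dlim_zeroE a) dlim_oppE dlim_addE addNr.
Qed.

HB.instance Definition _ := GRing.isZmodule.Build (dlim sys)
  dlim_addA dlim_addC dlim_add0 dlim_addN.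

Lemma dlim_inD a (x y : E a) : j x + j y = j (x + y).
Proof. exact: dlim_addE. Qed.

Fact dlim_scaleA k l (z : dlim sys) : dlim_scale k (dlim_scale l z) = dlim_scale (k * l) z.
Proof. by have [a [x ->]] := dlim_cover z; rewrite !dlim_scaleE scalerA. Qed.

Fact dlim_scale1 : left_id 1 dlim_scale.
Proof. by move=> z; have [a [x ->]] := dlim_cover z; rewrite dlim_scaleE scale1r. Qed.

Fact dlim_scaleDr : right_distributive dlim_scale +%R.
Proof.
move=> k z1 z2; have [a [[x y] [-> ->]]] := dlim_cover2 z1 z2.
by rewrite dlim_inD !dlim_scaleE dlim_inD scalerDr.
Qed.

Fact dlim_scaleDl (z : dlim sys) : {morph dlim_scale^~ z : k l / k + l}.
Proof.
move=> k l; have [a [x ->]] := dlim_cover z.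
by rewrite !dlim_scaleE dlim_inD scalerDl.
Qed.

HB.instance Definition _ := GRing.Zmodule_isLmodule.Build R (dlim sys)
  dlim_scaleA dlim_scale1 dlim_scaleDr dlim_scaleDl.

Fact dlim_le_refl : reflexive dlim_le.
Proof. by move=> z; have [a [x ->]] := dlim_cover z; rewrite dlim_leE. Qed.

Fact dlim_le_anti : antisymmetric dlim_le.
Proof.
move=> z1 z2; have [a [[x y] [-> ->]]] := dlim_cover2 z1 z2.
by rewrite !dlim_leE => /le_anti ->.
Qed.

Fact dlim_le_trans : transitive dlim_le.
Proof.
move=> z1 z2 z3; have [a [x [y [z [-> -> ->]]]]] := dlim_cover3 z1 z2 z3.
by rewrite !dlim_leE; exact: le_trans.
Qed.

Fact dlim_le_add2r (z1 z2 z3 : dlim sys) :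
  dlim_le z1 z2 -> dlim_le (z1 + z3) (z2 + z3).
Proof.
have [a [x [y [z [-> -> ->]]]]] := dlim_cover3 z1 z2 z3.
by rewrite !dlim_inD !dlim_leE lev_add2rE.
Qed.

Fact dlim_le_wpscale (k : R) (z1 z2 : dlim sys) :
  0 <= k -> dlim_le z1 z2 -> dlim_le (k *: z1) (k *: z2).
Proof.
have [a [[x y] [-> ->]]] := dlim_cover2 z1 z2.
rewrite [k *: j x]dlim_scaleE [k *: j y]dlim_scaleE !dlim_leE.
exact: lev_wpscale.
Qed.

(** The positive part is taken at one index; later indices agree because ideal embeddings are
    lattice homomorphisms. *)
Fact dlim_pos (z : dlim sys) : exists p : dlim sys,
  [/\ dlim_le 0 p, dlim_le z p & forall q, dlim_le 0 q -> dlim_le z q -> dlim_le p q].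
Proof.
have [a [x ->]] := dlim_cover z; exists (j (vpos x)).
rewrite [0](dlim_zeroE a) !dlim_leE vpos_ge0 le_vsupl; split=> // q.
have [b [y ->]] := dlim_cover q; have [c [ac bc]] := le_ub a b.
rewrite (_ : j (0 : E a) = j (0 : E c)) -?dlim_zeroE//.
rewrite (dlim_zeroE c) -(dlim_in_T y bc) -(dlim_in_T x ac).
rewrite -(dlim_in_T (vpos x) ac) !dlim_leE.
have hT := ideal_embedding_lattice_hom (T_emb ac).
by rewrite (lattice_hom_vpos hT) => ? ?; rewrite /vpos vsup_le; apply/andP.
Qed.

HB.instance Definition _ := Lmodule_isVectorLattice.Build R (dlim sys)
  dlim_le_refl dlim_le_anti dlim_le_trans dlim_le_add2r dlim_le_wpscale dlim_pos.

Lemma dlim_in_le a (x y : E a) : (j x <= j y) = (x <= y).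
Proof. exact: dlim_leE. Qed.

Lemma dlim_in_emb a : ideal_embedding (@dlim_in a).
Proof.
split=> [k x y|x y|x z].
- by rewrite -dlim_inD; congr (_ + _); rewrite -dlim_scaleE.
- exact: dlim_in_le.
have [b [y ->]] := dlim_cover z; have [c [ac bc]] := le_ub a b.
have -> : (0 : dlim sys) = j (0 : E c) by exact: dlim_zeroE.
rewrite -(dlim_in_T y bc) -(dlim_in_T x ac) !dlim_in_le => y0 yx.
have [_ _ sT] := T_emb ac; have [x' ->] := sT _ _ y0 yx.
by exists x'; rewrite dlim_in_T.
Qed.

End DirectLimit.

(** * Unions of function spaces: Archimedean property and completeness *)

Section LimitOfFunctionSpaces.
Variables (R : realType) (I : Type) (K : I -> compactHausdorffType).
Variables (F : vectorLatticeType R) (j : forall a, cfun R (K a) -> F).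
Arguments j : clear implicits.
Hypothesis j_emb : forall a, ideal_embedding (j a).
Hypothesis j_cover : forall z, exists a x, z = j a x.

(** Adding T x moves [y] into the interval from 0 to T (x + x), where solidity applies. *)
Lemma ideal_embedding_vabs (E G : vectorLatticeType R) (T : E -> G) x y :
  ideal_embedding T -> vabs y <= T x -> exists z, y = T z.
Proof.
move=> iT; have [lT _ sT] := iT; rewrite vabs_le => /andP[yx yx'].
have [||z zE] := sT (x + x) (y + T x).
- by rewrite -(opprK y) addrC subv_ge0.
- by rewrite linear_mapD// lev_add2rE.
- by exists (z - x); rewrite linear_mapB// -zE addrK.
Qed.

(** The positive part of a lower bound [z] lies in [0, x], hence in one function space, where the
    reals decide at each point. *)
Lemma function_spaces_archimedean : archimedean_vl F.
Proof.
move=> x x0; split; first by move=> _ [n _ <-]; rewrite scalev_ge0// invr_ge0.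
move=> z zlb; have [a [f xE]] := j_cover x; have [lj mj sj] := j_emb a.
have f0 : 0 <= f by rewrite -(ideal_embedding_ge0 _ (j_emb a)) -xE.
have zp n : vpos z <= n.+1%:R^-1 *: x.
  rewrite /vpos vsup_le scalev_ge0 ?invr_ge0// andbT.
  by apply: zlb; exists n.
have [|g gE] := sj f (vpos z) (vpos_ge0 z).
  by have := zp 0; rewrite invr1 scale1r xE.
apply: (le_trans (le_vsupl z 0)); rewrite -/(vpos z) gE -(linear_map0 lj) mj.
apply/cfun_leP => k; rewrite cfun0E leNgt; apply/negP => gk.
have fk : 0 <= f k :> R by move/cfun_leP: f0; apply.
have := zp (Num.truncn (f k / g k)); rewrite gE xE -linear_mapZ// mj.
move=> /cfun_leP/(_ k); rewrite cfunZE leNgt => /negP; apply.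
rewrite mulrC ltr_pdivrMr// mulrC -ltr_pdivrMr//.
by rewrite truncnS_gt.
Qed.

(** A tail of the sequence, translated by one of its terms, lies in the ideal of the regulator [u],
    hence in a single C(K_a). There it converges pointwise with error at most e g; as [g] is
    bounded, the convergence is uniform and the limit continuous. *)
Lemma function_spaces_ru_complete : ru_complete F.
Proof.
move=> x [u u0 xu]; have [a [g uE]] := j_cover u; have [lj mj sj] := j_emb a.
have g0 : 0 <= g by rewrite -(ideal_embedding_ge0 _ (j_emb a)) -uE.
have g0' k : 0 <= g k :> R by move/cfun_leP: g0; apply.
have [N0 HN0] := xu 1 ltr01.
have /choice[h hE] n : exists h, x (n + N0)%N - x N0 = j a h.
  apply: (@ideal_embedding_vabs _ _ _ g) => //; rewrite -uE -[u]scale1r.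
  by apply: HN0 => //; exact: leq_addl.
have hdist (e : R) : 0 < e -> exists N, forall m n k, (N <= m)%N -> (N <= n)%N ->
    `|h m k - h n k : R| <= e * g k.
  move=> e0; have [N HN] := xu e e0; exists N => m n k Nm Nn.
  have := HN (m + N0)%N (n + N0)%N (leq_trans Nm (leq_addr _ _)) (leq_trans Nn (leq_addr _ _)).
  have -> : x (m + N0)%N - x (n + N0)%N = j a (h m - h n).
    by rewrite linear_mapB// -!hE opprB addrA subrK.
  rewrite uE -linear_mapZ// vabs_le -linear_mapN// !mj.
  move=> /andP[/cfun_leP/(_ k) h1 /cfun_leP/(_ k)].
  rewrite cfunNE => h2; rewrite ler_norml; apply/andP; split; last exact: h1.
  by rewrite lerNl.
have hcvg k : exists l : R, (fun n => h n k : R) @ \oo --> l.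
  suff : cvgn (fun n => h n k : R) by move/cvg_ex.
  apply: cauchy_cvg; apply/cauchy_exP => e e0.
  have e1 : 0 < e / (g k + 1) by rewrite divr_gt0// ltr_wpDl.
  have [N HN] := hdist _ e1; exists (h N k : R); exists N => // n /= Nn.
  rewrite /ball/= (le_lt_trans (HN N n k (leqnn _) Nn))//.
  by rewrite mulrAC ltr_pdivrMr ?ltr_wpDl// ltr_pM2l// ltrDl.
have /choice[l lE] := hcvg.
have hl (e : R) : 0 < e -> exists N, forall n k, (N <= n)%N -> `|h n k - l k : R| <= e * g k.
  move=> e0; have [N HN] := hdist e e0; exists N => n k Nn.
  apply/ler_addgt0Pr => d d0; have /cvgrPdist_lt/(_ d d0)[M _ HM] := lE k.
  have := HM (maxn N M) (leq_maxr _ _); have := HN n (maxn N M) k Nn (leq_maxl _ _).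
  move: (h (maxn N M) k : R) (h n k : R) (l k) (e * g k) => A B C D.
  rewrite !ler_norml !ltr_norml => /andP[? ?] /andP[? ?].
  by apply/andP; split; lra.
have cl : continuous l.
  move=> k; apply/cvgrPdist_lt => e e0.
  have [M M0 gM] := cfun_bounded g.
  have e1 : 0 < e / 3 / (M + 1) by rewrite !divr_gt0// ltr_wpDl.
  have [N HN] := hl _ e1.
  have bnd y : `|h N y - l y : R| <= e / 3.
    rewrite (le_trans (HN N y (leqnn _)))// mulrAC ler_pdivrMr ?ltr_wpDl//.
    apply: ler_wpM2l; first by rewrite divr_ge0// ltW.
    by rewrite (le_trans (ler_norm _))// (le_trans (gM y))// lerDl.
  have e3 : 0 < e / 3 by rewrite divr_gt0.
  have /cvgrPdist_lt/(_ _ e3) := @cfun_continuous _ _ (h N) k.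
  apply: filterS => y; have := bnd y; have := bnd k.
  move: (h N k : R) (h N y : R) (l k) (l y) => A B C D.
  rewrite !ler_norml !ltr_norml => /andP[? ?] /andP[? ?] /andP[? ?].
  by apply/andP; split; lra.
exists (x N0 + j a (mkcfun cl)); exists u => // e e0.
have [N HN] := hl e e0; exists (N + N0)%N => n Nn.
have N0n : (N0 <= n)%N by apply: leq_trans Nn; exact: leq_addl.
have -> : x n - (x N0 + j a (mkcfun cl)) = j a (h (n - N0)%N - mkcfun cl).
  by rewrite linear_mapB// -hE subnK// opprD addrA.
rewrite uE -linear_mapZ// vabs_le -linear_mapN// !mj.
have Nn' : (N <= n - N0)%N by rewrite leq_subRL// addnC.
by apply/andP; split; apply/cfun_leP => k; have := HN _ k Nn';
  rewrite ler_norml ?cfunNE cfunBE cfunZE => /andP[? ?] //=; rewrite lerNl.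
Qed.

End LimitOfFunctionSpaces.

(** * The predual of an inverse limit of spaces of measures *)

Section FromSystemOfMeasures.
Variables (R : realType) (I : Type) (le : I -> I -> Prop).
Variables (K : I -> compactHausdorffType).
Variable p : forall b a, radonMeasure R (K b) -> radonMeasure R (K a).
Arguments p : clear implicits.
Hypothesis p_sys : inverse_system (@NIVL R) le p.
Hypothesis p_wcomp : forall a b, le a b ->
  exists (w : K b -> R) (Y : set (K a)) (t : cozero w -> Y),
    [/\ continuous w, forall x, 0 <= w x,
        homeomorphism t, dense Y /\ Cstar_embedded R Y
      & forall (mu : radonMeasure R (K b)) (A : set (K a)),
          borel (K a) A ->
          (p b a mu A)%:E =
          radon_integral mu [set \val x | x in [set x | A (\val (t x))]] w].

(** The integral formula determines [p b a mu] on Borel sets, so it is the measure of [wcomp_push].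
    Unrelated indices receive the map 0. *)
Lemma predual_maps : exists T : forall a b, cfun R (K a) -> cfun R (K b),
  forall a b, le a b -> ideal_embedding (T a b) /\
    forall mu f, riesz (p b a mu) f = riesz mu (T a b f) :> R.
Proof.
suff H a b : exists T : cfun R (K a) -> cfun R (K b), le a b ->
    ideal_embedding T /\ forall mu f, riesz (p b a mu) f = riesz mu (T f) :> R.
  by exists (fun a b => sval (cid (H a b))) => a b; case: cid.
have [ab|nab] := pselect (le a b); last by exists (fun=> 0) => /nab.
have [w [Y [t [cw w0 ht [dY eY] pE]]]] := p_wcomp ab.
exists (wcomp cw w0 ht.1) => _; split; first exact: wcomp_ideal_embedding.
move=> mu f; have [nu [nuE nuT]] := wcomp_push cw w0 ht.1 mu.
rewrite (_ : p b a mu = nu); last first.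
  apply: radon_eqP => A mA; apply: EFin_inj; rewrite pE// nuE//.
  by apply: (radon_integral_rint mu (mkcfun cw)); exact: (tpre_borel cw w0 ht.1).
by rewrite nuT (adjE (wcomp_linear cw w0 ht.1) (wcomp_ge0 cw w0 ht.1)).
Qed.

(** Evaluations separate functions and, by the Riesz theorem, come from measures; they transfer the
    composition law from the maps [p] to the maps [T]. *)
Lemma cfun_eval (a : I) (x : K a) : exists L : orderDual (cfun R (K a)),
  forall f, L f = f x.
Proof.
have LP : (fun f : cfun R (K a) => f x) \in @order_dual_pred R (cfun R (K a)).
  apply/asboolP; split=> [k f g|u v]; first by rewrite cfunDE cfunZE.
  exists (`|u x : R| + `|v x : R|) => f /cfun_leP/(_ x) uf /cfun_leP/(_ x) fv.
  move: (f x : R) (u x : R) (v x : R) uf fv => c d e h1 h2.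
  have := ler_norm e; have := ler_norm (- d); have := normr_ge0 d; have := normr_ge0 e.
  by rewrite normrN ler_norml => *; apply/andP; split; lra.
by exists (OrderDual LP).
Qed.

Lemma predual_exists (E : vectorLatticeType R)
    (q : forall a, E -> radonMeasure R (K a)) : inverse_limit (@NVL R) le p q ->
  exists F : vectorLatticeType R,
    [/\ ru_complete F, archimedean_vl F & lattice_isomorphic E (orderDual F)].
Proof.
move=> qlim; have [T TP] := predual_maps; have [le_dir _ p_comp] := p_sys.
have sys : direct_system le T.
  split=> // [a b /TP[]//|a b c ab bc f]; apply: cfun_eqP => x.
  have [L LE] := cfun_eval x; have [_ _ /(_ L)[mu muE]] := @riesz_order_iso R (K c).
  have [_ _ le_tr _] := le_dir.
  rewrite /= -!LE -muE -(TP _ _ bc).2 -(TP _ _ ab).2 -(TP _ _ (le_tr _ _ _ ab bc)).2.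
  by rewrite -(p_comp _ _ _ ab bc).
pose j a := @dlim_in _ _ _ _ _ sys a.
have j_emb a : ideal_embedding (j a) := dlim_in_emb sys a.
have j_cover : forall z, exists a x, z = j a x := @dlim_cover _ _ _ _ _ sys.
exists (dlim sys); split.
- exact: function_spaces_ru_complete j_emb j_cover.
- exact: function_spaces_archimedean j_emb j_cover.
have rex a (phi : orderDual (dlim sys)) :
    exists mu : radonMeasure R (K a), riesz mu = adj (j a) phi.
  by have [_ _] := @riesz_order_iso R (K a); apply.
pose r a phi := sval (cid (rex a phi)).
have rE a phi f : riesz (r a phi) f = phi (j a f).
  have [lj _ _] := j_emb a; have [jpos _] := ideal_embedding_interval (j_emb a).
  by rewrite -(adjE lj jpos) -(svalP (cid (rex a phi))).
apply: inverse_limit_unique qlim _.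
apply: (dual_inverse_limit (j := j) (rho := fun a => @riesz R (K a))) => //.
- move=> a b ab f; exists (T a b f); rewrite /j dlim_in_T//.
- by move=> a; exact: riesz_order_iso.
- move=> a b ab mu f g fg; rewrite (TP _ _ ab).2; congr (riesz mu _).
  by apply: (ideal_embedding_inj (j_emb b)); rewrite /j dlim_in_T.
- by move=> a phi f; exact: rE.
Qed.

End FromSystemOfMeasures.

(** * Kakutani representation of principal ideals *)

Section PrincipalIdeals.
Variables (R : realType) (F : vectorLatticeType R).
Implicit Types (u x y z : F).

(** Subtracting the infimum from x^+ leaves an element that still dominates both 0 and x. *)
Lemma vinf_vpos_vneg x : vinf (vpos x) (vneg x) = 0.
Proof.
apply/le_anti/andP; split; last by rewrite le_vinf vpos_ge0 vneg_ge0.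
set m := vinf _ _.
have : vpos x <= vpos x - m.
  rewrite {1}/vpos vsup_le subv_ge0 vinf_lel andbT.
  rewrite -{1}(vpos_vneg x) lev_add2lE lev_oppE vinf_ler.
  by [].
by rewrite -{1}[vpos x]addr0 lev_add2lE -{1}oppr0 lev_oppE.
Qed.

Lemma vpos_homo x y : x <= y -> vpos x <= vpos y.
Proof. by move=> xy; rewrite {1}/vpos vsup_le (le_trans xy) ?le_vsupl// vpos_ge0. Qed.

Lemma vpos_le0 x : x <= 0 -> vpos x = 0.
Proof. by move=> x0; apply/le_anti; rewrite /vpos vsup_le x0 lexx le_vsupr. Qed.

Lemma vpos_id x : 0 <= x -> vpos x = x.
Proof. exact: vsup_l. Qed.

Lemma vneg_vpos x : vneg x = vpos (- x). Proof. by []. Qed.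

Lemma vposZ (c : R) x : 0 <= c -> vpos (c *: x) = c *: vpos x.
Proof.
rewrite le_eqVlt => /predU1P[<-|c0]; first by rewrite !scale0r vpos_id.
have H (d : R) y : 0 < d -> vpos (d *: y) <= d *: vpos y.
  move=> d0; rewrite {1}/vpos vsup_le lev_scaleE// le_vsupl.
  by rewrite scalev_ge0 ?vpos_ge0// ltW.
apply/le_anti; rewrite H//=.
have := H c^-1 (c *: x); rewrite invr_gt0 => /(_ c0).
by rewrite scalerA mulVf ?gt_eqF// scale1r -(lev_scaleE _ _ c0) scalerA mulfV ?gt_eqF// scale1r.
Qed.

Lemma vinf_le2 x y x' y' : x <= x' -> y <= y' -> vinf x y <= vinf x' y'.
Proof.
by move=> xx' yy'; rewrite le_vinf (le_trans (vinf_lel x y))// (le_trans (vinf_ler x y)).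
Qed.

Lemma disjoint_add k x y : 0 <= k -> 0 <= x -> 0 <= y ->
  vinf k x = 0 -> vinf k y = 0 -> vinf k (x + y) = 0.
Proof.
move=> k0 x0 y0 kx ky; set z := vinf k (x + y).
have z0 : 0 <= z by rewrite le_vinf k0 addv_ge0.
have [z1 [z2 [z10 z1x z20 z2y zE]]] := riesz_decomposition x0 y0 z0 (vinf_ler _ _).
have zk : z <= k := vinf_lel _ _.
have e1 : z1 = 0.
  apply/le_anti; rewrite z10 andbT -kx le_vinf z1x andbT (le_trans _ zk)//.
  by rewrite zE -{1}[z1]addr0 lev_add2lE.
have e2 : z2 = 0.
  apply/le_anti; rewrite z20 andbT -ky le_vinf z2y andbT (le_trans _ zk)//.
  by rewrite zE -{1}[z2]add0r lev_add2rE.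
by rewrite zE e1 e2 addr0.
Qed.

(** This yields superadditivity of characters. The infimum is disjoint from x^- + y^- and lies below
    (x + y)^+ + x^- + y^-, so Riesz decomposition leaves only the first summand. *)
Lemma vinf_vpos_le x y : vinf (vpos x) (vpos y) <= vpos (x + y).
Proof.
set z := vinf _ _.
have z0 : 0 <= z by rewrite le_vinf !vpos_ge0.
have zx : vinf z (vneg x) = 0.
  apply/le_anti; rewrite le_vinf z0 vneg_ge0 andbT -(vinf_vpos_vneg x).
  by rewrite vinf_le2// vinf_lel.
have zy : vinf z (vneg y) = 0.
  apply/le_anti; rewrite le_vinf z0 vneg_ge0 andbT -(vinf_vpos_vneg y).
  by rewrite vinf_le2// vinf_ler.
have zn := disjoint_add z0 (vneg_ge0 x) (vneg_ge0 y) zx zy.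
have h : z <= vpos (x + y) + (vneg x + vneg y).
  apply: (@le_trans _ _ (vpos x + vpos y)).
    by rewrite -{1}[z]addr0 lev_add ?vinf_lel ?vpos_ge0.
  rewrite -(lev_add2rE (- (vneg x + vneg y))) addrK opprD addrACA !vpos_vneg.
  exact: le_vsupl.
have [z1 [z2 [z10 z1x z20 z2y zE]]] :=
  riesz_decomposition (vpos_ge0 _) (addv_ge0 (vneg_ge0 x) (vneg_ge0 y)) z0 h.
have e2 : z2 = 0.
  apply/le_anti; rewrite z20 andbT -zn le_vinf z2y andbT.
  by rewrite zE -{1}[z2]add0r lev_add2rE.
by rewrite zE e2 addr0.
Qed.

Definition in_ideal u x := exists2 r : R, 0 <= r & vabs x <= r *: u.

Lemma vabsN x : vabs (- x) = vabs x.
Proof.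
by rewrite /vabs opprK; apply/le_anti; rewrite !vsup_le !le_vsupl !le_vsupr.
Qed.

Lemma in_idealP u x : in_ideal u x <->
  exists2 r : R, 0 <= r & x <= r *: u /\ - x <= r *: u.
Proof.
by split=> -[r r0]; [rewrite vabs_le => /andP[]; exists r|move=> [h1 h2]; exists r; rewrite ?vabs_le ?h1].
Qed.

Lemma in_idealD u x y : in_ideal u x -> in_ideal u y -> in_ideal u (x + y).
Proof.
move=> /in_idealP[r r0 [h1 h2]] /in_idealP[s s0 [h3 h4]]; apply/in_idealP.
by exists (r + s); rewrite ?addr_ge0// scalerDl opprD !lev_add.
Qed.

Lemma in_idealN u x : in_ideal u x -> in_ideal u (- x).
Proof. by move=> [r r0 h]; exists r; rewrite ?vabsN. Qed.

Lemma in_idealZ u x (c : R) : in_ideal u x -> in_ideal u (c *: x).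
Proof.
have H (d : R) y : 0 <= d -> in_ideal u y -> in_ideal u (d *: y).
  move=> d0 /in_idealP[r r0 [h1 h2]]; apply/in_idealP; exists (d * r).
    exact: mulr_ge0.
  by rewrite -scalerA -scalerN !lev_wpscale.
move=> ux; have [c0|c0] := leP 0 c; first exact: H.
rewrite -[c]opprK scaleNr; apply: in_idealN; apply: H => //.
by rewrite oppr_ge0 ltW.
Qed.

Lemma in_ideal_le u x y : 0 <= y -> y <= x -> in_ideal u x -> in_ideal u y.
Proof.
move=> y0 yx /in_idealP[r r0 [h1 h2]]; apply/in_idealP; exists r => //; split.
  exact: le_trans h1.
have ru : 0 <= r *: u by rewrite (le_trans y0)// (le_trans yx).
by rewrite (le_trans _ ru)// -oppr0 lev_oppE.
Qed.

Lemma in_ideal_vpos u x : in_ideal u x -> in_ideal u (vpos x).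
Proof.
move=> [r r0 h]; exists r => //; rewrite vabs_pos ?vpos_ge0//.
rewrite {1}/vpos vsup_le (le_trans (le_vsupl _ _) h) andTb.
exact: le_trans (vabs_ge0 _) h.
Qed.

Lemma in_ideal_vsup u x y : in_ideal u x -> in_ideal u y -> in_ideal u (vsup x y).
Proof.
move=> ux uy; rewrite vsup_vpos; apply: in_idealD => //.
by apply: in_ideal_vpos; apply: in_idealD => //; exact: in_idealN.
Qed.

Lemma in_ideal_vinf u x y : in_ideal u x -> in_ideal u y -> in_ideal u (vinf x y).
Proof.
move=> ux uy; rewrite vinf_vsup; apply: in_idealN.
by apply: in_ideal_vsup; exact: in_idealN.
Qed.

Lemma in_ideal_unit u : 0 <= u -> in_ideal u u.
Proof. by move=> u0; exists 1; rewrite // scale1r vabs_pos. Qed.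

Lemma in_ideal0 u : in_ideal u 0.
Proof. by exists 0; rewrite // scale0r vabs_pos. Qed.

(* The junk value 0 off the ideal makes characters determined by their
   restrictions to it. *)
Definition is_character u (phi : F -> R) : Prop :=
  [/\ phi u = 1, forall x, ~ in_ideal u x -> phi x = 0,
      forall x y, in_ideal u x -> in_ideal u y -> phi (x + y) = phi x + phi y,
      forall (c : R) x, in_ideal u x -> phi (c *: x) = c * phi x
    & forall x y, in_ideal u x -> in_ideal u y ->
        phi (vsup x y) = Num.max (phi x) (phi y)].

End PrincipalIdeals.

(** * Real characters from maximal filters *)

Section CharacterExistence.
Variables (R : realType) (F : vectorLatticeType R) (u : F).
Hypothesis u0 : 0 <= u.
Implicit Types (x y z g h : F) (G : set F).

Definition proper_filter_at z0 G : Prop :=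
  [/\ G z0, ~ G 0, forall g, G g -> 0 <= g,
      forall g h, G g -> G h -> G (vinf g h)
    & forall g h, G g -> g <= h -> G h].

Lemma maximal_filter z0 : 0 <= z0 -> z0 != 0 -> exists G,
  proper_filter_at z0 G /\ forall y, 0 <= y -> ~ G y -> exists2 g, G g & vinf g y = 0.
Proof.
move=> z00 z0n0.
have [|G [PG Gmax]] := @Zorn_bigcup _ [set G | G = set0 \/ proper_filter_at z0 G].
- move=> C CP Ctot; have [[G0 [CG0 G0n]]|Cn] := pselect (exists G, C G /\ G <> set0).
    right; have PF G x : C G -> G x -> proper_filter_at z0 G.
      by move=> CG Gx; case: (CP _ CG) => // GE; move: Gx; rewrite GE.
    have [x G0x] : G0 !=set0 by apply/set0P/eqP.
    split.
    + by exists G0 => //; have [] := PF _ _ CG0 G0x.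
    + by move=> [G CG G00]; have [_ + _ _ _] := PF _ _ CG G00; apply.
    + by move=> g [G CG Gg]; have [_ _ + _ _] := PF _ _ CG Gg; apply.
    + move=> g h [G CG Gg] [H CH Hh]; have [GH|HG] := Ctot _ _ CG CH.
        by exists H => //; have [_ _ _ + _] := PF _ _ CH Hh; apply => //; exact: GH.
      by exists G => //; have [_ _ _ + _] := PF _ _ CG Gg; apply => //; exact: HG.
    + move=> g h [G CG Gg] gh; exists G => //.
      by have [_ _ _ _ up] := PF _ _ CG Gg; exact: up gh.
  left; apply/seteqP; split=> // x [G CG Gx]; case: Cn; exists G; split=> // G0.
  by move: Gx; rewrite G0.
have PG' : proper_filter_at z0 G.
  case: PG => // G0.
  exfalso; apply: (Gmax [set g | z0 <= g]).
    by split=> [|/(_ z0 (lexx _))]; rewrite G0.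
  right; split=> //=.
  - by move=> z00'; case/negP: z0n0; apply/eqP/le_anti; rewrite z00 z00'.
  - by move=> g; exact: le_trans.
  - by move=> g h ? ?; rewrite le_vinf; apply/andP.
  - by move=> g h; exact: le_trans.
exists G; split=> // y y0 Gy; apply: contrapT => nex.
have [Gz0 G0 Gge0 GI Gup] := PG'.
(* If no member of [G] is disjoint from [y], the filter generated by [G] and [y] is still proper,
   against maximality. *)
apply: (Gmax [set z | exists2 g, G g & vinf g y <= z]).
  split=> [g Gg|sub]; first by exists g => //; exact: vinf_lel.
  by apply: Gy; apply: sub; exists z0 => //; exact: vinf_ler.
right; split=> /=.
- by exists z0 => //; exact: vinf_lel.
- move=> [g Gg gy]; apply: nex; exists g => //.
  by apply/le_anti; rewrite gy le_vinf y0 Gge0.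
- by move=> z [g Gg]; apply: le_trans; rewrite le_vinf y0 Gge0.
- move=> z1 z2 [g1 Gg1 h1] [g2 Gg2 h2]; exists (vinf g1 g2); first exact: GI.
  rewrite le_vinf (le_trans _ h1) ?(le_trans _ h2)// vinf_le2//.
    exact: vinf_ler.
  exact: vinf_lel.
- by move=> z1 z2 [g Gg h1] h2; exists g => //; exact: le_trans h2.
Qed.

Section CharacterOfFilter.
Variables (z0 : F) (G : set F).
Hypotheses (z0u : in_ideal u z0) (GP : proper_filter_at z0 G).
Hypothesis Gmax : forall y, 0 <= y -> ~ G y -> exists2 g, G g & vinf g y = 0.

Let G0 : ~ G 0. Proof. by case: GP. Qed.
Let Gge0 g : G g -> 0 <= g. Proof. by case: GP => _ _ + _ _; apply. Qed.
Let GI g h : G g -> G h -> G (vinf g h). Proof. by case: GP => _ _ _ + _; apply. Qed.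
Let Gup g h : g <= h -> G g -> G h. Proof. by case: GP => _ _ _ _ H gh Gg; exact: H gh. Qed.

(** Were both outside, members of [G] disjoint from x and from y would have an infimum in [G]
    disjoint from x + y, forcing 0 into [G]. *)
Lemma filter_prime x y : 0 <= x -> 0 <= y -> G (x + y) -> G x \/ G y.
Proof.
move=> x0 y0 Gxy; apply: contrapT => /not_orP[Gx Gy].
have [g Gg gx] := Gmax x0 Gx; have [h Gh hy] := Gmax y0 Gy.
have Gk := GI Gg Gh; have k0 := Gge0 Gk; apply: G0.
have <- : vinf (vinf g h) (x + y) = 0; last exact: GI.
apply: disjoint_add => //; apply/le_anti; rewrite le_vinf k0 ?x0 ?y0 andbT.
  by rewrite -gx vinf_le2// vinf_lel.
by rewrite -hy vinf_le2// vinf_ler.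
Qed.

(** Were c g outside, some h in [G] would be disjoint from it; but min (1, c) times the infimum of h
    and g lies below both h and c g. *)
Lemma filter_scale (c : R) g : 0 < c -> G g -> G (c *: g).
Proof.
move=> c0 Gg; have g0 := Gge0 Gg; have cg0 : 0 <= c *: g by rewrite scalev_ge0// ltW.
apply: contrapT => /(Gmax cg0)[h Gh hcg]; have Ghg := GI Gh Gg.
have hg0 := Gge0 Ghg; apply: G0.
have <- : vinf h g = 0; last by [].
apply/le_anti; rewrite hg0 andbT.
set d := Num.min 1 c; have d0 : 0 < d by rewrite lt_min ltr01.
rewrite -(lev_scaleE _ _ d0) scaler0 -hcg le_vinf; apply/andP; split.
  rewrite -[leRHS]scale1r (le_trans (lev_scale2r hg0 (_ : d <= 1)))//.
    by rewrite ge_min lexx.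
  by rewrite !scale1r vinf_lel.
rewrite (le_trans (lev_scale2r hg0 (_ : d <= c)))//; first by rewrite ge_min lexx orbT.
by rewrite lev_scaleE// vinf_ler.
Qed.

Lemma filter_unit : G u.
Proof.
have [r r0 [h _]] := (in_idealP u z0).1 z0u.
have Gz0 : G z0 by case: GP.
have Gru := Gup h Gz0.
have r0' : 0 < r.
  by rewrite lt_def r0 andbT; apply/eqP => rE; apply: G0; move: Gru; rewrite rE scale0r.
have : 0 < r^-1 by rewrite invr_gt0.
by move=> /filter_scale/(_ Gru); rewrite scalerA mulVf ?gt_eqF// scale1r.
Qed.

(** [r] belongs to [S x] when x exceeds r u along the filter; the supremum is the limit of x / u
    along [G]. *)
Let S x : set R := [set r | G (vpos (x - r *: u))].

Let S_ub x (r : R) : x <= r *: u -> ubound (S x) r.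
Proof.
move=> xr s Ss; rewrite leNgt; apply/negP => rs; apply: G0.
have <- : vpos (x - s *: u) = 0; last exact: Ss.
apply: vpos_le0; rewrite lev_subl_addr add0r (le_trans xr)//.
by apply: lev_scale2r => //; exact: ltW.
Qed.

Let S_in x (r : R) : r *: u <= x -> forall s, s < r -> S x s.
Proof.
move=> rx s sr; have : G ((r - s) *: u).
  by apply: filter_scale; [rewrite subr_gt0|exact: filter_unit].
apply: Gup; rewrite scalerBl (le_trans _ (le_vsupl _ _))//.
by rewrite lev_add2rE.
Qed.

Let hsS x : in_ideal u x -> has_sup (S x).
Proof.
move=> /in_idealP[r r0 [h1 h2]]; split; last by exists r; exact: S_ub.
exists (- r - 1); apply: (@S_in x (- r)); last by rewrite ltrBlDr ltrDl.
by rewrite scaleNr -[x]opprK lev_oppE.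
Qed.

Let phi x : R := if `[< in_ideal u x >] then sup (S x) else 0.

Let phiE x : in_ideal u x -> phi x = sup (S x).
Proof. by move=> ux; rewrite /phi asboolT. Qed.

Let phi_ge x r : in_ideal u x -> S x r -> r <= phi x.
Proof. by move=> ux Sr; rewrite phiE//; apply: ub_le_sup => //; exact: (hsS ux).2. Qed.

Let phi_le x (r : R) : in_ideal u x -> ubound (S x) r -> phi x <= r.
Proof. by move=> ux ub; rewrite phiE//; apply: ge_sup => //; exact: (hsS ux).1. Qed.

Let phi_superadd x y : in_ideal u x -> in_ideal u y -> phi x + phi y <= phi (x + y).
Proof.
move=> ux uy; have uxy := in_idealD ux uy.
rewrite -lerBrDr; apply: phi_le => // r Sr.
rewrite lerBrDr addrC -lerBrDr; apply: phi_le => // s Ss.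
rewrite lerBrDr; apply: phi_ge => //; rewrite /S /=.
apply: Gup (GI Ss Sr).
by rewrite (le_trans (vinf_vpos_le _ _))// addrACA -opprD -scalerDl [y + x]addrC.
Qed.

Let phi_homo x y : in_ideal u x -> in_ideal u y -> x <= y -> phi x <= phi y.
Proof.
move=> ux uy xy; apply: phi_le => // r Sr; apply: phi_ge => //.
by apply: Gup Sr; apply: vpos_homo; rewrite lev_add2rE.
Qed.

Let phi0 : phi 0 = 0.
Proof.
have i0 := in_ideal0 u; apply/le_anti/andP; split.
  by apply: phi_le => //; apply: S_ub; rewrite scale0r.
apply/ler_addgt0Pr => e e0; rewrite -lerBlDr sub0r; apply: phi_ge => //.
by apply: (@S_in _ 0); rewrite ?scale0r// oppr_lt0.
Qed.

(** Superadditivity gives one half. For the other, the positive parts of x - (phi x + e/2) u and of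
    - x + (phi x + e) u add up to at least (e/2) u, which is in [G]. Primeness puts one of them in
    [G], and the supremum [phi x] excludes the first. *)
Let phiN x : in_ideal u x -> phi (- x) = - phi x.
Proof.
move=> ux; have ux' := in_idealN ux; apply/le_anti/andP; split.
  by have := phi_superadd ux ux'; rewrite subrr phi0 -lerBrDl sub0r.
apply/ler_addgt0Pr => e e0.
have e20 : 0 < e / 2 by rewrite divr_gt0.
have nS : ~ S x (phi x + e / 2) by move=> /(phi_ge ux); rewrite leNgt ltrDl e20.
suff : S (- x) (- phi x - e) by move=> /(phi_ge ux'); rewrite lerBlDr.
have : G (vpos (x - (phi x + e / 2) *: u) + vpos (- x - (- phi x - e) *: u)).
  apply: (Gup _ (filter_scale e20 filter_unit)).
  apply: (@le_trans _ _ ((x - (phi x + e / 2) *: u) + (- x - (- phi x - e) *: u))).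
    rewrite addrACA subrr add0r -opprD -scalerDl -scaleNr.
    by apply: lev_scale2r => //; lra.
  by rewrite lev_add// le_vsupl.
by move=> /filter_prime[||//|//]; try exact: vpos_ge0.
Qed.

Let phiD x y : in_ideal u x -> in_ideal u y -> phi (x + y) = phi x + phi y.
Proof.
move=> ux uy; apply/le_anti; rewrite phi_superadd// andbT.
(* Superadditivity at - x and - y, turned around by [phiN], is the missing inequality. *)
have := phi_superadd (in_idealN ux) (in_idealN uy).
by rewrite -opprD !phiN// ?lerN2 -?opprD ?lerN2//; exact: in_idealD.
Qed.

Let phiZ (c : R) x : in_ideal u x -> phi (c *: x) = c * phi x.
Proof.
have H (d : R) y : 0 < d -> in_ideal u y -> d * phi y <= phi (d *: y).
  move=> d0 uy; have udy := in_idealZ d uy.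
  rewrite mulrC -ler_pdivlMr//; apply: phi_le => // r Sr.
  rewrite ler_pdivlMr// mulrC; apply: phi_ge => //; rewrite /S /=.
  by rewrite -scalerA -scalerBr vposZ ?ltW//; exact: filter_scale.
have H' (d : R) y : 0 < d -> in_ideal u y -> phi (d *: y) = d * phi y.
  move=> d0 uy; apply/le_anti; rewrite H// andbT.
  have := H d^-1 (d *: y); rewrite invr_gt0 => /(_ d0 (in_idealZ d uy)).
  by rewrite scalerA mulVf ?gt_eqF// scale1r ler_pdivrMl.
move=> ux; have [c0|c0|->] := ltgtP c 0.
- rewrite -[c]opprK scaleNr phiN; last exact: in_idealZ.
  by rewrite H' ?oppr_gt0// !mulNr.
- exact: H'.
- by rewrite scale0r mul0r phi0.
Qed.

Let phi_vsup x y : in_ideal u x -> in_ideal u y -> phi (vsup x y) = Num.max (phi x) (phi y).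
Proof.
move=> ux uy; have uxy := in_ideal_vsup ux uy; apply/le_anti/andP; split.
  apply: phi_le => // r Sr; rewrite le_max.
  have : G (vpos (x - r *: u) + vpos (y - r *: u)).
    apply: Gup Sr; rewrite {1}/vpos vsup_le addv_ge0 ?vpos_ge0// andbT.
    rewrite lev_subl_addr vsup_le -(lev_subl_addr x) -(lev_subl_addr y).
    apply/andP; split; first by rewrite -[leLHS]addr0 lev_add ?le_vsupl ?vpos_ge0.
    by rewrite -[leLHS]add0r lev_add ?le_vsupl ?vpos_ge0.
  by move=> /filter_prime[||/(phi_ge ux)->//|/(phi_ge uy)->]; rewrite ?orbT ?vpos_ge0.
by rewrite ge_max !phi_homo// ?le_vsupl ?le_vsupr.
Qed.

Let phi_u : phi u = 1.
Proof.
have uu := in_ideal_unit u0; apply/le_anti/andP; split.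
  by apply: phi_le => //; apply: S_ub; rewrite scale1r.
apply/ler_addgt0Pr => e e0; rewrite -lerBlDr; apply: phi_ge => //.
by apply: (@S_in _ 1); rewrite ?scale1r// ltrBlDr ltrDl.
Qed.

Lemma character_of_filter : exists2 f, is_character u f &
  forall x (r : R), in_ideal u x -> G (vpos (x - r *: u)) -> r <= f x.
Proof.
exists phi; last by move=> x r ux; exact: phi_ge.
by split=> // x nux; rewrite /phi asboolF.
Qed.

End CharacterOfFilter.

(** Starting the filter at the positive part of y - e u puts [e] into the set whose supremum is
    [f y]. *)
Lemma character_separates y (e : R) : in_ideal u y -> 0 <= e ->
  vpos (y - e *: u) != 0 -> exists2 f, is_character u f & e <= f y.
Proof.
move=> uy e0 n0; have [G [GP Gmax]] := maximal_filter (vpos_ge0 _) n0.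
have uz : in_ideal u (vpos (y - e *: u)).
  apply: in_ideal_vpos; apply: in_idealD => //; apply: in_idealN.
  by apply: in_idealZ; exact: in_ideal_unit.
have [f fc fge] := character_of_filter uz GP Gmax; exists f => //.
by apply: fge => //; case: GP.
Qed.

End CharacterExistence.

Lemma compact_set_type (T : topologicalType) (A : set T) :
  compact A -> compact [set: A].
Proof.
move=> cA G PG _.
have PG' : ProperFilter ((set_val : A -> T) @ G) by exact: fmap_proper_filter.
have [|p [Ap clp]] := cA ((set_val : A -> T) @ G) PG'.
  by apply: (@filterS _ G _ setT); [move=> x _; exact: set_valP|exact: filterT].
exists (exist _ p (mem_set Ap)); split=> // U V GU [W [[W' oW' <-] W'p WV]].
have [|_ [[z Uz <-] W'z]] := clp (set_val @` U) W' _ (open_nbhs_nbhs (conj oW' W'p)).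
  by apply: (@filterS _ G _ U) => // z Uz; exists z.
by exists z; split=> //; exact: WV.
Qed.

Lemma hausdorff_separated (R : realType) (T : topologicalType) :
  (forall p q : T, (forall f : T -> R, continuous f -> f p = f q) -> p = q) ->
  hausdorff_space T.
Proof.
move=> sep p q clpq; apply: sep => f cf; apply: (@Rhausdorff R) => A B fpA fqB.
have [x [Ax Bx]] := clpq _ _ (cf p A fpA) (cf q B fqB).
by exists (f x).
Qed.

Lemma closed_eq_fun (R : realType) (T : topologicalType) (f g : T -> R) :
  continuous f -> continuous g -> closed [set x | f x = g x].
Proof.
move=> cf cg.
have -> : [set x | f x = g x] = (fun x => f x - g x) @^-1` [set 0].
  by apply/seteqP; split=> x /= => [->|/subr0_eq]//; rewrite subrr.
apply: closed_comp; last exact: closed_eq.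
by move=> x _; apply: continuousB; [exact: cf|exact: cg].
Qed.

(** * The compact space of characters of a principal ideal *)

Section Spectrum.
Variables (R : realType) (F : vectorLatticeType R).

Definition pcone := {u : F | 0 <= u}.

Definition characters (u : pcone) : set {ptws F -> R} :=
  [set phi | is_character (\val u) phi].

Definition spectrum (u : pcone) : Type := set_type (characters u).

HB.instance Definition _ (u : pcone) :=
  Topological.copy (spectrum u) (set_type (characters u)).

Definition chi (u : pcone) (phi : spectrum u) : F -> R := set_val phi.

Lemma ptws_eval_continuous (x : F) : continuous (fun phi : {ptws F -> R} => phi x).
Proof. exact: (@proj_continuous F (fun=> R) x). Qed.

Variable u : pcone.
Local Notation u0 := (valP u).
Local Notation ideal := (in_ideal (\val u)).
Implicit Types (phi psi : spectrum u) (x y : F).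

Lemma chi_continuous x : continuous (fun phi : spectrum u => chi phi x).
Proof.
move=> phi; apply: (@continuous_comp _ _ _ (set_val : characters u -> _)
  (fun f : {ptws F -> R} => f x)); last exact: ptws_eval_continuous.
exact: initial_continuous.
Qed.

Lemma chiP phi : is_character (\val u) (chi phi).
Proof. exact: (set_valP phi). Qed.

Lemma chi_inj phi psi : (forall x, chi phi x = chi psi x) -> phi = psi.
Proof. by move=> h; apply: val_inj; apply/funext => x; exact: h. Qed.

Lemma chi_ge0 phi x : ideal x -> 0 <= x -> 0 <= chi phi x.
Proof.
move=> ux x0; have [_ _ _ HZ Hs] := chiP phi.
have u00 := in_ideal0 (\val u).
have h0 : chi phi 0 = 0 by have := HZ 0 0 u00; rewrite scale0r mul0r.
by rewrite -(vsup_l x0) Hs// h0 le_max lexx orbT.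
Qed.

Lemma chiN phi x : ideal x -> chi phi (- x) = - chi phi x.
Proof. by move=> ux; have [_ _ _ HZ _] := chiP phi; rewrite -scaleN1r HZ// mulN1r. Qed.

Lemma chiB phi x y : ideal x -> ideal y -> chi phi (x - y) = chi phi x - chi phi y.
Proof.
move=> ux uy; have [_ _ HD _ _] := chiP phi.
by rewrite HD ?chiN//; exact: in_idealN.
Qed.

Lemma chi_homo phi x y : ideal x -> ideal y -> x <= y -> chi phi x <= chi phi y.
Proof.
move=> ux uy xy; rewrite -subr_ge0 -chiB// chi_ge0 ?subv_ge0//.
by apply: in_idealD => //; exact: in_idealN.
Qed.

Lemma chi_bound phi x (r : R) : ideal x -> vabs x <= r *: \val u -> `|chi phi x| <= r.
Proof.
move=> ux; rewrite vabs_le => /andP[h1 h2]; have [Hu _ _ HZ _] := chiP phi.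
have uu := in_ideal_unit u0; have iru := in_idealZ r uu.
have e : chi phi (r *: \val u) = r by rewrite HZ// Hu mulr1.
rewrite ler_norml lerNl -chiN// -e.
apply/andP; split; apply: chi_homo => //; exact: in_idealN.
Qed.

Lemma chi_vinf phi x y : ideal x -> ideal y ->
  chi phi (vinf x y) = Num.min (chi phi x) (chi phi y).
Proof.
move=> ux uy; have [_ _ _ _ Hs] := chiP phi.
rewrite vinf_vsup chiN; last by apply: in_ideal_vsup; exact: in_idealN.
by rewrite Hs ?oppr_max ?chiN// ?opprK//; exact: in_idealN.
Qed.

Lemma closed_is_character (T : topologicalType) (e : F -> T -> R) :
  (forall x, continuous (e x)) -> closed [set s | is_character (\val u) (e ^~ s)].
Proof.
move=> ce.
have -> : [set s | is_character (\val u) (e ^~ s)] =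
  [set s | e (\val u) s = 1] `&`
  \bigcap_(x in [set x | ~ ideal x]) [set s | e x s = 0] `&`
  \bigcap_(xy in [set xy | ideal xy.1 /\ ideal xy.2])
    [set s | e (xy.1 + xy.2) s = e xy.1 s + e xy.2 s] `&`
  \bigcap_(cx in [set cx : R * F | ideal cx.2])
    [set s | e (cx.1 *: cx.2) s = cx.1 * e cx.2 s] `&`
  \bigcap_(xy in [set xy | ideal xy.1 /\ ideal xy.2])
    [set s | e (vsup xy.1 xy.2) s = Num.max (e xy.1 s) (e xy.2 s)].
  apply/seteqP; split=> s.
    move=> [h1 h2 h3 h4 h5]; split; last by move=> [x y] /= [ux uy]; exact: h5.
    split; last by move=> [c x] /= ux; exact: h4.
    by split=> [|[x y] /= [ux uy]]; [split|exact: h3].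
  move=> [[[[h1 h2] h3] h4] h5]; split => //.
  - by move=> x y ux uy; exact: (h3 (x, y)).
  - by move=> c x ux; exact: (h4 (c, x)).
  - by move=> x y ux uy; exact: (h5 (x, y)).
apply: closedI; last first.
  apply: closed_bigI => xy _; apply: closed_eq_fun => [|s]; first exact: ce.
  by apply: continuous_max; exact: ce.
apply: closedI; last first.
  apply: closed_bigI => cx _; apply: closed_eq_fun => [|s]; first exact: ce.
  by apply: continuousM; [exact: cst_continuous|exact: ce].
apply: closedI; last first.
  apply: closed_bigI => xy _; apply: closed_eq_fun => [|s]; first exact: ce.
  by apply: continuousD; exact: ce.
apply: closedI; last first.
  apply: closed_bigI => x _; apply: closed_eq_fun; first exact: ce.
  by move=> s; exact: cst_continuous.
apply: closed_eq_fun; first exact: ce.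
by move=> s; exact: cst_continuous.
Qed.

Lemma characters_closed : closed (characters u).
Proof. exact: (closed_is_character ptws_eval_continuous). Qed.

Lemma spectrum_compact : compact [set: spectrum u].
Proof.
apply: compact_set_type.
(* On the ideal, |x| <= (r x) u bounds every character at x by [r x]; off the ideal, characters are
   0 and so is [r x]. Characters thus lie in a product of segments. *)
pose r x : R := if pselect (ideal x) is left h then s2val (cid2 h) else 0.
apply: (@subclosed_compact _ _ [set phi : {ptws F -> R} | forall x, `[- r x, r x]%classic (phi x)]).
- exact: characters_closed.
- by apply: (@tychonoff F (fun=> R) (fun x => `[- r x, r x]%classic)) => x; exact: segment_compact.
move=> phi phic x /=; rewrite in_itv/= -ler_norml /r; case: pselect => [h|nh].
  have := @chi_bound (exist _ phi (mem_set phic)) x (s2val (cid2 h)) h.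
  by apply; case: cid2.
by have [_ -> //] := phic; rewrite normr0.
Qed.

Lemma spectrum_hausdorff : hausdorff_space (spectrum u).
Proof.
apply: (@hausdorff_separated R) => phi psi h; apply: chi_inj => x.
by apply: (h (fun phi => chi phi x)); exact: chi_continuous.
Qed.

HB.instance Definition _ := isCompactHausdorff.Build (spectrum u)
  spectrum_compact spectrum_hausdorff.

Definition gelfand x : cfun R (spectrum u) := mkcfun (@chi_continuous x).

Lemma gelfandE x phi : gelfand x phi = chi phi x :> R. Proof. by []. Qed.

End Spectrum.

(** * The Gelfand transform onto continuous functions *)

Section Kakutani.
Variables (R : realType) (F : vectorLatticeType R).
Hypotheses (F_arch : archimedean_vl F) (F_ru : ru_complete F).

Lemma archimedean_le0 (z v : F) : 0 <= v ->
  (forall e : R, 0 < e -> z <= e *: v) -> z <= 0.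
Proof.
move=> v0 h; have [_] := F_arch v0; apply => _ [n _ <-].
by apply: h; rewrite invr_gt0.
Qed.

Variable u : pcone F.
Local Notation u0 := (valP u).
Local Notation ideal := (in_ideal (\val u)).
Implicit Types (phi psi s t k : spectrum u) (x y : F) (f : cfun R (spectrum u)).

(** Were x^- not below e u, some character would be at least [e] at x^-; but a character nonnegative
    at x vanishes at x^-. The Archimedean property then lets [e] tend to 0. *)
Lemma gelfand_ge0 x : ideal x -> (forall phi, 0 <= chi phi x) -> 0 <= x.
Proof.
move=> ux h; have uu := in_ideal_unit u0.
have un : ideal (vneg x) by rewrite vneg_vpos; apply/in_ideal_vpos/in_idealN.
suff nx : vneg x <= 0.
  rewrite -(vpos_vneg x) (_ : vneg x = 0) ?subr0 ?vpos_ge0//.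
  by apply/le_anti; rewrite nx vneg_ge0.
apply: (archimedean_le0 u0) => e e0.
suff /eqP E : vpos (vneg x - e *: \val u) == 0.
  have : vneg x - e *: \val u <= 0 by rewrite -[leRHS]E le_vsupl.
  by rewrite lev_subl_addr add0r.
apply: contraT => n0.
have [f fc fe] := character_separates u0 un (ltW e0) n0.
pose phi : spectrum u := exist _ f (mem_set fc).
have [_ _ _ _ Hs] := fc.
have : f (vneg x) = 0.
  rewrite vneg_vpos /vpos Hs; [|exact: in_idealN|exact: in_ideal0].
  have fN : f (- x) = - f x := chiN phi ux; have fx : 0 <= f x := h phi.
  rewrite fN.
  have -> : f 0 = 0 by have [_ _ _ HZ _] := fc; have := HZ 0 0 (in_ideal0 _); rewrite scale0r mul0r.
  by rewrite max_r// oppr_le0.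
by move=> E; move: fe; rewrite E leNgt e0.
Qed.

Lemma gelfand_le x y : ideal x -> ideal y ->
  (forall phi, chi phi x <= chi phi y) -> x <= y.
Proof.
move=> ux uy h; rewrite -subv_ge0; apply: gelfand_ge0.
  by apply: in_idealD => //; exact: in_idealN.
by move=> phi; rewrite chiB// subr_ge0.
Qed.

Lemma gelfand_inj x y : ideal x -> ideal y ->
  (forall phi, chi phi x = chi phi y) -> x = y.
Proof. by move=> ux uy h; apply/le_anti/andP; split; apply: gelfand_le => // phi; rewrite h. Qed.

(** Distinct characters differ at some y in the ideal and are 1 at u, so a combination of y and u
    takes prescribed values. The case s = t is included to spare its users a distinction. *)
Lemma interpolate (c d : R) s t : (s = t -> c = d) ->
  exists x, [/\ ideal x, chi s x = c & chi t x = d].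
Proof.
move=> cd; have uu := in_ideal_unit u0.
have [su _ sD sZ _] := chiP s; have [tu _ tD tZ _] := chiP t.
have [st|st] := pselect (s = t).
  exists (c *: \val u); split; [exact: in_idealZ|by rewrite sZ// su mulr1|].
  by rewrite tZ// tu mulr1 cd.
have [y ny] : exists y, chi s y <> chi t y.
  by apply/existsNP => h; apply: st; exact: chi_inj.
have uy : ideal y.
  apply: contrapT => nuy; apply: ny; have [_ s0 _ _ _] := chiP s.
  by have [_ t0 _ _ _] := chiP t; rewrite s0// t0.
have dn0 : chi s y - chi t y != 0 by apply/eqP => /subr0_eq.
pose a := (c - d) / (chi s y - chi t y); pose b := c - a * chi s y.
have ay := in_idealZ a uy; have bu := in_idealZ b uu.
exists (a *: y + b *: \val u); split; first exact: in_idealD.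
  by rewrite sD// !sZ// su mulr1 /b; lra.
rewrite tD// !tZ// tu mulr1 /b.
have : a * (chi s y - chi t y) = c - d by rewrite divfK.
by rewrite mulrBr; lra.
Qed.

(** First half of the lattice Stone-Weierstrass argument: elements matching [f] at [s] and at [t]
    exceed f - e near [t]; by compactness a finite supremum does so everywhere, keeping the value at
    [s]. *)
Lemma upper_approx f (e : R) s : 0 < e -> exists x,
  [/\ ideal x, chi s x = f s & forall k, (f k : R) - e < chi k x].
Proof.
move=> e0.
have /choice[X XP] t : exists x, [/\ ideal x, chi s x = f s & chi t x = f t].
  by apply: interpolate => ->.
have oU t : open [set k | 0 < chi k (X t) - f k + e].
  exact: cfun_open_gt (gelfand u (X t) - f + ccst e) 0.
have [|l lP] := compact_subcover (@compactT (spectrum u)) oU.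
  move=> k _; exists k => //=.
  by have [_ _ ->] := XP k; rewrite subrr add0r.
pose x := foldr (fun t => vsup (X t)) (X s) l.
have [ux xs xge] : [/\ ideal x, chi s x = f s &
    forall t k, t \in l -> chi k (X t) <= chi k x].
  rewrite /x; elim: l {lP x} => [|t l [ux xs xge]] /=; first by have [] := XP s.
  have [ut st _] := XP t; split; first exact: in_ideal_vsup.
    by have [_ _ _ _ ->//] := chiP s; rewrite st xs maxxx.
  move=> t' k; rewrite inE; have [_ _ _ _ ->//] := chiP k.
  by move=> /predU1P[->|/xge h]; rewrite le_max ?lexx ?h ?orbT.
exists x; split=> // k; have [t tl] := lP k I.
move=> /= h; apply: (lt_le_trans _ (xge _ k tl)).
by move: (chi k (X t)) (f k : R) h => a b; lra.
Qed.

(** Second half: by compactness, a finite infimum of upper approximations for varying [s] also stays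
    below f + e. *)
Lemma gelfand_dense f (e : R) : 0 < e -> exists2 x, ideal x &
  forall k, `|chi k x - f k| <= e.
Proof.
move=> e0; have [[s0 _]|nos] := pselect (exists _ : spectrum u, True); last first.
  by exists 0 => [|k]; [exact: in_ideal0|case: nos; exists k].
have /choice[X XP] s := upper_approx f s e0.
have oV s : open [set k | 0 < (f k : R) - chi k (X s) + e].
  exact: cfun_open_gt (f - gelfand u (X s) + ccst e) 0.
have [|l lP] := compact_subcover (@compactT (spectrum u)) oV.
  move=> k _; exists k => //=.
  by have [_ -> _] := XP k; rewrite subrr add0r.
pose x := foldr (fun t => vinf (X t)) (X s0) l.
have [ux xge xle] : [/\ ideal x, forall k, (f k : R) - e < chi k x &
    forall t k, t \in l -> chi k x <= chi k (X t)].
  rewrite /x; elim: l {lP x} => [|t l [ux xge xle]] /=; first by have [] := XP s0.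
  have [ut _ tge] := XP t; split; first exact: in_ideal_vinf.
    by move=> k; rewrite chi_vinf// lt_min tge xge.
  move=> t' k; rewrite inE chi_vinf//.
  by move=> /predU1P[->|/xle h]; rewrite ge_min ?lexx ?h ?orbT.
exists x => // k; have [t tl] := lP k I; have := xle _ k tl; have := xge k.
move=> /= h1 h2 h3.
move: (chi k (X t)) (chi k x) (f k : R) h1 h2 h3 => a b c *.
by rewrite ler_norml; apply/andP; split; lra.
Qed.

(** As characters detect the order, uniform approximations of [f] are relatively uniformly Cauchy
    with regulator u, and completeness of [F] provides the preimage. *)
Lemma gelfand_surj f : exists2 x, ideal x & forall k, chi k x = f k.
Proof.
have uu := in_ideal_unit u0.
have /choice[X XP] (n : nat) : exists x, ideal x /\ forall k, `|chi k x - f k| <= n.+1%:R^-1.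
  by have [|x ux h] := @gelfand_dense f n.+1%:R^-1; [rewrite invr_gt0|exists x].
have uX n : ideal (X n) by have [] := XP n.
pose c (m n : nat) : R := m.+1%:R^-1 + n.+1%:R^-1.
have cu m n := in_idealZ (c m n) uu.
have dist1 m n : X m - X n <= c m n *: \val u.
  apply: gelfand_le => //; first by apply: in_idealD => //; exact: in_idealN.
  move=> k; rewrite chiB//; have [ku _ _ kZ _] := chiP k; rewrite kZ// ku mulr1 /c.
  have := (XP m).2 k; have := (XP n).2 k.
  move: (chi k (X m)) (chi k (X n)) (f k : R) (m.+1%:R^-1 : R) (n.+1%:R^-1 : R).
  by move=> A B C D E; rewrite !ler_norml => /andP[? ?] /andP[? ?]; lra.
have dist m n : vabs (X m - X n) <= c m n *: \val u.
  have cC : c m n = c n m by rewrite /c addrC.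
  by rewrite vabs_le dist1 opprB cC dist1.
have inv_small (e : R) : 0 < e -> exists N, forall n, (N <= n)%N -> n.+1%:R^-1 <= e.
  move=> e0; exists (Num.truncn e^-1) => n Nn.
  rewrite -[e]invrK lef_pV2 ?posrE ?invr_gt0// (le_trans (ltW (truncnS_gt _)))//.
  by rewrite ler_nat ltnS.
have [|l [v v0 vl]] := F_ru (x := X).
  exists (\val u); first exact: u0.
  move=> e e0; have e20 : 0 < e / 2 by rewrite divr_gt0.
  have [N HN] := inv_small _ e20; exists N => m n Nm Nn.
  rewrite (le_trans (dist m n))//; apply: lev_scale2r; first exact: u0.
  by rewrite /c (le_trans (lerD (HN _ Nm) (HN _ Nn)))// -splitr.
(* The regulator [v] of the limit need not lie in the ideal of [u]. The Archimedean property removes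
   it, and the bound by [u] alone puts [l] in the ideal. *)
have close n : vabs (X n - l) <= n.+1%:R^-1 *: \val u.
  suff H y : (forall e : R, 0 < e -> y <= n.+1%:R^-1 *: \val u + e *: (\val u + v)) ->
      y <= n.+1%:R^-1 *: \val u.
    have step (e : R) : 0 < e -> exists m, m.+1%:R^-1 <= e /\ vabs (X m - l) <= e *: v.
      move=> e0; have [N HN] := inv_small e e0; have [M HM] := vl e e0.
      exists (maxn N M).
      by split; [apply: HN; exact: leq_maxl|apply: HM; exact: leq_maxr].
    have bnd (a b : F) m (e : R) : m.+1%:R^-1 <= e -> a <= c n m *: \val u ->
        b <= e *: v -> a + b <= n.+1%:R^-1 *: \val u + e *: (\val u + v).
      move=> me ha hb; rewrite scalerDr addrA lev_add// (le_trans ha)//.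
      by rewrite /c scalerDl lev_add2lE; exact: lev_scale2r u0 me.
    rewrite vabs_le; apply/andP; split; apply: H => e e0.
      have [m [me]] := step e e0; rewrite vabs_le => /andP[h1 _].
      by have := bnd _ _ m e me (dist1 n m) h1; rewrite addrA subrK.
    have [m [me]] := step e e0; rewrite vabs_le opprB => /andP[_ h1].
    have := dist n m; rewrite vabs_le opprB => /andP[_ h2].
    by have := bnd _ _ m e me h2 h1; rewrite opprB addrC addrA subrK.
  move=> h; rewrite -[leRHS]add0r -lev_subl_addr.
  apply: (archimedean_le0 (addv_ge0 u0 v0)) => e e0.
  by rewrite lev_subl_addr addrC; exact: h.
have ul : ideal l.
  have -> : l = X 0%N - (X 0%N - l) by rewrite opprB addrC subrK.
  apply: in_idealD => //; apply: in_idealN; exists 1%:R^-1 => //; exact: close.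
exists l => // k; apply/eqP; rewrite -subr_eq0 -normr_le0; apply/ler_addgt0Pr => e e0.
rewrite add0r; have e20 : 0 < e / 2 by rewrite divr_gt0.
have [N HN] := inv_small _ e20.
have h1 := (XP N).2 k; have h2 := chi_bound k (in_idealD (uX N) (in_idealN ul)) (close N).
have h3 := HN N (leqnn _); rewrite chiB// in h2.
move: (chi k (X N)) (chi k l) (f k : R) (N.+1%:R^-1 : R) h1 h2 h3 => a b d g.
by rewrite !ler_norml => /andP[? ?] /andP[? ?] ?; apply/andP; split; lra.
Qed.

End Kakutani.

Lemma ptws_continuous (R : realType) (S : Type) (T : topologicalType)
    (g : T -> {ptws S -> R}) :
  (forall x, continuous (fun z => g z x)) -> continuous g.
Proof.
move=> cg z; apply/cvg_sup => x U [W [[V oV <-] /= Vgz VU]].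
apply: filterS VU _; apply: (cg x z); exact: open_nbhs_nbhs.
Qed.

Lemma spectrum_continuous (R : realType) (F : vectorLatticeType R) (u : pcone F)
    (T : topologicalType) (g : T -> spectrum u) :
  (forall x, continuous (fun z => chi (g z) x)) -> continuous g.
Proof.
move=> cg; apply: (@continuous_comp_initial _ _ _ (set_val : characters u -> _)).
by apply: ptws_continuous => x; exact: cg.
Qed.

Section KakutaniRepresentation.
Variables (R : realType) (F : vectorLatticeType R).
Hypotheses (F_arch : archimedean_vl F) (F_ru : ru_complete F).
Implicit Types (u v : pcone F) (x y : F).

Let surj u f := @gelfand_surj R F F_arch F_ru u f.

(** The inverse of the Gelfand transform; by [gelfand_inj] the chosen preimage is the only one. *)
Definition from_spectrum u (f : cfun R (spectrum u)) : F := s2val (cid2 (surj f)).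
Local Notation j := from_spectrum.

Lemma from_spectrum_ideal u (f : cfun R (spectrum u)) : in_ideal (\val u) (j f).
Proof. by rewrite /from_spectrum; case: cid2. Qed.

Lemma chi_from_spectrum u (f : cfun R (spectrum u)) phi : chi phi (j f) = f phi.
Proof. by rewrite /from_spectrum; case: cid2. Qed.

Lemma gelfandK u x : in_ideal (\val u) x -> j (gelfand u x) = x.
Proof.
move=> ux; apply: (gelfand_inj F_arch (from_spectrum_ideal _) ux) => phi.
exact: chi_from_spectrum.
Qed.

Lemma from_spectrum_emb u : ideal_embedding (@from_spectrum u).
Proof.
have iJ := @from_spectrum_ideal u; split=> [a f g|f g|f y y0 yf].
- apply: (gelfand_inj F_arch) => //.
    by apply: in_idealD => //; exact: in_idealZ.
  move=> phi; have [_ _ HD HZ _] := chiP phi.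
  by rewrite HD ?HZ ?chi_from_spectrum//; exact: in_idealZ.
- apply/idP/idP => [h|/cfun_leP fg].
    by apply/cfun_leP => phi; rewrite -!chi_from_spectrum chi_homo.
  by apply: (gelfand_le F_arch) => // phi; rewrite !chi_from_spectrum.
- by exists (gelfand u y); rewrite gelfandK//; apply: in_ideal_le (iJ f).
Qed.

Definition pcone_le u v : Prop := \val u <= \val v.

Lemma pcone_directed : directed_set pcone_le.
Proof.
split; [by exists (exist _ 0 (lexx 0))|by move=> u; exact: lexx| |].
  by move=> u v k; exact: le_trans.
move=> u v; exists (exist _ (\val u + \val v) (addv_ge0 (valP u) (valP v))).
split; rewrite /pcone_le /=.
  by rewrite -[leLHS]addr0 lev_add2lE; exact: valP.
by rewrite -[leLHS]add0r lev_add2rE; exact: valP.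
Qed.

Lemma in_ideal_pcone_le u v x : pcone_le u v -> in_ideal (\val u) x -> in_ideal (\val v) x.
Proof.
move=> uv [r r0 xr]; exists r => //; rewrite (le_trans xr)//.
exact: lev_wpscale.
Qed.

Lemma from_spectrum_incr u v : pcone_le u v -> forall f, exists g, @from_spectrum u f = @from_spectrum v g.
Proof.
move=> uv f; exists (gelfand v (j f)); rewrite gelfandK//.
exact/(in_ideal_pcone_le uv)/from_spectrum_ideal.
Qed.

Lemma from_spectrum_cover x : exists u f, x = @from_spectrum u f.
Proof.
exists (exist _ (vabs x) (vabs_ge0 x)), (gelfand _ x); rewrite gelfandK//=.
by exists 1; rewrite ?scale1r.
Qed.

Section Restriction.
Variables (u v : pcone F).
Hypothesis uv : pcone_le u v.

Local Notation iu := (in_ideal (\val u)).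
Local Notation iv := (in_ideal (\val v)).

Let iuv x : iu x -> iv x. Proof. exact: in_ideal_pcone_le. Qed.
Let iuu : iu (\val u). Proof. exact/in_ideal_unit/(valP u). Qed.

Definition weight (phi : spectrum v) : R := chi phi (\val u).

Lemma weight_continuous : continuous weight.
Proof. exact: chi_continuous. Qed.

Lemma weight_ge0 phi : 0 <= weight phi.
Proof. by apply: chi_ge0; [exact: iuv|exact: (valP u)]. Qed.

Let Z := cozero weight.

Let weight_gt0 (z : Z) : 0 < weight (\val z).
Proof. by rewrite lt_def weight_ge0 andbT; exact: (set_valP z). Qed.

Definition restrict_char (phi : spectrum v) : F -> R :=
  fun x => if `[< iu x >] then chi phi x / weight phi else 0.

Lemma restrict_char_in phi x : iu x -> restrict_char phi x = chi phi x / weight phi.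
Proof. by move=> ux; rewrite /restrict_char asboolT. Qed.

Lemma restrict_charP (z : Z) : is_character (\val u) (restrict_char (\val z)).
Proof.
have [_ _ HD HZ Hs] := chiP (\val z); have w0 := weight_gt0 z.
split=> [|x nux|x y ux uy|c x ux|x y ux uy].
- by rewrite restrict_char_in// divff// gt_eqF.
- by rewrite /restrict_char asboolF.
- by rewrite !restrict_char_in ?HD ?mulrDl//; [exact: iuv|exact: iuv|exact: in_idealD].
- by rewrite !restrict_char_in ?HZ ?mulrA//; [exact: iuv|exact: in_idealZ].
- rewrite !restrict_char_in ?Hs//; [|exact: iuv|exact: iuv|exact: in_ideal_vsup].
  by rewrite maxr_pMl// invr_ge0 ltW.
Qed.

Definition restriction (z : Z) : spectrum u :=
  exist _ (restrict_char (\val z)) (mem_set (restrict_charP z)).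

Lemma chi_restriction z x : iu x -> chi (restriction z) x = chi (\val z) x / weight (\val z).
Proof. exact: restrict_char_in. Qed.

Let Y := range restriction.

Definition restrictY (z : Z) : Y := exist _ (restriction z) (mem_set (imageT restriction z)).

Lemma restrictY_continuous : continuous restrictY.
Proof.
apply: (@continuous_comp_initial _ _ _ (set_val : Y -> spectrum u)).
apply: spectrum_continuous => x.
have [ux|nux] := pselect (iu x); last first.
  rewrite (_ : (fun z => _) = cst 0); first by move=> z; exact: cst_continuous.
  apply/funext => z; rewrite -[LHS]/(restrict_char (\val z) x).
  by rewrite /restrict_char asboolF.
rewrite (_ : (fun z => _) = fun z : Z => chi (\val z) x / weight (\val z)); last first.
  by apply/funext => z; rewrite -chi_restriction.
have cv : continuous (set_val : Z -> spectrum v) := @initial_continuous Z _ set_val.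
move=> z.
have h1 : {for z, continuous ((fun phi : spectrum v => chi phi x) \o (set_val : Z -> _))}.
  by apply: continuous_comp; [exact: cv|exact: chi_continuous].
have h2 : {for z, continuous (weight \o (set_val : Z -> _))}.
  by apply: continuous_comp; [exact: cv|exact: weight_continuous].
by apply: (continuousM h1 (continuousV _ h2)); rewrite gt_eqF// weight_gt0.
Qed.

End Restriction.

End KakutaniRepresentation.

(** * Restriction of characters *)

Section RestrictionHomeomorphism.
Variables (R : realType) (F : vectorLatticeType R).
Hypotheses (F_arch : archimedean_vl F) (F_ru : ru_complete F).
Variables (u v : pcone F).
Hypothesis uv : pcone_le u v.
Implicit Types (x y : F).

Local Notation iu := (in_ideal (\val u)).
Local Notation iv := (in_ideal (\val v)).
Local Notation w := (@weight R F u v).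
Local Notation r := (restriction uv).
Local Notation Z := (cozero w).
Local Notation Y := (range (restriction uv)).

Let iuv x : iu x -> iv x. Proof. exact: in_ideal_pcone_le. Qed.
Let iuu : iu (\val u). Proof. exact/in_ideal_unit/(valP u). Qed.
Let ivv : iv (\val v). Proof. exact/in_ideal_unit/(valP v). Qed.
Let w_gt0 (z : Z) : 0 < w (\val z).
Proof. by rewrite lt_def (weight_ge0 uv) andbT; exact: (set_valP z). Qed.

(** Reduces claims about the values of characters to 0 <= x <= v, where [chi_recover] applies: an
    element of the ideal is a difference of positive ones, each a multiple of such an x. *)
Lemma character_induction (P : F -> Prop) : (forall x, ~ iv x -> P x) ->
  (forall x, 0 <= x -> x <= \val v -> P x) ->
  (forall (c : R) x, iv x -> P x -> P (c *: x)) ->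
  (forall x y, iv x -> iv y -> P x -> P y -> P (x - y)) -> forall x, P x.
Proof.
move=> Pout P1 PZ PB x; have [vx|] := pselect (iv x); last exact: Pout.
suff pos y : iv y -> 0 <= y -> P y.
  rewrite -(vpos_vneg x); apply: PB; try apply: pos; rewrite ?vpos_ge0 ?vneg_ge0//;
    by [exact: in_ideal_vpos|rewrite vneg_vpos; apply/in_ideal_vpos/in_idealN].
move=> vy y0; have [c c0] := vy; rewrite vabs_pos// => yc.
have c1 : 0 < c + 1 by rewrite ltr_wpDl.
have c10 : 0 <= (c + 1)^-1 by rewrite invr_ge0 ltW.
rewrite -[y](scale1r y) -(mulfV (lt0r_neq0 c1)) -scalerA.
apply: PZ; first exact: in_idealZ.
apply: P1; first exact: scalev_ge0.
rewrite -(lev_scaleE _ _ c1) scalerA mulfV ?gt_eqF// scale1r (le_trans yc)//.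
by apply: lev_scale2r; [exact: (valP v)|rewrite lerDl].
Qed.

Let trunc x (n : R) := vinf x (n *: \val u).

Let trunc_ideal x n : 0 <= n -> 0 <= x -> iu (trunc x n).
Proof.
move=> n0 x0; apply: (@in_ideal_le _ _ _ (n *: \val u)); last exact: in_idealZ.
  by rewrite le_vinf x0 scalev_ge0//; exact: (valP u).
exact: vinf_ler.
Qed.

Let chi_trunc z x n : 0 <= n -> 0 <= x -> iv x ->
  chi (r z) (trunc x n) = Num.min (chi (\val z) x) (n * w (\val z)) / w (\val z).
Proof.
move=> n0 x0 vx; rewrite chi_restriction; last exact: trunc_ideal.
rewrite chi_vinf//; last by apply: in_idealZ; exact: iuv.
by have [_ _ _ HZ _] := chiP (\val z); rewrite HZ//; exact: iuv.
Qed.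

Let chi_unit (phi : spectrum v) : chi phi (\val v) = 1.
Proof. by have [] := chiP phi. Qed.

(* On [{n w > 1}], a character of the larger ideal is recovered from its
   restriction through truncations by [n u]. *)
Let chi_recover z x n : 0 <= x -> x <= \val v -> 0 <= n -> 1 < n * w (\val z) ->
  chi (\val z) x = chi (r z) (trunc x n) / chi (r z) (trunc (\val v) n).
Proof.
move=> x0 xv n0 nw; have vx : iv x := in_ideal_le x0 xv ivv.
have x1 : chi (\val z) x <= 1 by rewrite -(chi_unit (\val z)) chi_homo.
rewrite !chi_trunc ?chi_unit//; last exact: (valP v).
rewrite !min_l ?(ltW nw)//; last exact: le_trans (ltW nw).
by rewrite div1r invrK divfK// gt_eqF.
Qed.

(** Reads the condition n w > 1 off the restricted character, which makes it an open condition on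
    [Y]. *)
Let trunc_lt z n : 0 <= n ->
  (chi (r z) (trunc (\val v) n) < n) = (1 < n * w (\val z)).
Proof.
move=> n0; rewrite chi_trunc ?chi_unit//; last exact: (valP v).
by rewrite ltr_pdivrMr// gt_min ltxx orbF.
Qed.

Lemma restriction_inj : injective r.
Proof.
move=> z1 z2 rz; apply: val_inj; apply: chi_inj.
(* Large enough that n w exceeds 1 at both points, so one recovery formula serves both. *)
pose n := 2 / w (\val z1) + 2 / w (\val z2).
have n0 : 0 <= n by rewrite addr_ge0// divr_ge0// ltW.
have n1 : 1 < n * w (\val z1).
  rewrite mulrDl divfK ?gt_eqF// (lt_le_trans (_ : 1 < 2 :> R)) ?ltr1n//.
  by rewrite lerDl mulr_ge0 ?divr_ge0 ?ltW.
have n2 : 1 < n * w (\val z2).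
  rewrite mulrDl addrC divfK ?gt_eqF// (lt_le_trans (_ : 1 < 2 :> R)) ?ltr1n//.
  by rewrite lerDl mulr_ge0 ?divr_ge0 ?ltW.
have [_ out1 _ HZ1 _] := chiP (\val z1); have [_ out2 _ HZ2 _] := chiP (\val z2).
apply: character_induction => [x nvx|x x0 xv|c x vx h|x y vx vy h1 h2].
- by rewrite out1// out2.
- by rewrite (chi_recover x0 xv n0 n1) (chi_recover x0 xv n0 n2) rz.
- by rewrite HZ1// HZ2// h.
- by rewrite !chiB// h1 h2.
Qed.

Let unrestrict_ex (y : Y) : exists z, r z = \val y.
Proof. by have [z _ <-] := set_valP y; exists z. Qed.

Definition unrestrict (y : Y) : Z := sval (cid (unrestrict_ex y)).

Lemma unrestrictK (y : Y) : r (unrestrict y) = \val y.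
Proof. by rewrite /unrestrict; case: cid. Qed.

(** Near y0 a fixed n works, by [trunc_lt]; the recovery formula is then a quotient of continuous
    functions of y whose denominator is nonzero at y0. *)
Lemma unrestrict_continuous : continuous unrestrict.
Proof.
apply: (@continuous_comp_initial _ _ _ (set_val : Z -> spectrum v)).
apply: spectrum_continuous.
have cvY : continuous (set_val : Y -> spectrum u) := @initial_continuous Y _ set_val.
have cchi x : continuous (fun y : Y => chi (\val y) x).
  move=> y.
  have : {for y, continuous ((fun phi : spectrum u => chi phi x) \o (set_val : Y -> _))}.
    by apply: continuous_comp; [exact: cvY|exact: chi_continuous].
  exact.
have cE x : (fun y : Y => chi ((set_val \o unrestrict) y) x) =
            (fun y : Y => chi (\val (unrestrict y)) x) by [].
apply: character_induction => [x nvx|x x0 xv|c x vx h|x x' vx vx' h1 h2].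
- rewrite (_ : (fun y : Y => _) = cst 0); first by move=> y; exact: cst_continuous.
  by apply/funext => y; have [_ out _ _ _] := chiP (\val (unrestrict y)); exact: out.
- move=> y0; rewrite cE; set z0 := unrestrict y0.
  pose n := 2 / w (\val z0).
  have n0 : 0 <= n by rewrite divr_ge0// ltW.
  have n1 : 1 < n * w (\val z0) by rewrite divfK ?gt_eqF// ltr1n.
  have recover (y : Y) : 1 < n * w (\val (unrestrict y)) -> chi (\val (unrestrict y)) x =
      chi (\val y) (trunc x n) / chi (\val y) (trunc (\val v) n).
    by move=> ny; rewrite (chi_recover x0 xv n0 ny) unrestrictK.
  have near_n : \forall y \near y0, 1 < n * w (\val (unrestrict y)).
    have lt0 : chi (\val y0) (trunc (\val v) n) < n by rewrite -unrestrictK trunc_lt.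
    have h : \forall y \near y0, chi (\val (y : Y)) (trunc (\val v) n) < n.
      exact: (cvgr_lt _ (@cchi (trunc (\val v) n) y0) n lt0).
    by apply: (@filterS _ _ (nbhs_filter y0)) h => y /=; rewrite -unrestrictK trunc_lt.
  have cq : {for y0, continuous (fun y : Y =>
      chi (\val y) (trunc x n) / chi (\val y) (trunc (\val v) n))}.
    apply: (continuousM (@cchi _ y0) (continuousV _ (@cchi _ y0))).
    rewrite -unrestrictK chi_trunc ?chi_unit//; last exact: (valP v).
    by rewrite min_l ?(ltW n1)// div1r invr_eq0 gt_eqF.
  rewrite /continuous_at [X in _ --> X](recover y0 n1).
  apply: cvg_trans cq; apply: (@near_eq_cvg _ _ _ (nbhs_filter y0)).
  by apply: (@filterS _ _ (nbhs_filter y0)) near_n => y ny; rewrite recover.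
- rewrite (_ : (fun y : Y => _) = fun y : Y => c * chi (\val (unrestrict y)) x); last first.
    by apply/funext => y; have [_ _ _ HZ _] := chiP (\val (unrestrict y)); exact: HZ.
  by move=> y; apply: continuousM; [exact: cst_continuous|exact: h].
- rewrite (_ : (fun y : Y => _) = fun y : Y =>
      chi (\val (unrestrict y)) x - chi (\val (unrestrict y)) x'); last first.
    by apply/funext => y; exact: chiB.
  by move=> y; apply: continuousB; [exact: h1|exact: h2].
Qed.

Lemma restrictY_homeomorphism : homeomorphism (restrictY uv).
Proof.
split; first exact: restrictY_continuous.
exists unrestrict; split; first exact: unrestrict_continuous.
- by move=> z; apply: restriction_inj; rewrite unrestrictK.
- by move=> y; apply: val_inj; rewrite /= unrestrictK.
Qed.

(** A function vanishing off [O] and equal to 1 at [psi0] comes from a nonzero x in the ideal of u.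
    Some character of the larger ideal is nonzero at x, hence at u, a multiple of which dominates
    |x|; its restriction is nonzero at x, so it lies in [O]. *)
Lemma restriction_dense : dense Y.
Proof.
move=> O [psi0 Opsi0] oO.
have cO : closed (~` O) by exact: open_closedC.
have c1 : closed [set psi0].
  exact: (accessible_closed_set1 (hausdorff_accessible (@hausdorffT (spectrum u)))).
have [|f [_ f0 f1]] := @urysohn_cfun R (spectrum u) _ _ cO c1.
  by apply/seteqP; split=> // psi [nO /= E]; apply: nO; rewrite E.
have [x ux xf] := gelfand_surj F_arch F_ru f.
have [phi phix] : exists phi : spectrum v, chi phi x <> 0.
  apply/existsNP => h; have x0 : x = 0.
    apply: (gelfand_inj F_arch (iuv ux) (in_ideal0 _)) => phi.
    have [_ _ _ HZ _] := chiP phi; have := HZ 0 0 (in_ideal0 _).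
    by rewrite scale0r mul0r => ->; exact: h.
  have [_ _ _ HZ _] := chiP psi0; have := HZ 0 0 (in_ideal0 _).
  rewrite scale0r mul0r -x0 xf f1// => /eqP; apply/negP.
  exact: oner_neq0.
have wphi : Z phi.
  apply/negP => /eqP w0; apply: phix; have [c c0 xc] := ux.
  have [_ _ _ HZ _] := chiP phi.
  have xcu : vabs x <= c *: \val u := xc.
  have bound y : iu y -> y <= c *: \val u -> chi phi y <= 0.
    move=> uy yc; rewrite -(mulr0 c) -w0 /weight -HZ; last exact: iuv.
    by apply: chi_homo yc; [exact: iuv|apply/in_idealZ/iuv].
  move: xcu; rewrite vabs_le => /andP[h1 h2]; apply/le_anti; rewrite bound//=.
  by rewrite -oppr_le0 -chiN ?bound//; [exact: in_idealN|exact: iuv].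
exists (r (exist _ phi (mem_set wphi))); split; last by exists (exist _ phi (mem_set wphi)).
apply: contrapT => /f0; rewrite -xf chi_restriction// => /eqP.
by rewrite mulf_eq0 invr_eq0 (negbTE wphi) orbF => /eqP.
Qed.

(** As [f] is bounded, the weight times f o [restrictY] extends by 0 to a continuous function,
    represented by some y in the ideal of v. The bound |y| <= |M| u puts y in the ideal of u, and
    its Gelfand transform there extends [f]. *)
Lemma restriction_Cstar_embedded : Cstar_embedded R Y.
Proof.
move=> f cf [M fM].
have cft : continuous (f \o restrictY uv).
  by move=> z; apply: continuous_comp; [exact: restrictY_continuous|exact: cf].
pose g := mkcfun (cozero_ext_continuous (@weight_continuous R F u v)
  (weight_ge0 uv) cft (fun z => fM (restrictY uv z))).
have [y vy yg] := gelfand_surj F_arch F_ru g.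
have uy : iu y.
  have Mu := in_idealZ `|M| (iuv iuu).
  have bnd (phi : spectrum v) : `|chi phi y| <= `|M| * w phi.
    rewrite yg /=; have [/cozero_ex[z <-]|nZ] := pselect (Z phi); last first.
      by rewrite cozero_ext_out// normr0 mulr_ge0//; exact: weight_ge0.
    rewrite cozero_ext_in normrM ger0_norm ?(weight_ge0 uv)// mulrC.
    rewrite ler_wpM2r ?(weight_ge0 uv)// (le_trans (fM _))//.
    exact: ler_norm.
  have chiM (phi : spectrum v) : chi phi (`|M| *: \val u) = `|M| * w phi.
    by have [_ _ _ HZ _] := chiP phi; rewrite HZ//; exact: iuv.
  apply/in_idealP; exists `|M| => //.
  split.
    apply: (gelfand_le F_arch vy Mu) => phi.
    by rewrite chiM (le_trans _ (bnd phi))// ler_norm.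
  apply: (gelfand_le F_arch (in_idealN vy) Mu) => phi.
  by rewrite chiM chiN// (le_trans _ (bnd phi))// -normrN ler_norm.
exists (gelfand u y); split; first exact: cfun_continuous.
move=> p; have [z _ zp] := set_valP p.
have -> : p = restrictY uv z by apply: val_inj.
rewrite gelfandE [\val _]/= chi_restriction// yg /= cozero_ext_in mulrAC divff ?mul1r//.
by rewrite gt_eqF.
Qed.

End RestrictionHomeomorphism.

(** * The inverse system of measures on the spectra *)

Section ToSystemOfMeasures.
Variables (R : realType) (F : vectorLatticeType R).
Hypotheses (F_arch : archimedean_vl F) (F_ru : ru_complete F).
Implicit Types u v : pcone F.

Local Notation j u := (@from_spectrum R F F_arch F_ru u).
Local Notation M u := (radonMeasure R (spectrum u)).

Definition restriction_wcomp u v (uv : pcone_le u v) :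
    cfun R (spectrum u) -> cfun R (spectrum v) :=
  wcomp (@weight_continuous R F u v) (weight_ge0 uv) (@restrictY_continuous R F u v uv).

(** A character of the larger ideal is its weight times its restriction on the ideal of u; where the
    weight is 0 it vanishes on that ideal. Both sides thus have the same Gelfand transform over
    v. *)
Lemma from_spectrum_wcomp u v (uv : pcone_le u v) f :
  j v (restriction_wcomp uv f) = j u f.
Proof.
have uf := from_spectrum_ideal F_arch F_ru f.
have vf := in_ideal_pcone_le uv uf.
rewrite -[RHS](gelfandK F_arch F_ru vf); congr (j v _); apply: cfun_eqP => phi.
rewrite gelfandE wcompE; have [/cozero_ex[z <-]|nZ] := pselect (cozero (@weight R F u v) phi).
  rewrite wcomp_fun_in -[f _](chi_from_spectrum F_arch F_ru) [\val (restrictY _ _)]/=.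
  by rewrite chi_restriction// mulrC divfK//; exact: (set_valP z).
rewrite wcomp_fun_out//; have [c _ fc] := uf; have w0 := cozeroN nZ.
apply/esym/eqP; rewrite -normr_le0.
have uv' : in_ideal (\val v) (\val u).
  by apply: (in_ideal_pcone_le uv); exact/in_ideal_unit/(valP u).
have chic : chi phi (c *: \val u) = 0.
  by have [_ _ _ HZ _] := chiP phi; rewrite HZ// [chi _ _]w0 mulr0.
move: fc; rewrite vabs_le => /andP[h1 h2]; rewrite ler_norml oppr0.
apply/andP; split.
  rewrite -oppr_le0 -chiN// -chic chi_homo//; [exact: in_idealN|exact: in_idealZ].
by rewrite -chic chi_homo//; exact: in_idealZ.
Qed.

Lemma restriction_push_ex v u (mu : M v) : exists nu : M u, forall uv : pcone_le u v,
  (forall A, borel (spectrum u) A ->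
     nu A = rint mu (tpre (restrictY uv) A) (@weight R F u v) :> R) /\
  riesz nu = adj (restriction_wcomp uv) (riesz mu).
Proof.
have [uv|//] := pselect (pcone_le u v); last by exists 0.
have [nu nuP] := wcomp_push (@weight_continuous R F u v) (weight_ge0 uv)
  (@restrictY_continuous R F u v uv) mu.
by exists nu => uv'; rewrite (Prop_irrelevance uv' uv).
Qed.

Definition restriction_push v u (mu : M v) : M u := sval (cid (restriction_push_ex u mu)).

Lemma restriction_pushE v u (uv : pcone_le u v) mu A : borel (spectrum u) A ->
  (restriction_push u mu A)%:E = radon_integral mu
    [set \val x | x in [set x : cozero (@weight R F u v) | A (\val (restrictY uv x))]]
    (@weight R F u v).
Proof.
move=> mA; have [pA _] := svalP (cid (restriction_push_ex u mu)) uv.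
rewrite /restriction_push pA//; apply/esym.
apply: (radon_integral_rint mu (mkcfun (@weight_continuous R F u v))).
exact: (tpre_borel (@weight_continuous R F u v) (weight_ge0 uv)
  (@restrictY_continuous R F u v uv)).
Qed.

Lemma riesz_restriction_push v u (uv : pcone_le u v) mu f :
  riesz (restriction_push u mu) f = riesz mu (restriction_wcomp uv f) :> R.
Proof.
have [_ E] := svalP (cid (restriction_push_ex u mu)) uv.
by rewrite [riesz _]E adjE//; [exact: wcomp_linear|exact: wcomp_ge0].
Qed.

Lemma system_exists (E : vectorLatticeType R) : lattice_isomorphic E (orderDual F) ->
  inverse_system (@NIVL R) (@pcone_le R F) (@restriction_push) /\
  exists q : forall u : pcone F, E -> M u,
    inverse_limit (@NVL R) (@pcone_le R F) (@restriction_push) q.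
Proof.
move=> [s s_hom s_bij]; have sI := bijective_lattice_hom_order_iso s_hom s_bij.
have pE u v : pcone_le u v -> forall mu f g, j u f = j v g ->
    riesz (restriction_push u mu) f = riesz mu g :> R.
  move=> uv mu f g; rewrite -(from_spectrum_wcomp uv) => /(ideal_embedding_inj _) <-.
    exact: riesz_restriction_push.
  exact: from_spectrum_emb.
have rex u (phi : orderDual F) : exists mu : M u, riesz mu = adj (j u) phi.
  by have [_ _] := @riesz_order_iso R (spectrum u); apply.
pose q u phi := sval (cid (rex u phi)).
have qE u phi f : riesz (q u phi) f = phi (j u f).
  have j_emb := from_spectrum_emb F_arch F_ru u.
  have [lj _ _] := j_emb; have [jpos _] := ideal_embedding_interval j_emb.
  by rewrite -(adjE lj jpos) -(svalP (cid (rex u phi))).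
have rI u : order_iso (@riesz R (spectrum u)) by exact: riesz_order_iso.
split.
  exact: (dual_inverse_system (rho := fun u => @riesz R (spectrum u))
    (@pcone_directed R F) (from_spectrum_emb F_arch F_ru)
    (from_spectrum_incr F_arch F_ru) rI pE).
exists (fun u => q u \o s); apply: inverse_limit_iso => //.
exact: (dual_inverse_limit (rho := fun u => @riesz R (spectrum u))
  (@pcone_directed R F) (from_spectrum_emb F_arch F_ru)
  (from_spectrum_incr F_arch F_ru) (from_spectrum_cover F_arch F_ru) rI pE qE).
Qed.

End ToSystemOfMeasures.

Theorem theorem6p25 (R : realType) (E : vectorLatticeType R) :
  (exists F : vectorLatticeType R,
     [/\ ru_complete F, archimedean_vl F & lattice_isomorphic E (orderDual F)])
  <->
  (exists (I : Type) (le : I -> I -> Prop) (K : I -> compactHausdorffType)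
          (p : forall b a, radonMeasure R (K b) -> radonMeasure R (K a)),
     [/\ inverse_system (@NIVL R) le p,
         forall a b, le a b ->
           exists (w : K b -> R) (Y : set (K a)) (t : cozero w -> Y),
             [/\ continuous w, forall x, 0 <= w x,
                 homeomorphism t, dense Y /\ Cstar_embedded R Y
               & forall (mu : radonMeasure R (K b)) (A : set (K a)),
                   borel (K a) A ->
                   (p b a mu A)%:E =
                   radon_integral mu [set \val x | x in [set x | A (\val (t x))]] w]
       & exists q : forall a, E -> radonMeasure R (K a),
           (forall a, normal_lattice_hom (q a)) /\
           inverse_limit (@NVL R) le p q]).
Proof.
split=> [[F [F_ru F_arch isoEF]]|[I [le [K [p [p_sys p_wcomp [q [_ q_lim]]]]]]]]; last first.
  exact: (predual_exists p_sys p_wcomp q_lim).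
have [p_sys [q q_lim]] := system_exists F_arch F_ru isoEF.
exists (pcone F), (@pcone_le R F), (@spectrum R F), (@restriction_push R F).
split=> //; last by exists q; split=> //; have [[]] := q_lim.
move=> u v uv; exists (@weight R F u v), (range (restriction uv)), (restrictY uv); split.
- exact: weight_continuous.
- exact: weight_ge0.
- exact: restrictY_homeomorphism.
- split; first exact: restriction_dense F_arch F_ru _ _ _.
  exact: restriction_Cstar_embedded.
- by move=> mu A; exact: restriction_pushE.
Qed.
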